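(* For $i=0,1$, let $g_i:\Delta\times\Omega\times\mathbb R^n\times\mathbb R^m\to\mathbb R^n$ and $\theta_i:\Delta\times\Omega^2\times\mathbb R^n\times\mathbb R^n\to\mathbb R^m$ satisfy the measurability, Lipschitz and growth hypotheses stated in the context. Moreover, suppose that (the derivatives below exist and) for all $y,y'\in\mathbb R^n$, $\gamma\in\mathbb R^m$, almost all $(t,s)\in\Delta$ and almost surely $\omega,\omega'\in\Omega$, $$(g_0)_\gamma(t,s,\omega,y,\gamma)\in\widehat{\mathbb M}^{n\times m}_+,\quad(\theta_0)_{y'}(t,s,\omega,\omega',y,y')\in\widehat{\mathbb M}^{m\times n}_+,\quad(g_0)_y(t,s,\omega,y,\gamma)\in\widehat{\mathbb M}^n_+,\quad(\theta_0)_y(t,s,\omega,\omega',y,y')\in\widehat{\mathbb M}^{m\times n}_+,$$ and $$g_1(t,s,\omega,y,\gamma)\ge g_0(t,s,\omega,y,\gamma),\qquad\theta_1(t,s,\omega,\omega',y,y')\ge\theta_0(t,s,\omega,\omega',y,y').$$ Let $\psi_i(\cdot)\in L^2_{\mathcal F_T}(0,T;\mathbb R^n)$ with $\psi_0(t)\le\psi_1(t)$ for all $t\in[0,T]$, a.s., and let $(Y_i(\cdot),Z_i(\cdot,\cdot))$ be the adapted M-solutions of $$Y_i(t)=\psi_i(t)+\int_t^Tg_i\big(t,s,Y_i(s),\Gamma_i(t,s,Y_i(s))\big)ds-\int_t^TZ_i(t,s)dW(s),\quad t\in[0,T],\ i=0,1,$$ where $\Gamma_i(t,s,Y_i(s))(\omega)=\int_\Omega\theta_i(t,s,\omega,\omega',Y_i(s,\omega),Y_i(s,\omega'))\mathbb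 P(d\omega')$. Then $$Y_0(t)\le Y_1(t),\qquad t\in[0,T],\ \text{a.s.}$$
   Context: Let $T>0$ and let $(\Omega,\mathcal F,\mathbb F,\mathbb P)$ be a complete filtered probability space on which a one-dimensional standard Brownian motion $W$ is defined, $\mathbb F=\{\mathcal F_t\}_{t\ge0}$ being its natural filtration augmented by all $\mathbb P$-null sets. $(\Omega^2,\mathcal F^2,\mathbb P^2)$ is the completion of the product of $(\Omega,\mathcal F,\mathbb P)$ with itself, and $\mathbb F^2=\{\mathcal F_t\otimes\mathcal F_t\}_{t\in[0,T]}$ (completed). Put $\Delta=\{(t,s)\in[0,T]^2: t\le s\}$. $L^2_{\mathcal F_T}(0,T;\mathbb R^n)$: $\mathcal F_T$-measurable (not necessarily adapted) processes with $\mathbb E\int_0^T|X(s)|^2ds<\infty$. An adapted M-solution is a pair $(Y,Z)$ with $Y$ $\mathbb F$-adapted, $\mathbb E\int_0^T|Y(t)|^2dt<\infty$, $Z(t,\cdot)$ $\mathbb F$-adapted for a.e. $t$, $\mathbb E\int_0^T\int_0^T|Z(t,s)|^2dsdt<\infty$, satisfying the equation in the Itô sense and $Y(t)=\mathbb EY(t)+\int_0^tZ(t,s)dW(s)$, $t\in[0,T]$. Hypotheses on $g_i,\theta_i$ (the paper's (H3)$_q$ for some $q\ge2$, specialised to coefficients not depending on $Z$): the maps are measurable; for all $(t,y,\gamma)$ the map $(s,\omega)\mapsto g_i(t,s,\omega,y,\gamma)$ is $\mathbb F$-progressively measurable on $[t,T]$; for all $(t,y,y')$ the map $(s,\omega,\omega')\mapsto\theta_i(t,s,\omega,\omega',y,y')$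 is $\mathbb F^2$-progressively measurable on $[t,T]$; and there is $L>0$ with $|g_i(t,s,\omega,y_1,\gamma_1)-g_i(t,s,\omega,y_2,\gamma_2)|\le L(|y_1-y_2|+|\gamma_1-\gamma_2|)$, $|g_i(t,s,\omega,y,\gamma)|\le L(1+|y|+|\gamma|)$, $|\theta_i(t,s,\omega,\omega',y_1,y_1')-\theta_i(t,s,\omega,\omega',y_2,y_2')|\le L(|y_1-y_2|+|y_1'-y_2'|)$, $|\theta_i(t,s,\omega,\omega',y,y')|\le L(1+|y|+|y'|)$. $\widehat{\mathbb M}^{n\times m}_+$: $n\times m$ real matrices with all entries nonnegative; $\widehat{\mathbb M}^n_+=\widehat{\mathbb M}^{n\times n}_+$. Vector inequalities are componentwise. Subscripts $y,\gamma,y'$ denote partial derivatives (Jacobians); for $\theta_0(t,s,\omega,\omega',\cdot,\cdot)$, subscript $y$ refers to the first and $y'$ to the second spatial argument. *)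

(* Defs.v *)
From HB Require Import structures.
From mathcomp Require Import all_boot all_order all_algebra.
From mathcomp Require Import all_classical all_reals all_analysis.

Set Implicit Arguments.
Unset Strict Implicit.
Unset Printing Implicit Defensive.

Import Order.TTheory GRing.Theory Num.Theory.
Import numFieldNormedType.Exports.

Local Open Scope classical_set_scope.
Local Open Scope ring_scope.

(* Vectors of R^n are row vectors of 'rV[R]_n. *)

(* 'rV[R]_n with its Borel sigma-algebra. *)
Notation borel_rV R n := (g_sigma_algebraType (@open 'rV[R]_n)).

Section vectors.
Context {R : realType}.

(* Euclidean norm; the library norm on 'rV[R]_n is the sup norm. *)
Definition enorm {n : nat} (x : 'rV[R]_n) : R :=
  Num.sqrt (\sum_(j < n) x 0 j ^+ 2).

Definition le_vec {n : nat} (x y : 'rV[R]_n) : Prop :=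
  forall j : 'I_n, x 0 j <= y 0 j.

Definition nonneg_mx {n m : nat} (A : 'M[R]_(n, m)) : Prop :=
  forall i j, 0 <= A i j.

(* All first order partial derivatives of f exist at x. *)
Definition has_jacobian {k l : nat} (f : 'rV[R]_k -> 'rV[R]_l) (x : 'rV[R]_k)
  : Prop := forall j : 'I_k, derivable f x (delta_mx 0 j).

(* The l x k matrix of partial derivatives (d f_i / d x_j); the library's
   'J f x is its transpose, since it acts on row vectors. *)
Definition jacobian_mx {k l : nat} (f : 'rV[R]_k -> 'rV[R]_l) (x : 'rV[R]_k)
  : 'M[R]_(l, k) := \matrix_(i, j) ('D_(delta_mx 0 j) f x) 0 i.

Definition vec_integral {d} {X : measurableType d} (mu : {measure set X -> \bar R})
    {n : nat} (D : set X) (f : X -> 'rV[R]_n) : 'rV[R]_n :=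
  \row_j (\int[mu]_(x in D) f x 0 j).

End vectors.

Section stochastic_basis.
Context {R : realType} {d : measure_display} {Omega : measurableType d}.
Variables (P : probability Omega R) (W : R -> {RV P >-> R}).

(* Natural filtration of W augmented by the P-null sets. *)
Definition bm_filtration (t : R) : set (set Omega) :=
  <<s [set A | (exists s B, [/\ 0 <= s <= t, measurable B & A = W s @^-1` B])
             \/ P.-negligible A] >>.

Definition increment (s t : R) (w : Omega) : R := W t w - W s w.

(* Standard Brownian motion; only the times t >= 0 are meaningful. *)
Record is_brownian_motion : Prop := {
  bm_start : {ae P, forall w, W 0 w = 0} ;
  bm_indep : forall s t, 0 <= s <= t -> forall A B,
    bm_filtration s A -> measurable B ->
    P (A `&` increment s t @^-1` B) =
    (P A * P (increment s t @^-1` B))%E ;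
  bm_normal : forall s t, 0 <= s < t -> forall B, measurable B ->
    P (increment s t @^-1` B) =
    normal_prob 0 (Num.sqrt (t - s)) B ;
  bm_continuous :
    {ae P, forall w, {within `[0, +oo[, continuous (fun t => W t w)}} }.

(* Given G on Omega, the sigma-algebra G (x) G on Omega^2 augmented by the null
   sets of the product measure.  For G := measurable it is the sigma-algebra of
   the completed product space; for G := F_t it is the filtration F^2. *)
Definition completed_square (G : set (set Omega)) : set (set (Omega * Omega)) :=
  <<s [set C | (exists A B, [/\ G A, G B & C = A `*` B])
             \/ (P \x P)%E.-negligible C] >>.

Definition bm_filtration2 (t : R) : set (set (Omega * Omega)) :=
  completed_square (bm_filtration t).

(* L^2_{F_T}(0,T;R^n): jointly measurable, not necessarily adapted. *)
Definition L2_process (T : R) {n : nat} (X : R -> Omega -> 'rV[R]_n) : Prop :=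
  @measurable_fun _ _ (R * g_sigma_algebraType (bm_filtration T))%type
    (borel_rV R n) ([set` `[0, T]] `*` setT) (fun p => X p.1 p.2) /\
  (\int[P]_w \int[lebesgue_measure]_(s in `[0%R, T])
     (enorm (X s w) ^+ 2)%:E < +oo)%E.

(* Simple adapted processes  sum_i xi_i 1_(t_i, t_i+1]  on [a, b]. *)
Record simple_process (a b : R) := SimpleProcess {
  sp_size : nat ;
  sp_time : nat -> R ;
  sp_coef : nat -> Omega -> R ;
  sp_first : sp_time 0%N = a ;
  sp_last : sp_time sp_size = b ;
  sp_mono : forall i, (i < sp_size)%N -> sp_time i <= sp_time i.+1 ;
  sp_adapted : forall i, (i < sp_size)%N ->
    @measurable_fun _ _ (g_sigma_algebraType (bm_filtration (sp_time i))) R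
      setT (sp_coef i) ;
  sp_bounded : exists M : R, forall i w, (i < sp_size)%N ->
    `|sp_coef i w| <= M }.

Definition sp_fun {a b : R} (S : simple_process a b) (s : R) (w : Omega) : R :=
  \sum_(i < sp_size S)
     sp_coef S i w * \1_(`]sp_time S i, sp_time S i.+1]%classic) s.

Definition sp_integral {a b : R} (S : simple_process a b) (w : Omega) : R :=
  \sum_(i < sp_size S)
     sp_coef S i w * (W (sp_time S i.+1) w - W (sp_time S i) w).

(* I is (a version of) the Ito integral of H over [a, b] with respect to W: the
   L^2(P)-limit of the integrals of simple adapted processes that converge to H
   in L^2([a, b] x Omega). *)
Definition is_ito_integral (a b : R) (H : R -> Omega -> R) (I : Omega -> R)
    : Prop :=
  measurable_fun [set: Omega] I /\
  exists S : nat -> simple_process a b,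
    ((fun k => \int[P]_w \int[lebesgue_measure]_(s in `[a, b])
        ((H s w - sp_fun (S k) s w) ^+ 2)%:E)%E @ \oo --> 0%E) /\
    ((fun k => \int[P]_w ((I w - sp_integral (S k) w) ^+ 2)%:E)%E
        @ \oo --> 0%E).

Definition is_ito_integral_vec (a b : R) {n : nat} (H : R -> Omega -> 'rV[R]_n)
    (I : Omega -> 'rV[R]_n) : Prop :=
  forall j : 'I_n, is_ito_integral a b (fun s w => H s w 0 j) (fun w => I w 0 j).

End stochastic_basis.

Definition Delta {R : realType} (T : R) : set (R * R) :=
  [set p | 0 <= p.1 /\ p.1 <= p.2 /\ p.2 <= T].

(* Progressive measurability on [t, T] with respect to a filtration Filt on an
   arbitrary set X (used with X := Omega and X := Omega^2). *)
Definition progressively_measurable {R : realType} {X : pointedType}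
    (Filt : R -> set (set X)) (t T : R) {n : nat} (f : R -> X -> 'rV[R]_n)
    : Prop :=
  forall tau, t <= tau <= T ->
    @measurable_fun _ _ (R * g_sigma_algebraType (Filt tau))%type
      (borel_rV R n) ([set` `[t, tau]] `*` setT) (fun p => f p.1 p.2).

Section mean_field_BSVIE.
Context {R : realType} {d : measure_display} {Omega : measurableType d}.
Variables (P : probability Omega R) (W : R -> {RV P >-> R}) (T : R) (n m : nat).

(* Coefficients are total functions; all hypotheses concern (t, s) in Delta. *)
Definition generator := R -> R -> Omega -> 'rV[R]_n -> 'rV[R]_m -> 'rV[R]_n.
Definition mf_coefficient :=
  R -> R -> Omega -> Omega -> 'rV[R]_n -> 'rV[R]_n -> 'rV[R]_m.

Record standing_hypotheses (g : generator) (theta : mf_coefficient) : Prop := {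
  g_measurable :
    @measurable_fun _ _ (R * R * Omega * borel_rV R n * borel_rV R m)%type
      (borel_rV R n) [set p | Delta T p.1.1.1]
      (fun p => g p.1.1.1.1 p.1.1.1.2 p.1.1.2 p.1.2 p.2) ;
  theta_measurable :
    @measurable_fun _ _
      (R * R * g_sigma_algebraType (completed_square P measurable)
         * borel_rV R n * borel_rV R n)%type
      (borel_rV R m) [set p | Delta T p.1.1.1]
      (fun p => theta p.1.1.1.1 p.1.1.1.2 p.1.1.2.1 p.1.1.2.2 p.1.2 p.2) ;
  g_progressive : forall t y gamma, 0 <= t <= T ->
    progressively_measurable (bm_filtration W) t T
      (fun s w => g t s w y gamma) ;
  theta_progressive : forall t y y', 0 <= t <= T ->
    progressively_measurable (bm_filtration2 W) t T
      (fun s (q : Omega * Omega) => theta t s q.1 q.2 y y') ;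
  lipschitz_growth : exists L : R, 0 < L /\ forall t s, Delta T (t, s) ->
    [/\ forall w y1 y2 gamma1 gamma2,
          enorm (g t s w y1 gamma1 - g t s w y2 gamma2)
            <= L * (enorm (y1 - y2) + enorm (gamma1 - gamma2)),
        forall w y gamma,
          enorm (g t s w y gamma) <= L * (1 + enorm y + enorm gamma),
        forall w w' y1 y2 y1' y2',
          enorm (theta t s w w' y1 y1' - theta t s w w' y2 y2')
            <= L * (enorm (y1 - y2) + enorm (y1' - y2')) &
        forall w w' y y',
          enorm (theta t s w w' y y') <= L * (1 + enorm y + enorm y')] }.

(* Gamma(t, s, Y(s))(w) *)
Definition mf_term (theta : mf_coefficient) (Y : R -> Omega -> 'rV[R]_n)
    (t s : R) (w : Omega) : 'rV[R]_m :=
  vec_integral P setT (fun w' => theta t s w w' (Y s w) (Y s w')).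

(* As Y and psi are elements of L^2 spaces of processes and Z(t, .) is adapted
   for almost every t only, the two equations are required for almost every t
   in [0, T], almost surely. *)
Record adapted_M_solution (psi : R -> Omega -> 'rV[R]_n) (g : generator)
    (theta : mf_coefficient) (Y : R -> Omega -> 'rV[R]_n)
    (Z : R -> R -> Omega -> 'rV[R]_n) : Prop := {
  Y_L2 : L2_process W T Y ;
  Y_adapted : forall t, 0 <= t <= T ->
    @measurable_fun _ _ (g_sigma_algebraType (bm_filtration W t))
      (borel_rV R n) setT (Y t) ;
  Z_measurable :
    @measurable_fun _ _ (R * R * g_sigma_algebraType (bm_filtration W T))%type
      (borel_rV R n) ([set` `[0, T]] `*` [set` `[0, T]] `*` setT)
      (fun p => Z p.1.1 p.1.2 p.2) ;
  Z_adapted : {ae lebesgue_measure, forall t : R, 0 <= t <= T ->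
    forall s, 0 <= s <= T ->
    @measurable_fun _ _ (g_sigma_algebraType (bm_filtration W s))
      (borel_rV R n) setT (Z t s)} ;
  Z_L2 : (\int[P]_w \int[lebesgue_measure]_(t in `[0%R, T])
            \int[lebesgue_measure]_(s in `[0%R, T])
              (enorm (Z t s w) ^+ 2)%:E < +oo)%E ;
  bsvie : {ae lebesgue_measure, forall t : R, 0 <= t <= T ->
    exists I : Omega -> 'rV[R]_n,
      is_ito_integral_vec W t T (Z t) I /\
      {ae P, forall w, Y t w = psi t w
         + vec_integral lebesgue_measure `[t, T]
             (fun s => g t s w (Y s w) (mf_term theta Y t s w))
         - I w}} ;
  M_condition : {ae lebesgue_measure, forall t : R, 0 <= t <= T ->
    exists I : Omega -> 'rV[R]_n,
      is_ito_integral_vec W 0 t (Z t) I /\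
      {ae P, forall w, Y t w = vec_integral P setT (Y t) + I w}} }.

End mean_field_BSVIE.

(* Main.v *)
Require Import Defs.
From HB Require Import structures.
From mathcomp Require Import all_boot all_order all_algebra.
From mathcomp Require Import all_classical all_reals all_analysis.
From mathcomp Require Import measurable_realfun ring lra.

(** Let [d s] be the sum of the positive parts of the coordinates of
    [Y0 s - Y1 s], and [e s] its mean.  The theorem says that [e = 0] almost
    everywhere on [[0, T]], and this follows from a Gronwall inequality
    [e t <= K * \int_t^T e].

    The source of the inequality is an estimate for functions of vectors
    ([monotone_below_gap]): if [f0] is nondecreasing in all its arguments,
    Lipschitz, and below [f1], then [f0 (u, v)] exceeds [f1 (u', v')] at most by
    a multiple of the positive parts of [u - u'] and [v - v'].  Applied to
    [theta0], [theta1] and integrated over [omega'], it bounds the positive part of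
    the difference of the mean-field terms by [d s + e s] ([mf_integral_gap]);
    applied to [g0], [g1] it then gives, for almost every [t] and almost surely,
    [(Y0 t - Y1 t)_j <= 2 * \int_t^T C (d s + e s) ds - (I0 - I1)_j], where
    [I0], [I1] are the Ito integrals over [[t, T]]
    ([generator_integral_comparison]).  The event
    [A] that the left-hand side is positive is known at time [t], and Ito
    integrals over [[t, T]] have mean zero on such events ([ito_integral_mean]).
    Integrating over [A] thus removes the stochastic integrals and leaves
    [E (Y0 t - Y1 t)_j^+ <= 4 C \int_t^T e] ([mean_gap_inequality]), and
    [gronwall_backward] concludes.

    The delicate point is that the derivative and comparison hypotheses hold, for each
    fixed choice of the spatial arguments, off a null set that depends on this
    choice, whereas the random vectors [Y0 s], [Y1 s] have to be substituted.
    Even along a single line, monotonicity does not follow path by path, because the null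
    set varies along the line.  [nondecreasing_ae] integrates the function over
    the set where monotonicity fails and argues with the resulting function of
    one real variable; the Lipschitz condition then reduces all arguments to rational
    ones ([monotone_comparison_exceptional]).  For the mean-field coefficients,
    which are measurable for a completed product sigma-algebra only, a null set
    of the square is removed beforehand
    ([completed_square_product_measurable_fun]).

    Finally, the integrands of the drift and of the mean-field term are
    composed functions whose measurability in the integration variable is
    delicate; their integrals are compared through simple functions from below
    ([Rintegral_comparison]), which costs only a constant factor. *)

Set Implicit Arguments.
Unset Strict Implicit.
Unset Printing Implicit Defensive.

Import Order.TTheory GRing.Theory Num.Theory.
Import numFieldNormedType.Exports.

Local Open Scope classical_set_scope.
Local Open Scope ring_scope.

(** * Null sets of product measures *)

Section almost_everywhere_product.
Context {R : realType} {d1 d2 : measure_display}.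
Context {X1 : measurableType d1} {X2 : measurableType d2}.

Lemma ae_product (m1 : {measure set X1 -> \bar R})
    (m2 : {sigma_finite_measure set X2 -> \bar R}) (Q : X1 * X2 -> Prop) :
  {ae (m1 \x m2)%E, forall z, Q z} ->
  {ae m1, forall x, {ae m2, forall y, Q (x, y)}}.
Proof.
move=> [N [mN N0 QN]].
have mx := measurable_fun_xsection m2 mN.
have /(ae_eq_integral_abs _ measurableT mx) : (\int[m1]_x `|m2 (xsection N x)| = 0)%E.
  by rewrite -N0; apply: eq_integral => x _; rewrite gee0_abs.
apply: filterS => x /(_ I) /= x0; exists (xsection N x); split => //.
  exact: measurable_xsection.
by move=> y nQ; rewrite /xsection/= inE; apply: QN.
Qed.

Lemma ae_not_measure0 {d} {X : measurableType d} (m : {measure set X -> \bar R})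
  (S : set X) : measurable S -> {ae m, forall x, ~ S x} <-> m S = 0%E.
Proof.
move=> mS; split=> [[N [mN N0 SN]]|S0]; last first.
  by exists S; split => // x /= /contrapT.
apply: (subset_measure0 _ mN _ N0) => // x Sx; apply: SN => /=; exact.
Qed.

(** Measurability of [S] is what makes the order of the two null sets
    irrelevant: both iterated statements say that [S] is null for the product
    measure. *)
Lemma ae_swap (m1 : {sigma_finite_measure set X1 -> \bar R})
    (m2 : {sigma_finite_measure set X2 -> \bar R}) (S : set (X1 * X2)) :
  measurable S ->
  {ae m1, forall x, {ae m2, forall y, ~ S (x, y)}} ->
  {ae m2, forall y, {ae m1, forall x, ~ S (x, y)}}.
Proof.
move=> mS h.
have S0 : ((m1 \x m2) S = 0)%E.
  rewrite /product_measure1.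
  transitivity (\int[m1]_x `|m2 (xsection S x)|)%E.
    by apply: eq_integral => x _; rewrite gee0_abs.
  apply/(ae_eq_integral_abs _ measurableT); first exact: measurable_fun_xsection.
  apply: filterS h => x h _ /=.
  have := (ae_not_measure0 m2 (measurable_xsection x mS)).1; apply.
  by apply: filterS h => y; rewrite /xsection /= inE.
have {}S0 : (\int[m2]_y `|m1 (ysection S y)| = 0)%E.
  transitivity ((m1 \x^ m2)%E S).
    by apply: eq_integral => y _; rewrite gee0_abs.
  rewrite -S0; apply/esym; apply: product_measure_unique => // A B mA mB.
  exact: product_measure2E.
move: S0 => /(ae_eq_integral_abs _ measurableT).
move=> /(_ (measurable_fun_ysection _ mS)).
apply: filterS => y /(_ I) /= /(ae_not_measure0 m1 (measurable_ysection y mS)).2.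
by apply: filterS => x; rewrite /ysection/= inE.
Qed.

End almost_everywhere_product.

(** * Comparison of integrals of functions that may fail to be measurable *)

Section lower_integral.
Context {R : realType} {d : measure_display} {X : measurableType d}.
Variables (mu : {measure set X -> \bar R}) (D : set X) (mD : measurable D).
Local Open Scope ereal_scope.
Import HBNNSimple.

(** The integral of a nonnegative function is the supremum of the integrals of
    the simple functions below it, so it is monotone whether or not the
    integrands are measurable. *)
Lemma ge0_le_lower_integral (E : set X) (u v : X -> \bar R) :
  (forall x, E x -> 0 <= u x) -> (forall x, E x -> u x <= v x) ->
  \int[mu]_(x in E) u x <= \int[mu]_(x in E) v x.
Proof.
move=> u0 uv; rewrite !ge0_integralE//; last first.
  by move=> x Ex; rewrite (le_trans (u0 x Ex))// uv.
apply: le_ereal_sup => _ [h /= hu <-]; exists h => //= x.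
by apply: (le_trans (hu x)); apply: lee_restrict.
Qed.

(** Lower integrals are only superadditive in general; subadditivity holds as
    soon as one of the two summands, here [w], is measurable. *)
Lemma lower_integral_le_add (u v w : X -> \bar R) :
  (forall x, D x -> 0 <= u x) -> (forall x, D x -> 0 <= v x) ->
  (forall x, D x -> 0 <= w x) -> measurable_fun D w ->
  {ae mu, forall x, D x -> u x <= v x + w x} ->
  \int[mu]_(x in D) u x <= \int[mu]_(x in D) v x + \int[mu]_(x in D) w x.
Proof.
move=> u0 v0 w0 mw [N [mN N0 uvw]].
rewrite (ge0_integralE _ u0); apply: ge_ereal_sup => _ [h /= hu <-].
rewrite -integralT_nnsfun.
(* On [N] the inequality is unknown; an infinite value of [w] makes it true. *)
pose w' x := if x \in N then +oo else (w \_ D) x.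
have mw' : measurable_fun setT w'.
  apply: measurable_fun_ifT => //; last exact/(measurable_restrictT _ mD).
  apply: (measurable_fun_bool true); rewrite setTI.
  by rewrite (_ : _ @^-1` _ = N)//; apply/seteqP; split=> x; [exact: set_mem|exact: mem_set].
have w'0 x : 0 <= w' x by rewrite /w'; case: ifP => // _; apply: erestrict_ge0.
(* The excess of [h] over [w] is measurable and lies below [v]. *)
pose p x := maxe ((h x)%:E - w' x) 0.
have mp : measurable_fun setT p.
  apply: measurable_maxe => //; apply: emeasurable_funB => //.
  exact/measurable_EFinP.
have p0 x : 0 <= p x by rewrite /p le_max lexx orbT.
have hp x : (h x)%:E <= p x + w' x.
  have [->|wx] := eqVneq (w' x) +oo; first by rewrite addey ?leey// gt_eqF// (lt_le_trans _ (p0 x)).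
  have w'f : w' x \is a fin_num by rewrite ge0_fin_numE// lt_neqAle wx leey.
  by rewrite -leeBlDr// /p le_max lexx.
have pv x : p x <= (v \_ D) x.
  rewrite /p ge_max erestrict_ge0// andbT.
  rewrite /w'; case: ifPn => [_|xN]; first by rewrite addeNy ?leNye.
  have := hu x; rewrite /patch; case: ifPn => [/set_mem Dx hux|_ hx0]; last first.
    by rewrite sube0.
  have [->|wx] := eqVneq (w x) +oo; first by rewrite addeNy ?leNye.
  have wf : w x \is a fin_num by rewrite ge0_fin_numE ?w0// lt_neqAle wx leey.
  rewrite leeBlDr// (le_trans hux)//; apply: contrapT => nuvw.
  by move/negP: xN; apply; apply/mem_set/uvw => /= /(_ Dx).
rewrite [X in _ <= X + _](integral_mkcond D) [X in _ <= _ + X](integral_mkcond D).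
have <- : \int[mu]_x w' x = \int[mu]_x (w \_ D) x.
  apply: ge0_ae_eq_integral => //.
  - by have /(measurable_restrictT _ mD) := mw.
  - by move=> x _; apply: erestrict_ge0.
  - exists N; split => // x /= /not_implyP[_ neq]; apply: contrapT => Nx; apply: neq.
    by rewrite /w' memNset.
apply: (@le_trans _ _ (\int[mu]_x p x + \int[mu]_x w' x)).
  rewrite -ge0_integralD//; apply: ge0_le_lower_integral.
  - by move=> x; rewrite lee_fin.
  - by [].
by apply: leeD => //; apply: ge0_le_lower_integral.
Qed.

End lower_integral.

Section lower_integral_comparison.
Context {R : realType} {d : measure_display} {X : measurableType d}.
Variables (mu : {measure set X -> \bar R}) (D : set X) (mD : measurable D).
Local Open Scope ereal_scope.

Lemma dominated_lower_integral (f : X -> \bar R) (k : X -> \bar R) :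
  (forall x, D x -> 0 <= f x) -> (forall x, D x -> 0 <= k x) ->
  measurable_fun D k -> {ae mu, forall x, D x -> f x <= k x} ->
  \int[mu]_(x in D) f x <= \int[mu]_(x in D) k x.
Proof.
move=> f0 k0 mk fk.
rewrite -[leRHS]add0e -[X in _ <= X + _](integral0 mu D).
apply: lower_integral_le_add => //; apply: filterS fk => x fk Dx.
by rewrite add0e fk.
Qed.

(** Without measurability of [f] and [f'] the integral is not additive, and the
    factor 2 is the price of comparing them through lower integrals: the positive parts
    satisfy [f^+ <= f'^+ + h], the negative parts [f'^- <= f^- + h], and each of
    the two inequalities loses one integral of [h].  The bound [k] keeps the four
    lower integrals finite. *)
Lemma Rintegral_comparison (f f' : X -> R) (h k : X -> \bar R) :
  (forall x, D x -> 0 <= h x) -> measurable_fun D h ->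
  (forall x, D x -> 0 <= k x) -> measurable_fun D k ->
  \int[mu]_(x in D) k x < +oo ->
  {ae mu, forall x, D x -> `|(f x)%:E| <= k x} ->
  {ae mu, forall x, D x -> `|(f' x)%:E| <= k x} ->
  {ae mu, forall x, D x -> (f x)%:E <= (f' x)%:E + h x} ->
  (\int[mu]_(x in D) f x)%R%:E <=
  (\int[mu]_(x in D) f' x)%R%:E + 2%:E * \int[mu]_(x in D) h x.
Proof.
move=> h0 mh k0 mk kfin fk f'k ff'.
have posE (u : X -> R) : (fun x => (u x)%:E)^\+ = fun x => (Num.max (u x) 0)%:E.
  by apply/funext => x; rewrite funeposE EFin_max.
have negE (u : X -> R) : (fun x => (u x)%:E)^\- = fun x => (Num.max (- u x) 0)%:E.
  by apply/funext => x; rewrite funenegE EFin_max.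
have max0 (u : X -> R) x : D x -> 0 <= (Num.max (u x) 0)%:E.
  by move=> _; rewrite lee_fin le_max lexx orbT.
have bp (u : X -> R) : {ae mu, forall x, D x -> `|(u x)%:E| <= k x} ->
    \int[mu]_(x in D) (Num.max (u x) 0)%:E \is a fin_num.
  move=> uk; rewrite ge0_fin_numE; last first.
    by apply: integral_ge0 => x _; rewrite lee_fin le_max lexx orbT.
  apply: le_lt_trans kfin; apply: dominated_lower_integral => //.
    by move=> x _; rewrite lee_fin le_max lexx orbT.
  apply: filterS uk => x uk Dx; apply: le_trans (uk Dx).
  by rewrite lee_fin ge_max normr_ge0 ler_norm.
have bn (u : X -> R) : {ae mu, forall x, D x -> `|(u x)%:E| <= k x} ->
    \int[mu]_(x in D) (Num.max (- u x) 0)%:E \is a fin_num.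
  move=> uk; apply: (bp (fun x => (- u x)%R)).
  by apply: filterS uk => x uk Dx; rewrite EFinN abseN uk.
have RE (u : X -> R) : {ae mu, forall x, D x -> `|(u x)%:E| <= k x} ->
    (\int[mu]_(x in D) u x)%R%:E = \int[mu]_(x in D) (Num.max (u x) 0)%:E
       - \int[mu]_(x in D) (Num.max (- u x) 0)%:E.
  move=> uk; rewrite /Rintegral fineK integralE posE negE// fin_numB.
  by rewrite bp ?bn.
rewrite !RE//.
have [hoo|hfin] := eqVneq (\int[mu]_(x in D) h x) +oo.
  rewrite hoo gt0_muley ?lte_fin// addey ?leey//.
  by rewrite -(RE f').
have hnum : \int[mu]_(x in D) h x \is a fin_num.
  by rewrite ge0_fin_numE ?integral_ge0// lt_neqAle hfin leey.
have le1 : \int[mu]_(x in D) (Num.max (f x) 0)%:E <=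
    \int[mu]_(x in D) (Num.max (f' x) 0)%:E + \int[mu]_(x in D) h x.
  apply: lower_integral_le_add => //; [exact: (max0 f)|exact: (max0 f')|].
  move: ff'; apply: filterS => x ff' Dx; have := ff' Dx; have := h0 x Dx.
  case: (h x) => [r| |]//; last by move=> _ _; rewrite addey ?leey.
  rewrite -!EFinD !lee_fin => r0 fr; rewrite ge_max; apply/andP; split.
    by rewrite (le_trans fr)// lerD2r le_max lexx.
  by rewrite addr_ge0// le_max lexx orbT.
have le2 : \int[mu]_(x in D) (Num.max (- f' x) 0)%:E <=
    \int[mu]_(x in D) (Num.max (- f x) 0)%:E + \int[mu]_(x in D) h x.
  apply: lower_integral_le_add => //; [exact: (max0 (fun x => - f' x)%R)|exact: (max0 (fun x => - f x)%R)|].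
  move: ff'; apply: filterS => x ff' Dx; have := ff' Dx; have := h0 x Dx.
  case: (h x) => [r| |]//; last by move=> _ _; rewrite addey ?leey.
  rewrite -!EFinD !lee_fin => r0 fr; rewrite ge_max; apply/andP; split.
    have : (- f x <= Num.max (- f x) 0)%R by rewrite le_max lexx.
    by move: fr; lra.
  by rewrite addr_ge0// le_max lexx orbT.
move: le1 le2.
rewrite -(fineK (bp _ fk)) -(fineK (bp _ f'k)) -(fineK (bn _ fk)) -(fineK (bn _ f'k)).
rewrite -(fineK hnum) -!EFinM -!EFinB -!EFinD !lee_fin; lra.
Qed.

End lower_integral_comparison.

(** * Monotonicity almost everywhere from derivatives *)

Section one_variable.
Context {R : realType}.
Implicit Types (f : R -> R) (a b c K r s : R).

(** Nonnegativity of the lower right Dini derivative of [f] at [r], written out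
    with increments so that no limit has to exist. *)
Definition right_lower_derivative_ge0 f r : Prop := forall e, 0 < e ->
  exists2 del, 0 < del & forall h, 0 < h -> h < del -> - (e * h) <= f (r + h) - f r.

(** If the chord of a Lipschitz function over [[a, b]] has slope below [- c],
    then from some point [r] on all chords starting at [r] have slope below
    [- c]: take for [r] the last point where [f x + c * x] is at least its value
    at [a]. *)
Lemma decreasing_chords f a b c K : a < b -> 0 <= K ->
  (forall r s, `|f r - f s| <= K * `|r - s|) ->
  f b - f a < - c * (b - a) ->
  exists r, [/\ a <= r, r < b &
    forall s, r < s -> s <= b -> f s - f r < - c * (s - r)].
Proof.
move=> ab K0 lip fab.
pose g r := f r + c * r.
have gab : g b < g a by move: fab; rewrite /g; lra.
(* A Lipschitz constant of [g], made positive. *)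
pose K' := K + `|c| + 1.
have K'0 : 0 < K' by rewrite /K' ltr_wpDl// addr_ge0.
have lipg r s : g s - K' * `|r - s| <= g r.
  have h1 : f s - f r <= K * `|r - s|.
    by rewrite distrC (le_trans (ler_norm _))// (le_trans (lip _ _))// distrC.
  have h2 : c * (s - r) <= `|c| * `|r - s|.
    by rewrite (le_trans (ler_norm _))// normrM (distrC s).
  have : 0 <= `|r - s| by [].
  by rewrite /g /K' !mulrDl mul1r; move: h1 h2; rewrite mulrBr; lra.
pose S := [set r | a <= r <= b /\ g a <= g r].
have Sa : S a by split; rewrite ?lexx ?ltW.
have hS : has_sup S by split; [exists a|exists b => r [/andP[]]].
have Sub := sup_upper_bound hS.
pose r := sup S.
have ar : a <= r by exact: Sub.
have rb : r <= b by apply: ge_sup; [exists a|move=> x [/andP[]]].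
have gr : g a <= g r.
  apply/ler_addgt0Pr => e e0.
  have [s Ss rs] := sup_adherent (divr_gt0 e0 K'0) hS.
  have sr : s <= r := Sub s Ss.
  case: Ss => _ gs.
  have := lipg r s; rewrite ger0_norm ?subr_ge0// => h.
  have : K' * (r - s) <= e by rewrite -ler_pdivlMl// mulrC; move: rs; rewrite -/r; lra.
  by move: h gs; lra.
exists r; split => //.
  rewrite lt_neqAle rb andbT; apply/eqP => rE.
  by move: gr; rewrite rE leNgt gab.
move=> s rs sb; have [gs|gs] := leP (g a) (g s).
  have : s <= r by apply: Sub; split => //; rewrite sb (le_trans ar (ltW rs)).
  by rewrite leNgt rs.
by move: (lt_le_trans gs gr); rewrite /g; lra.
Qed.

End one_variable.

Section monotone_almost_everywhere.
Context {R : realType} {d1 d2 : measure_display}.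
Context {X1 : measurableType d1} {X2 : measurableType d2}.
Variables (m1 : {sigma_finite_measure set X1 -> \bar R}).
Variables (m2 : {sigma_finite_measure set X2 -> \bar R}).
Variables (D : set X1) (mD : measurable D) (Dfin : (m1 D < +oo)%E).
Hypothesis m2fin : (m2 setT < +oo)%E.

(** The derivative is nonnegative at each fixed [r] off a null set that depends
    on [r], so no single path can be followed and the usual mean value argument
    is unavailable.  It is applied instead to the function
    [G s = \int_B (phi s - phi a)], where [B] is the set on which [phi b < phi a].
    If [B] had positive measure, then [G b < G a], and by
    [decreasing_chords] there would be chords of slope below [- c] at one point
    [r]; at that fixed [r] the negative parts of the difference quotients tend
    to 0 almost everywhere and are bounded by [K], so dominated convergence
    contradicts this.  The convergence is only known in iterated form, hence
    dominated convergence is used twice, for [m2] and then for [m1]. *)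
Lemma nondecreasing_ae (phi : R -> X1 * X2 -> R) (K a b : R) :
  (forall r, measurable_fun setT (phi r)) ->
  0 <= K -> (forall r s z, `|phi r z - phi s z| <= K * `|r - s|) ->
  (forall r, {ae m1, forall x, D x -> {ae m2, forall y,
     right_lower_derivative_ge0 (phi^~ (x, y)) r}}) ->
  a <= b ->
  {ae m1, forall x, D x -> {ae m2, forall y, phi a (x, y) <= phi b (x, y)}}.
Proof.
move=> mphi K0 lip der; rewrite le_eqVlt => /predU1P[->|ab].
  by apply: aeW => x _; exact: aeW.
pose mu := (m1 \x m2)%E.
pose B := [set z : X1 * X2 | D z.1 /\ phi b z < phi a z].
have mB : measurable B.
  rewrite (_ : B = (fst @^-1` D) `&` [set z | phi b z < phi a z])//.
  apply: measurableI.
    by rewrite -[X in measurable X]setTI; exact: measurable_fst.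
  rewrite -[X in measurable X]setTI.
  exact: (measurable_fun_ltr (mphi b) (mphi a)).
have Bfin : (mu B < +oo)%E.
  apply: (@le_lt_trans _ _ (mu (D `*` setT))).
    by apply: le_measure; rewrite ?inE//; [exact: measurableX|move=> z []].
  by rewrite /mu product_measure1E// lte_mul_pinfty// ge0_fin_numE.
pose dphi r s z := phi s z - phi r z.
have mdphi r s : measurable_fun setT (dphi r s) by exact: measurable_funB.
have idphi r s : mu.-integrable B (EFin \o dphi r s).
  apply: measurable_bounded_integrable => //; first exact: measurable_funTS.
  exists (K * `|s - r|); split; first exact: num_real.
  move=> M sM z _ /=.
  by rewrite (le_trans (lip _ _ _))// ltW.
pose G s := \int[mu]_(z in B) dphi a s z.
have GE r s : G s - G r = \int[mu]_(z in B) dphi r s z.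
  rewrite /G -RintegralB//; apply: eq_Rintegral => z _.
  by rewrite /dphi opprB addrA subrK.
have lipG r s : `|G r - G s| <= (K * fine (mu B)) * `|r - s|.
  rewrite GE (le_trans (le_normr_Rintegral _ _))//.
  apply: (@le_trans _ _ (\int[mu]_(z in B) (K * `|r - s|))).
    apply: le_Rintegral => //.
    - exact: integrable_norm.
    - apply: measurable_bounded_integrable => //.
      exists (K * `|r - s|); split; first exact: num_real.
      move=> M sM z _ /=.
      by rewrite ger0_norm ?mulr_ge0// ltW.
    - by move=> z _; rewrite /dphi lip.
  by rewrite Rintegral_cst// mulrAC.
have [muB0|muB0] := eqVneq (mu B) 0%E.
  have : {ae mu, forall z, ~ B z} by apply/ae_not_measure0.
  move/ae_product; apply: filterS => x h Dx; move: h; apply: filterS => y nB.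
  by rewrite leNgt; apply/negP => ba; apply: nB.
have Gab : G b - G a < 0.
  rewrite -opprB oppr_lt0 GE lt_neqAle; apply/andP; split; last first.
    by apply: Rintegral_ge0 => z [_ ba]; rewrite subr_ge0 ltW.
  apply: contra muB0 => /eqP int0.
  have : (\int[mu]_(z in B) `|(dphi b a z)%:E| = 0)%E.
    rewrite -[RHS]/(0%:E) int0 /Rintegral fineK; last exact: integrable_fin_num (idphi b a).
    apply: eq_integral => z /set_mem[_ ba].
    by rewrite gee0_abs// lee_fin subr_ge0 ltW.
  move/(ae_eq_integral_abs _ mB); case/(_ _)/Wrap.
    exact/measurable_EFinP/measurable_funTS.
  move=> h; apply/eqP/ae_not_measure0 => //.
  apply: filterS h => z h Bz; have [_] := Bz.
  by case: (h Bz) => /eqP; rewrite subr_eq0 => /eqP ->; rewrite ltxx.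
(* Half of the mean slope, so that the chord over [[a, b]] is strictly steeper. *)
pose c := (G a - G b) / (b - a) / 2.
have c0 : 0 < c by rewrite !divr_gt0// ?subr_gt0// -subr_lt0.
have Gc : G b - G a < - c * (b - a).
  rewrite /c mulNr -!mulrA (mulrC 2^-1) (mulrA (b - a)^-1) mulVf ?mul1r; last first.
    by rewrite subr_eq0 gt_eqF.
  by move: Gab; lra.
have Kfin0 : 0 <= K * fine (mu B) by rewrite mulr_ge0// fine_ge0.
have [r [ar rb rG]] := decreasing_chords ab Kfin0 lipG Gc.
pose h k := (b - r) / k.+1%:R.
have h0 k : 0 < h k by rewrite divr_gt0// subr_gt0.
(* Opposite difference quotients at [r], of positive part [q k]. *)
pose w k z := dphi r (r + h k) z * - (h k)^-1.
have wK k z : `|w k z| <= K.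
  rewrite normrM normrN normfV ler_pdivrMr ?normr_gt0 ?gt_eqF//.
  by rewrite (le_trans (lip _ _ _))// addrC addKr.
have mw k : measurable_fun setT (w k) by exact: measurable_funM.
pose q k z := Num.max (w k z) 0.
have q0 k z : 0 <= q k z by rewrite le_max lexx orbT.
have qK k z : q k z <= K.
  by rewrite /q ge_max K0 andbT (le_trans (ler_norm _)).
have mq k : measurable_fun setT (q k).
  exact: measurable_maxr.
have qB k : (c%:E <= \int[mu]_(z in B) (q k z)%:E)%E.
  have : G (r + h k) - G r < - c * (r + h k - r).
    apply: rG; first by rewrite ltrDl.
    have k1 : 1 <= k.+1%:R :> R by rewrite ler1n.
    by rewrite -lerBrDl /h ler_pdivrMr// ler_peMr// subr_ge0 ltW.
  rewrite (addrC r) addrK GE mulNr ltrNr addrC => cG.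
  have iq : mu.-integrable B (EFin \o q k).
    apply: measurable_bounded_integrable => //; first exact: measurable_funTS.
    exists K; split; first exact: num_real.
    by move=> M KM z _ /=; rewrite ger0_norm// (le_trans (qK _ _))// ltW.
  have iw : mu.-integrable B (EFin \o w k).
    apply: measurable_bounded_integrable => //; first exact: measurable_funTS.
    exists K; split; first exact: num_real.
    by move=> M KM z _ /=; rewrite (le_trans (wK _ _))// ltW.
  apply: (@le_trans _ _ (\int[mu]_(z in B) w k z)%R%:E).
    by rewrite lee_fin RintegralZr// mulrN -mulNr ler_pdivlMr// ltW.
  rewrite -[leRHS]fineK; last exact: integrable_fin_num iq.
  rewrite lee_fin; apply: le_Rintegral => //.
  by move=> z _; rewrite /q le_max lexx.
(* The integrals of [q k] over [B] stay above [c] but will be shown to tend to 0. *)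
pose g k := (EFin \o q k) \_ B.
have mg k : measurable_fun setT (g k).
  apply/(measurable_restrictT _ mB).
  exact/measurable_EFinP/measurable_funTS.
have g0 k z : (0 <= g k z)%E by apply: erestrict_ge0 => ? _; rewrite lee_fin.
have gK k z : (g k z <= K%:E)%E.
  by rewrite /g /patch; case: ifP => _; rewrite lee_fin.
pose F k x := (\int[m2]_y g k (x, y))%E.
have mF k : measurable_fun setT (F k).
  exact: (measurable_fun_fubini_tonelli_F (g k)).
have F0 k x : (0 <= F k x)%E by apply: integral_ge0.
have mgx k x : measurable_fun setT (fun y => g k (x, y)) by exact: measurableT_comp.
have icst c' : m2.-integrable setT (cst c'%:E).
  apply: (@measurable_bounded_integrable _ _ _ m2 (cst c')) => //.
  by exists `|c'|; split; [exact: num_real|move=> M cM ? _ /=; rewrite ltW].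
have FK k x : (F k x <= K%:E * m2 setT)%E.
  rewrite -integral_cst//; apply: ge0_le_integral => //.
have gcvg : {ae m1, forall x, D x -> {ae m2, forall y, g k (x, y) @[k --> \oo] --> 0%E}}.
  have := der r; apply: filterS => x derx Dx; move: (derx Dx).
  apply: filterS => y dery.
  have [xyB|xyB] := boolP ((x, y) \in B); last first.
    rewrite (_ : (fun k => _) = cst 0%E); first exact: cvg_cst.
    by apply/funext => k; rewrite /g /patch (negbTE xyB).
  rewrite (_ : (fun k => _) = fun k => (q k (x, y))%:E); last first.
    by apply/funext => k; rewrite /g /patch xyB.
  apply: cvg_EFin; first exact: nearW.
  apply/cvgr0Pnorm_le => e e0.
  have [del del0 hdel] := dery e e0.
  have hcvg : h k @[k --> \oo] --> (0 : R).
    rewrite -(mulr0 (b - r)); apply: cvgM; first exact: cvg_cst.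
    exact: cvg_harmonic.
  near=> k; rewrite /= ger0_norm// /q ge_max (ltW e0) andbT.
  rewrite /w mulrN lerNl ler_pdivlMr// mulNr; apply: hdel => //.
  rewrite -[ltLHS]ger0_norm ?ltW//.
  near: k; move/cvgr0Pnorm_lt : hcvg; exact.
have Fcvg : {ae m1, forall x, D x -> F k x @[k --> \oo] --> 0%E}.
  move: gcvg; apply: filterS => x gx Dx.
  have [] := @dominated_convergence _ _ _ m2 setT measurableT (fun k y => g k (x, y))
    (cst 0%E) (cst K%:E).
  - by [].
  - by [].
  - by move: (gx Dx); apply: filterS.
  - exact: icst.
  - by apply: aeW => y k _; rewrite gee0_abs.
  by move=> _ _; rewrite integral0.
have [_ _] : [/\ m1.-integrable D (cst 0%E : X1 -> \bar R),
     (\int[m1]_(x in D) `|F k x - 0|)%E @[k --> \oo] --> 0%E &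
     (\int[m1]_(x in D) F k x)%E @[k --> \oo] --> (\int[m1]_(x in D) (cst 0%E x))%E].
  apply: (@dominated_convergence _ _ _ m1 D mD F (cst 0%E) (cst (K * fine (m2 setT))%:E)).
  - by move=> k; exact: measurable_funTS.
  - by [].
  - exact: Fcvg.
  - apply: (@measurable_bounded_integrable _ _ _ m1 (cst (K * fine (m2 setT)))) => //.
    by exists `|K * fine (m2 setT)|; split; [exact: num_real|move=> M cM ? _ /=; rewrite ltW].
  - apply: aeW => x k _; rewrite gee0_abs// EFinM fineK//.
    by rewrite ge0_fin_numE.
rewrite integral0 => Flim.
have : (c%:E <= limn (fun k => \int[m1]_(x in D) F k x))%E.
  apply: lime_ge; first by apply/cvg_ex; exists 0%E.
  apply: nearW => k; rewrite (le_trans (qB k))//.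
  rewrite integral_mkcond [X in (X <= _)%E](fubini_tonelli1 (g k))//.
  rewrite [leRHS]integral_mkcond.
  apply: (@ge0_le_integral _ _ _ m1 setT measurableT (F k) (F k \_ D)) => //.
    by apply/(measurable_restrictT _ mD); exact: measurable_funTS.
  move=> x _; rewrite patchE; case: ifPn => // /negP nDx.
  rewrite (_ : F k x = 0%E)//; apply: integral0_eq => y _.
  rewrite /g patchE ifF//; apply/negP => /set_mem[/= Dx _].
  exact/nDx/mem_set.
by rewrite (cvg_lim _ Flim)// lee_fin leNgt c0.
Unshelve. all: end_near. Qed.

End monotone_almost_everywhere.

(** * Row vectors and rational arguments *)

Section coordinates.
Context {R : realType}.

Definition norm1 {n : nat} (x : 'rV[R]_n) : R := \sum_j `|x 0 j|.

Lemma norm1_ge0 n (x : 'rV[R]_n) : 0 <= norm1 x.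
Proof. exact: sumr_ge0. Qed.

Lemma norm1D n (x y : 'rV[R]_n) : norm1 (x + y) <= norm1 x + norm1 y.
Proof.
by rewrite /norm1 -big_split/=; apply: ler_sum => j _; rewrite mxE ler_normD.
Qed.

Lemma norm1_distC n (x y : 'rV[R]_n) : norm1 (x - y) = norm1 (y - x).
Proof. by apply: eq_bigr => j _; rewrite !mxE distrC. Qed.

Lemma norm1_delta n (r : R) (j : 'I_n) : norm1 (r *: delta_mx 0 j) = `|r|.
Proof.
rewrite /norm1 (bigD1 j)//= big1 ?addr0 => [|i ij]; rewrite !mxE eqxx/=.
  by rewrite eqxx mulr1.
by rewrite (negbTE ij) mulr0 normr0.
Qed.

Lemma enorm_le_norm1 n (x : 'rV[R]_n) : enorm x <= norm1 x.
Proof.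
rewrite /enorm -[leRHS]ger0_norm ?norm1_ge0// -sqrtr_sqr ler_wsqrtr//.
rewrite expr2 {1}/norm1 mulr_suml; apply: ler_sum => j _.
rewrite -real_normK ?num_real// expr2 ler_wpM2l// /norm1 (bigD1 j)//= lerDl.
exact: sumr_ge0.
Qed.

Lemma coord_le_enorm n (x : 'rV[R]_n) (j : 'I_n) : `|x 0 j| <= enorm x.
Proof.
rewrite -sqrtr_sqr ler_wsqrtr// (bigD1 j)//= lerDl.
by apply: sumr_ge0 => i _; exact: sqr_ge0.
Qed.

Lemma rat_row_dense n (x : 'rV[R]_n) (e : R) : 0 < e ->
  exists q : 'rV[rat]_n, norm1 (x - map_mx ratr q) <= e.
Proof.
move=> e0; pose e' := e / n.+1%:R.
have e'0 : 0 < e' by rewrite divr_gt0.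
have h j : exists q : rat, `|x 0 j - ratr q| <= e'.
  have /rat_in_itvoo[q] : x 0 j - e' < x 0 j by rewrite ltrBlDr ltrDl.
  rewrite in_itv/= => /andP[xq qx]; exists q => //.
  by rewrite ger0_norm; move: xq qx; lra.
exists (\row_j sval (cid (h j))); rewrite /norm1.
apply: (@le_trans _ _ (\sum_(j < n) e')).
  by apply: ler_sum => j _; rewrite !mxE; case: cid.
rewrite sumr_const card_ord -[leLHS]mulr_natr /e' mulrAC ler_pdivrMr//.
by rewrite ler_pM2l// ler_nat.
Qed.

Lemma rat_nneg_dense (r e : R) : 0 <= r -> 0 < e ->
  exists q : rat, 0 <= q /\ `|r - ratr q| <= e.
Proof.
move=> r0 e0; have /rat_in_itvoo[q] : r < r + e by rewrite ltrDl.
rewrite in_itv/= => /andP[rq qr]; exists q; split.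
  by rewrite -(ler0q R) (le_trans r0)// ltW.
by rewrite ler0_norm; move: rq qr; lra.
Qed.

(** The segment from [x] to [y] is replaced by a staircase along the axes. *)
Lemma nondecreasing_coordinates n (f : 'rV[R]_n -> R) :
  (forall x j r, 0 <= r -> f x <= f (x + r *: delta_mx 0 j)) ->
  forall x y, le_vec x y -> f x <= f y.
Proof.
move=> mono x y xy.
have -> : y = x + \sum_j (y - x) 0 j *: delta_mx 0 j.
  by rewrite -row_sum_delta addrC subrK.
elim/big_rec: _ => [|j z _ xz]; first by rewrite addr0.
by rewrite addrCA addrC (le_trans xz)// mono// !mxE subr_ge0.
Qed.

(** Links the Jacobian hypotheses with the one-variable criterion, along a line
    parallel to an axis. *)
Lemma right_lower_derivative_partial k l (f : 'rV[R]_k -> 'rV[R]_l) x j i r :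
  has_jacobian f (x + r *: delta_mx 0 j) ->
  0 <= jacobian_mx f (x + r *: delta_mx 0 j) i j ->
  right_lower_derivative_ge0 (fun s => f (x + s *: delta_mx 0 j) 0 i) r.
Proof.
move=> /(_ j) df; rewrite mxE derive_mx// mxE => D0 e e0.
have {}df := (derivable_mxP _ _ _).1 df 0 i.
set g := fun x => f x 0 i in df D0.
have /cvgrPdist_le/(_ _ e0) : h^-1 *: ((g \o shift (x + r *: delta_mx 0 j)) (h *: delta_mx 0 j) - g (x + r *: delta_mx 0 j)) @[h --> 0^'] --> 'D_(delta_mx 0 j) g (x + r *: delta_mx 0 j).
  exact: df.
move=> /nbhs_ballP[del /= del0 hdel]; exists del => // h h0 hd.
have := hdel h; rewrite /ball/= sub0r normrN gtr0_norm// => /(_ hd).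
rewrite gt_eqF// => /(_ isT).
rewrite /shift/= [h *: _ + _]addrC -addrA -scalerDl.
set q := g _ - g _ => hq.
have : - e <= h^-1 *: q by move: hq; rewrite ler_norml; lra.
by rewrite ler_pdivlMl// mulrN mulrC.
Qed.

(** By Lipschitz continuity, monotonicity along the axes at rational points with
    rational increments is enough.  This is what reduces the uncountably many
    arguments to countably many null sets. *)
Lemma nondecreasing_of_rational k l (f : 'rV[R]_k -> 'rV[R]_l -> R) (K : R) :
  0 <= K ->
  (forall u v u' v', `|f u v - f u' v'| <= K * (norm1 (u - u') + norm1 (v - v'))) ->
  (forall (q : 'rV[rat]_k) (p : 'rV[rat]_l) (j : 'I_k) (r : rat), 0 <= r ->
     f (map_mx ratr q) (map_mx ratr p)
     <= f (map_mx ratr q + ratr r *: delta_mx 0 j) (map_mx ratr p)) ->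
  forall u u' v, le_vec u u' -> f u v <= f u' v.
Proof.
move=> K0 lip frat u0 u1 v; apply: (nondecreasing_coordinates (f := f^~ v)).
move=> u j r r0.
apply/ler_addgt0Pr => e e0.
(* Five arguments are replaced by approximations in the estimates below. *)
have e'0 : 0 < e / (5%:R * (K + 1)) by rewrite divr_gt0// mulr_gt0// ltr_wpDl.
set e' := e / _ in e'0.
have [q hq] := rat_row_dense u e'0.
have [p hp] := rat_row_dense v e'0.
have [s [s0 hs]] := rat_nneg_dense r0 e'0.
have h1 := frat q p j s s0.
have h2 : f u v - f (map_mx ratr q) (map_mx ratr p) <= K * (e' + e').
  by rewrite (le_trans (ler_norm _))// (le_trans (lip _ _ _ _))// ler_wpM2l// lerD.
have h3 : f (map_mx ratr q + ratr s *: delta_mx 0 j) (map_mx ratr p)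
    - f (u + r *: delta_mx 0 j) v <= K * ((e' + e') + e').
  rewrite (le_trans (ler_norm _))// (le_trans (lip _ _ _ _))// ler_wpM2l// lerD//.
    rewrite opprD addrACA -scalerBl (le_trans (norm1D _ _))// lerD//.
      by rewrite norm1_distC.
    by rewrite norm1_delta distrC.
  by rewrite norm1_distC.
have : 5%:R * (K + 1) * e' = e.
  by rewrite mulrC divfK// gt_eqF// mulr_gt0// ltr_wpDl.
rewrite -mulrA mulrDl mul1r => eE.
by move: h1 h2 h3 e'0; lra.
Qed.

Lemma le_of_rational k l (f g : 'rV[R]_k -> 'rV[R]_l -> R) (K : R) :
  0 <= K ->
  (forall u v u' v', `|f u v - f u' v'| <= K * (norm1 (u - u') + norm1 (v - v'))) ->
  (forall u v u' v', `|g u v - g u' v'| <= K * (norm1 (u - u') + norm1 (v - v'))) ->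
  (forall (q : 'rV[rat]_k) (p : 'rV[rat]_l),
     f (map_mx ratr q) (map_mx ratr p) <= g (map_mx ratr q) (map_mx ratr p)) ->
  forall u v, f u v <= g u v.
Proof.
move=> K0 lipf lipg frat u v.
apply/ler_addgt0Pr => e e0.
(* Four arguments are replaced by approximations in the estimates below. *)
have e'0 : 0 < e / (4%:R * (K + 1)) by rewrite divr_gt0// mulr_gt0// ltr_wpDl.
set e' := e / _ in e'0.
have [q hq] := rat_row_dense u e'0.
have [p hp] := rat_row_dense v e'0.
have h1 := frat q p.
have h2 : f u v - f (map_mx ratr q) (map_mx ratr p) <= K * (e' + e').
  by rewrite (le_trans (ler_norm _))// (le_trans (lipf _ _ _ _))// ler_wpM2l// lerD.
have h3 : g (map_mx ratr q) (map_mx ratr p) - g u v <= K * (e' + e').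
  rewrite (le_trans (ler_norm _))// (le_trans (lipg _ _ _ _))// ler_wpM2l// lerD//.
    by rewrite norm1_distC.
  by rewrite norm1_distC.
have : 4%:R * (K + 1) * e' = e.
  by rewrite mulrC divfK// gt_eqF// mulr_gt0// ltr_wpDl.
rewrite -mulrA mulrDl mul1r => eE.
by move: h1 h2 h3 e'0; lra.
Qed.

End coordinates.

(** * One exceptional set for all arguments *)

Lemma ae_forall_countable {R : realType} {d} {X : measurableType d}
    (m : {measure set X -> \bar R}) (I : countType) (Q : I -> X -> Prop) :
  (forall i, {ae m, forall x, Q i x}) -> {ae m, forall x, forall i, Q i x}.
Proof.
move=> h; pose Q' n x := if unpickle n is Some i then Q i x else True.
have : {ae m, forall x, forall n, Q' n x}.
  apply: ae_foralln => n; rewrite /Q'; case: (unpickle n) => [i|]; first exact: h.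
  exact: aeW.
by apply: filterS => x hx i; have := hx (pickle i); rewrite /Q' pickleK.
Qed.

Lemma lipschitz_coord {R : realType} (k l o : nat) (K : R)
    (f : 'rV[R]_k -> 'rV[R]_l -> 'rV[R]_o) : 0 <= K ->
  (forall u v u' v',
     enorm (f u v - f u' v') <= K * (enorm (u - u') + enorm (v - v'))) ->
  forall i u v u' v',
    `|f u v 0 i - f u' v' 0 i| <= K * (norm1 (u - u') + norm1 (v - v')).
Proof.
move=> K0 lipf i u v u' v'.
have -> : f u v 0 i - f u' v' 0 i = (f u v - f u' v') 0 i by rewrite !mxE.
rewrite (le_trans (coord_le_enorm _ _))// (le_trans (lipf _ _ _ _))//.
by rewrite ler_wpM2l// lerD// enorm_le_norm1.
Qed.

Section exceptional_sets.
Context {R : realType} {d1 d2 : measure_display}.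
Context {X1 : measurableType d1} {X2 : measurableType d2}.
Variables (m1 : {sigma_finite_measure set X1 -> \bar R}).
Variables (m2 : {sigma_finite_measure set X2 -> \bar R}).
Variables (D : set X1).

(** Measurability is part of the notion so that null sets in [t], [s], [omega]
    can be exchanged afterwards by [ae_swap]; the iterated form of smallness is
    the one in which the hypotheses on the coefficients are given. *)
Definition exceptional (S : set (X1 * X2)) : Prop :=
  measurable S /\
  {ae m1, forall x, D x -> {ae m2, forall y, ~ S (x, y)}}.

Lemma exceptional_bigcup (I : countType) (S : I -> set (X1 * X2)) :
  (forall i, exceptional (S i)) -> exceptional (\bigcup_i S i).
Proof.
move=> hS; split.
  by apply: countable_bigcupT_measurable => // i; case: (hS i).
have : {ae m1, forall x, forall i, D x -> {ae m2, forall y, ~ S i (x, y)}}.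
  by apply: ae_forall_countable => i; case: (hS i).
apply: filterS => x hx Dx.
have : {ae m2, forall y, forall i, ~ S i (x, y)}.
  by apply: ae_forall_countable => i; apply: hx.
by apply: filterS => y hy [i _]; exact: hy.
Qed.

Lemma exceptionalU (S S' : set (X1 * X2)) :
  exceptional S -> exceptional S' -> exceptional (S `|` S').
Proof.
move=> [mS aS] [mS' aS']; split; first exact: measurableU.
move: aS aS'; apply: filterS2 => x h h' Dx.
by move: (h Dx) (h' Dx); apply: filterS2 => y n n' [].
Qed.

Hypotheses (mD : measurable D) (Dfin : (m1 D < +oo)%E).
Hypothesis m2fin : (m2 setT < +oo)%E.

(** For each rational configuration [nondecreasing_ae] gives an exceptional set
    of points where the inequality fails; their countable union serves all real
    arguments by [nondecreasing_of_rational]. *)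
Lemma nondecreasing_exceptional (k l o : nat)
    (F : X1 * X2 -> 'rV[R]_k -> 'rV[R]_l -> 'rV[R]_o) (K : R) :
  (forall u v i, measurable_fun setT (fun z => F z u v 0 i)) ->
  0 <= K ->
  (forall z u v u' v',
     enorm (F z u v - F z u' v') <= K * (enorm (u - u') + enorm (v - v'))) ->
  (forall u v, {ae m1, forall x, D x -> {ae m2, forall y,
     has_jacobian (fun c => F (x, y) c v) u /\
     nonneg_mx (jacobian_mx (fun c => F (x, y) c v) u)}}) ->
  exists2 S, exceptional S & forall z, ~ S z ->
    forall u u' v, le_vec u u' -> le_vec (F z u v) (F z u' v).
Proof.
move=> mF K0 lipF jacF.
have lip1 z := lipschitz_coord K0 (lipF z).
pose S (t : 'rV[rat]_k * 'rV[rat]_l * 'I_k * 'I_o * rat) :=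
  let: (q, p, j, i, r) := t in
  if 0 <= r then [set z | F z (map_mx ratr q + ratr r *: delta_mx 0 j) (map_mx ratr p) 0 i
                          < F z (map_mx ratr q) (map_mx ratr p) 0 i] else set0.
exists (\bigcup_t S t).
  apply: exceptional_bigcup => -[[[[q p] j] i] r]; rewrite /S.
  have [r0|_] := leP 0 r; last by split=> //; apply: aeW => x _; apply: aeW => y [].
  split.
    by rewrite -[X in measurable X]setTI; exact: measurable_fun_ltr.
  pose phi s z := F z (map_mx ratr q + s *: delta_mx 0 j) (map_mx ratr p) 0 i.
  have : {ae m1, forall x, D x -> {ae m2, forall y, phi 0 (x, y) <= phi (ratr r) (x, y)}}.
    apply: (nondecreasing_ae mD Dfin m2fin (K := K)) => //.
    - by move=> s; exact: mF.
    - move=> s s' z; rewrite (le_trans (lip1 _ _ _ _ _ _))//.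
      rewrite opprD addrACA subrr add0r -scalerBl norm1_delta subrr.
      by rewrite /norm1 big1 ?addr0// => a _; rewrite mxE normr0.
    - move=> s; have := jacF (map_mx ratr q + s *: delta_mx 0 j) (map_mx ratr p).
      apply: filterS => x h Dx; move: (h Dx); apply: filterS => y [hj nj].
      exact: (right_lower_derivative_partial hj (nj i j)).
    - by rewrite ler0q.
  apply: filterS => x h Dx; move: (h Dx); apply: filterS => y.
  by rewrite /phi scale0r addr0 leNgt => /negP.
move=> z nSz u u' v uu' i.
apply: (nondecreasing_of_rational (f := fun u v => F z u v 0 i) K0) => // q p j r r0.
rewrite leNgt; apply/negP => lt; apply: nSz; exists (q, p, j, i, r) => //.
by rewrite /S r0.
Qed.

Lemma comparison_exceptional (k l o : nat)
    (F0 F1 : X1 * X2 -> 'rV[R]_k -> 'rV[R]_l -> 'rV[R]_o) (K : R) :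
  (forall u v i, measurable_fun setT (fun z => F0 z u v 0 i)) ->
  (forall u v i, measurable_fun setT (fun z => F1 z u v 0 i)) ->
  0 <= K ->
  (forall z u v u' v',
     enorm (F0 z u v - F0 z u' v') <= K * (enorm (u - u') + enorm (v - v'))) ->
  (forall z u v u' v',
     enorm (F1 z u v - F1 z u' v') <= K * (enorm (u - u') + enorm (v - v'))) ->
  (forall u v, {ae m1, forall x, D x -> {ae m2, forall y,
     le_vec (F0 (x, y) u v) (F1 (x, y) u v)}}) ->
  exists2 S, exceptional S & forall z, ~ S z ->
    forall u v, le_vec (F0 z u v) (F1 z u v).
Proof.
move=> mF0 mF1 K0 lipF0 lipF1 leF.
pose S (t : 'rV[rat]_k * 'rV[rat]_l * 'I_o) :=
  let: (q, p, i) := t in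
  [set z | F1 z (map_mx ratr q) (map_mx ratr p) 0 i
           < F0 z (map_mx ratr q) (map_mx ratr p) 0 i].
exists (\bigcup_t S t).
  apply: exceptional_bigcup => -[[q p] i]; rewrite /S; split.
    by rewrite -[X in measurable X]setTI; exact: measurable_fun_ltr.
  have := leF (map_mx ratr q) (map_mx ratr p).
  apply: filterS => x h Dx; move: (h Dx); apply: filterS => y /(_ i).
  by rewrite leNgt => /negP.
move=> z nSz u v i.
apply: (le_of_rational (f := fun u v => F0 z u v 0 i)
  (g := fun u v => F1 z u v 0 i) K0) => [????|????|q p].
- exact: (lipschitz_coord K0 (lipF0 z)).
- exact: (lipschitz_coord K0 (lipF1 z)).
rewrite leNgt; apply/negP => lt; apply: nSz; exists (q, p, i) => //.
Qed.

(** Random arguments may be substituted in the conclusion, because the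
    exceptional set does not depend on the arguments. *)
Lemma monotone_comparison_exceptional (k l o : nat)
    (F0 F1 : X1 * X2 -> 'rV[R]_k -> 'rV[R]_l -> 'rV[R]_o) (K : R) :
  (forall u v i, measurable_fun setT (fun z => F0 z u v 0 i)) ->
  (forall u v i, measurable_fun setT (fun z => F1 z u v 0 i)) ->
  0 <= K ->
  (forall z u v u' v',
     enorm (F0 z u v - F0 z u' v') <= K * (enorm (u - u') + enorm (v - v'))) ->
  (forall z u v u' v',
     enorm (F1 z u v - F1 z u' v') <= K * (enorm (u - u') + enorm (v - v'))) ->
  (forall u v, {ae m1, forall x, D x -> {ae m2, forall y,
     [/\ has_jacobian (fun c => F0 (x, y) u c) v,
         nonneg_mx (jacobian_mx (fun c => F0 (x, y) u c) v),
         has_jacobian (fun c => F0 (x, y) c v) u &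
         nonneg_mx (jacobian_mx (fun c => F0 (x, y) c v) u)]}}) ->
  (forall u v, {ae m1, forall x, D x -> {ae m2, forall y,
     le_vec (F0 (x, y) u v) (F1 (x, y) u v)}}) ->
  exists2 S, exceptional S & forall z, ~ S z ->
    (forall u u' v v', le_vec u u' -> le_vec v v' ->
       le_vec (F0 z u v) (F0 z u' v')) /\
    (forall u v, le_vec (F0 z u v) (F1 z u v)).
Proof.
move=> mF0 mF1 K0 lipF0 lipF1 jac leF.
have [|S1 eS1 hS1] := nondecreasing_exceptional mF0 K0 lipF0.
  move=> u v; apply: filterS (jac u v) => x h Dx; move: (h Dx).
  by apply: filterS => y [].
have [|||S2 eS2 hS2] := nondecreasing_exceptional
    (F := fun z v u => F0 z u v) _ K0.
- by move=> u v i; exact: mF0.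
- by move=> z u v u' v'; rewrite [X in K * X]addrC; exact: lipF0.
- move=> v u; apply: filterS (jac u v) => x h Dx; move: (h Dx).
  by apply: filterS => y [].
have [S3 eS3 hS3] := comparison_exceptional mF0 mF1 K0 lipF0 lipF1 leF.
exists (S1 `|` S2 `|` S3); first by do 2?apply: exceptionalU.
move=> z nS; split; last by apply: hS3 => Sz; apply: nS; right.
move=> u u' v v' uu' vv' i; apply: (@le_trans _ _ (F0 z u' v 0 i)).
  by apply: hS1 => // Sz; apply: nS; left; left.
by apply: hS2 => // Sz; apply: nS; left; right.
Qed.

End exceptional_sets.

(** * Ito integrals have mean zero on events of the past *)

Section gaussian.
Context {R : realType}.
Local Notation mu := (@lebesgue_measure R).
Variable sigma : R.
Hypothesis sigma0 : sigma != 0.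
Local Notation N := (normal_prob 0 sigma).

(** The density is even and Lebesgue measure is invariant under reflection. *)
Lemma normal_prob_opp (A : set R) : measurable A -> N (-%R @^-1` A) = N A.
Proof.
move=> mA; rewrite /normal_prob.
transitivity (\int[pushforward mu (-%R : R -> measurableTypeR R)]_(x in A) (normal_pdf 0 sigma x)%:E)%E.
  rewrite ge0_integral_pushforward//=; last 2 first.
  - by apply/measurable_EFinP/measurable_funTS; exact: measurable_normal_pdf.
  - by move=> x _; rewrite lee_fin normal_pdf_ge0.
  apply: eq_integral => x _ /=; congr EFin.
  by rewrite !normal_pdfE// /normal_fun !subr0 sqrrN.
by apply: eq_measure_integral => B mB _; exact: lebesgue_measureN.
Qed.

(** The Radon-Nikodym derivative of the normal law coincides almost everywhere
    with its density. *)
Lemma integral_normal_prob (f : R -> \bar R) : measurable_fun setT f ->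
  (forall x, 0 <= f x)%E ->
  (\int[N]_x f x = \int[mu]_x (f x * (normal_pdf 0 sigma x)%:E))%E.
Proof.
move=> mf f0.
have dom : N `<< mu by exact: normal_prob_dominates.
rewrite -(Radon_Nikodym_SigmaFinite.change_of_variables dom)//.
have mpdf : measurable_fun setT (fun x => (normal_pdf 0 sigma x)%:E).
  by apply/measurable_EFinP; exact: measurable_normal_pdf.
have mrn := measurable_int _ (Radon_Nikodym_SigmaFinite.f_integrable dom).
apply: ae_eq_integral => //.
- exact: emeasurable_funM.
- exact: emeasurable_funM.
apply: ae_eqe_mul2l; apply: integral_ae_eq => //.
- exact: Radon_Nikodym_SigmaFinite.f_integrable.
- by move=> E _ mE; rewrite -Radon_Nikodym_SigmaFinite.f_integral.
Qed.

(** Integrability of the first moment: [x] is absorbed by passing to the density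
    of standard deviation [2 * sigma], which decays more slowly. *)
Lemma integral_normal_pos_lty : (\int[N]_x (Num.max x 0)%:E < +oo)%E.
Proof.
have mpos : measurable_fun setT (fun x : R => (Num.max x 0)%:E).
  by apply/measurable_EFinP; exact: measurable_maxr.
rewrite integral_normal_prob//; last by move=> x; rewrite lee_fin le_max lexx orbT.
pose s2 := 2 * sigma.
have s20 : s2 != 0 by rewrite mulf_neq0.
pose C := (1 + 8 * sigma ^+ 2) * normal_peak sigma / normal_peak s2.
apply: (@le_lt_trans _ _ (\int[mu]_x (C * normal_pdf 0 s2 x)%:E)%E).
  apply: ge0_le_integral => //.
  - by move=> x _; rewrite -EFinM lee_fin mulr_ge0 ?normal_pdf_ge0// le_max lexx orbT.
  - apply: emeasurable_funM => //.
    by apply/measurable_EFinP; exact: measurable_normal_pdf.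
  - apply/measurable_EFinP/measurable_funM => //.
    exact: measurable_normal_pdf.
  move=> x _; rewrite -EFinM lee_fin !normal_pdfE//.
  have p2 := normal_peak_gt0 s20; have p1 := normal_peak_gt0 sigma0.
  rewrite /C -!mulrA (mulrA (normal_peak s2)^-1) mulVf ?gt_eqF// mul1r.
  rewrite [leRHS]mulrCA [leLHS]mulrCA ler_pM2l// /normal_fun !subr0.
  have sg : 0 < sigma ^+ 2 by rewrite exprn_even_gt0//=.
  (* The difference of the exponents of the two densities. *)
  pose y := 3 * x ^+ 2 / (8 * sigma ^+ 2).
  have y0 : 0 <= y.
    by apply: divr_ge0; apply: mulr_ge0 => //; exact: sqr_ge0.
  have -> : - x ^+ 2 / (sigma ^+ 2 *+ 2) = - x ^+ 2 / (s2 ^+ 2 *+ 2) - y.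
    by rewrite /y /s2; field.
  rewrite expRD mulrCA [leRHS]mulrC ler_wpM2l ?expR_ge0// expRN ler_pdivrMr ?expR_gt0//.
  have xy : Num.max x 0 <= (1 + 8 * sigma ^+ 2) * (1 + y).
    have -> : (1 + 8 * sigma ^+ 2) * (1 + y) = 1 + y + 8 * sigma ^+ 2 + 3 * x ^+ 2.
      by rewrite /y; field.
    rewrite ge_max; apply/andP; split; last by move: (sqr_ge0 x) y0 sg; lra.
    by have := sqr_ge0 (x - 1); move: y0 sg (sqr_ge0 x); rewrite sqrrB1; lra.
  apply: (le_trans xy); rewrite ler_wpM2l ?expR_ge1Dx//; lra.
under eq_integral do rewrite EFinM.
rewrite integralZl//; last exact: integrable_normal_pdf.
by rewrite integral_normal_pdf mule1 ltry.
Qed.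

Lemma integral_normal_neg :
  (\int[N]_x (Num.max (- x) 0)%:E = \int[N]_x (Num.max x 0)%:E)%E.
Proof.
transitivity (\int[pushforward N (-%R : R -> measurableTypeR R)]_x (Num.max x 0)%:E)%E.
  rewrite ge0_integral_pushforward//.
  - by apply/measurable_EFinP; exact: measurable_maxr.
  - by move=> x _; rewrite lee_fin le_max lexx orbT.
by apply: eq_measure_integral => B mB _; exact: normal_prob_opp.
Qed.

End gaussian.

Section independence.
Context {R : realType} {d : measure_display} {Omega : measurableType d}.
Variables (P : probability Omega R) (eta X : Omega -> R).
Hypotheses (meta : measurable_fun setT eta) (mX : measurable_fun setT X).
Hypothesis indep : forall A B, measurable A -> measurable B ->
  P (eta @^-1` A `&` X @^-1` B) = (P (eta @^-1` A) * P (X @^-1` B))%E.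

(** The joint law is the product of the two laws, since they agree on rectangles;
    Tonelli then separates the integrals. *)
Lemma expectation_indep (f g : R -> R) :
  measurable_fun setT f -> measurable_fun setT g ->
  (forall x, 0 <= f x) -> (forall x, 0 <= g x) ->
  (\int[P]_w (f (eta w) * g (X w))%:E =
   \int[P]_w (f (eta w))%:E * \int[P]_w (g (X w))%:E)%E.
Proof.
move=> mf mg f0 g0.
pose pr w := (eta w, X w).
have mpr : measurable_fun setT pr by exact: measurable_fun_pair.
pose eta' : {RV P >-> R} := HB.pack eta (isMeasurableFun.Build _ _ _ _ _ meta).
pose X' : {RV P >-> R} := HB.pack X (isMeasurableFun.Build _ _ _ _ _ mX).
pose pr' : {RV P >-> (R * R)%type} :=
  HB.pack pr (isMeasurableFun.Build _ _ _ _ _ mpr).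
pose h (z : R * R) := (f z.1 * g z.2)%:E.
have mh : measurable_fun setT h.
  by apply/measurable_EFinP; apply: measurable_funM; exact: measurableT_comp.
have h0 z : (0 <= h z)%E by rewrite lee_fin mulr_ge0.
have mEf : measurable_fun setT (EFin \o f) by exact/measurable_EFinP.
have mEg : measurable_fun setT (EFin \o g) by exact/measurable_EFinP.
transitivity (\int[distribution P pr']_z h z)%E.
  by rewrite ge0_integral_distribution.
transitivity (\int[(distribution P eta' \x distribution P X')%E]_z h z)%E.
  apply: eq_measure_integral => S mS _; apply/esym.
  by apply: product_measure_unique => // A B mA mB; exact: indep.
have g0' x : setT x -> (0 <= (EFin \o g) x)%E by rewrite lee_fin.
have inner x : (\int[distribution P X']_y h (x, y) =
    (f x)%:E * \int[P]_w (g (X w))%:E)%E.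
  rewrite -(ge0_integral_distribution X' (f := EFin \o g))//.
  have <- := ge0_integralZl (distribution P X') measurableT mEg g0' (k := (f x)%:E) _.
    by apply: eq_integral => y _; rewrite /h /= EFinM.
  by rewrite lee_fin.
rewrite fubini_tonelli1//.
under eq_integral => x _ do rewrite /fubini_F inner.
rewrite /= ge0_integralZr//.
  by rewrite (ge0_integral_distribution eta' (f := EFin \o f))//.
  by move=> y _; rewrite lee_fin.
by apply: integral_ge0 => y _; rewrite lee_fin.
Qed.

End independence.

Section brownian.
Context {R : realType} {d : measure_display} {Omega : measurableType d}.
Variables (P : probability Omega R) (W : R -> {RV P >-> R}).
Hypothesis P_complete : measure_is_complete P.

Lemma bm_filtration_measurable t A : bm_filtration W t A -> measurable A.
Proof.
apply: (smallest_sub (sigma_algebra_measurable _)) => {}A [[s [B [_ mB ->]]]|].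
  by rewrite -[X in measurable X]setTI; exact: measurable_funP.
exact: P_complete.
Qed.

Lemma bm_filtrationS s t : s <= t -> bm_filtration W s `<=` bm_filtration W t.
Proof.
move=> st; apply: sub_sigma_algebra2 => A [[r [B [/andP[r0 rs] mB AE]]]|]; last by right.
by left; exists r, B; split=> //; rewrite r0 (le_trans rs).
Qed.

Lemma adapted_preimage t d' (Y : measurableType d') (f : Omega -> Y) (B : set Y) :
  @measurable_fun _ _ (g_sigma_algebraType (bm_filtration W t)) Y setT f ->
  measurable B -> bm_filtration W t (f @^-1` B).
Proof.
move=> mf mB.
have <- : <<s bm_filtration W t>> = bm_filtration W t.
  exact: sigma_algebra_id (smallest_sigma_algebra _ _).
by rewrite -[_ @^-1` _]setTI; exact: mf.
Qed.

Lemma adapted_measurable_fun t d' (Y : measurableType d') (f : Omega -> Y) :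
  @measurable_fun _ _ (g_sigma_algebraType (bm_filtration W t)) Y setT f ->
  measurable_fun setT f.
Proof.
move=> mf _ B mB; rewrite setTI.
exact: bm_filtration_measurable (adapted_preimage mf mB).
Qed.

Hypothesis W_bm : is_brownian_motion W.

Lemma increment_gaussian_mean s t : 0 <= s -> s < t ->
  (\int[P]_w (Num.max (increment W s t w) 0)%:E < +oo)%E /\
  (\int[P]_w (Num.max (- increment W s t w) 0)%:E =
   \int[P]_w (Num.max (increment W s t w) 0)%:E)%E.
Proof.
move=> s0 st.
have mX : measurable_fun setT (increment W s t) by exact: measurable_funB.
pose X : {RV P >-> measurableTypeR R} :=
  HB.pack (increment W s t) (isMeasurableFun.Build _ _ _ (measurableTypeR R) _ mX).
have sig0 : Num.sqrt (t - s) != 0 by rewrite gt_eqF// sqrtr_gt0 subr_gt0.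
have XN (f : R -> R) : measurable_fun setT f -> (forall x, 0 <= f x) ->
    (\int[P]_w (f (increment W s t w))%:E =
     \int[normal_prob 0 (Num.sqrt (t - s))]_x (f x)%:E)%E.
  move=> mf f0.
  have mEf : measurable_fun setT (EFin \o f) by exact/measurable_EFinP.
  transitivity (\int[distribution P X]_x (f x)%:E)%E.
    by rewrite (ge0_integral_distribution X (f := EFin \o f)).
  apply: (eq_measure_integral (normal_prob 0 (Num.sqrt (t - s)))) => B mB _; apply: (bm_normal W_bm) => //.
  by rewrite s0.
have max0 (x : R) : 0 <= Num.max x 0 by rewrite le_max lexx orbT.
rewrite (XN (fun x => Num.max x 0))//; last exact: measurable_maxr.
rewrite (XN (fun x => Num.max (- x) 0))//; last by apply: measurable_maxr.
by split; [exact: integral_normal_pos_lty|exact: integral_normal_neg].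
Qed.

(** A bounded factor known at time [s] is independent of the centred increment
    after [s].  To use independence for nonnegative functions only, the increment is split
    into its positive and negative parts, which have the same mean by symmetry of the normal law,
    and the factor is shifted by [M]. *)
Lemma increment_martingale s t (eta : Omega -> R) (M : R) :
  0 <= s -> s <= t ->
  @measurable_fun _ _ (g_sigma_algebraType (bm_filtration W s)) R setT eta ->
  (forall w, `|eta w| <= M) ->
  P.-integrable setT (fun w => (eta w * increment W s t w)%:E) /\
  (\int[P]_w (eta w * increment W s t w)%:E = 0)%E.
Proof.
move=> s0; rewrite le_eqVlt => /predU1P[<- _ _|st meta etaM].
  rewrite (_ : (fun w => _) = cst 0%E); last first.
    by apply/funext => w; rewrite /increment subrr mulr0.
  by split; [exact: integrable0|rewrite integral0].
have [cfin cneg] := increment_gaussian_mean s0 st.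
have mX : measurable_fun setT (increment W s t) by exact: measurable_funB.
have meta' : measurable_fun setT eta := adapted_measurable_fun meta.
have ind A B : measurable A -> measurable B ->
    P (eta @^-1` A `&` increment W s t @^-1` B)
    = (P (eta @^-1` A) * P (increment W s t @^-1` B))%E.
  move=> mA mB; apply: (bm_indep W_bm) => //; first by rewrite s0 ltW.
  exact: (adapted_preimage (Y := R) meta mA).
pose X := increment W s t.
pose Xp w := Num.max (X w) 0; pose Xn w := Num.max (- X w) 0.
have mmp : measurable_fun setT (fun x : R => Num.max x 0) by exact: measurable_maxr.
have mmn : measurable_fun setT (fun x : R => Num.max (- x) 0) by exact: measurable_maxr.
have mXp : measurable_fun setT Xp by exact: (measurableT_comp mmp mX).
have mXn : measurable_fun setT Xn by exact: (measurableT_comp mmn mX).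
have Xp0 w : 0 <= Xp w by rewrite le_max lexx orbT.
have Xn0 w : 0 <= Xn w by rewrite le_max lexx orbT.
have XE w : X w = Xp w - Xn w.
  rewrite /Xp /Xn; case: (leP (X w) 0) => h.
    by rewrite max_l ?oppr_ge0// sub0r opprK.
  by rewrite max_r ?subr0// oppr_le0 ltW.
have iXp : P.-integrable setT (EFin \o Xp).
  apply/integrableP; split; first exact/measurable_EFinP.
  by under eq_integral do rewrite gee0_abs ?lee_fin//.
have iXn : P.-integrable setT (EFin \o Xn).
  apply/integrableP; split; first exact/measurable_EFinP.
  by under eq_integral do rewrite gee0_abs ?lee_fin//; rewrite cneg.
have iX : P.-integrable setT (EFin \o X).
  rewrite (_ : EFin \o X = (EFin \o Xp) \- (EFin \o Xn))%E; last first.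
    by apply/funext => w; rewrite /= XE.
  exact: integrableB.
have X0 : (\int[P]_w (X w)%:E = 0)%E.
  under eq_integral do rewrite XE EFinB.
  rewrite integralB//= cneg subee// ge0_fin_numE//.
  by apply: integral_ge0 => w _; rewrite lee_fin Xp0.
(* Nonnegative, and a function of [eta] only. *)
pose e' w := eta w + M.
have e'0 w : 0 <= e' w.
  by rewrite /e' -lerBlDr sub0r; have := etaM w; rewrite ler_norml => /andP[].
have e'M w : e' w <= M + M.
  by rewrite /e' lerD2r (le_trans (ler_norm _)).
have me' : measurable_fun setT e' by exact: measurable_funD.
have mpos : measurable_fun setT (fun x : R => Num.max (x + M) 0).
  by apply: measurable_maxr => //; exact: measurable_funD.
have e'E w : e' w = Num.max (eta w + M) 0 by rewrite max_l//; exact: e'0.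
have ep : (\int[P]_w (e' w * Xp w)%:E = \int[P]_w (e' w)%:E * \int[P]_w (Xp w)%:E)%E.
  under eq_integral do rewrite e'E.
  under [X in _ = (X * _)%E]eq_integral do rewrite e'E.
  apply: (expectation_indep meta' mX ind (f := fun x => Num.max (x + M) 0)
    (g := fun x => Num.max x 0)) => // x; by rewrite le_max lexx orbT.
have en : (\int[P]_w (e' w * Xn w)%:E = \int[P]_w (e' w)%:E * \int[P]_w (Xp w)%:E)%E.
  rewrite -cneg.
  under eq_integral do rewrite e'E.
  under [X in _ = (X * _)%E]eq_integral do rewrite e'E.
  apply: (expectation_indep meta' mX ind (f := fun x => Num.max (x + M) 0)
    (g := fun x => Num.max (- x) 0)) => // x; by rewrite le_max lexx orbT.
have bnd (f h : Omega -> R) (K : R) : measurable_fun setT f ->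
    (forall w, `|f w| <= K) -> P.-integrable setT (EFin \o h) ->
    P.-integrable setT (fun w => (f w * h w)%:E).
  move=> mf fK ih.
  rewrite (_ : (fun w => _) = (EFin \o f) \* (EFin \o h))%E//.
  apply: integrableMr => //.
  exists K; split; first exact: num_real.
  by move=> L KL w _ /=; rewrite (le_trans (fK w))// ltW.
have e'b w : `|e' w| <= M + M by rewrite ger0_norm.
split; first exact: bnd meta' etaM iX.
have -> : (\int[P]_w (eta w * X w)%:E =
    \int[P]_w ((e' w * Xp w)%:E - (e' w * Xn w)%:E - (M * X w)%:E))%E.
  apply: eq_integral => w _; rewrite -!EFinB; congr EFin.
  by rewrite /e' XE; ring.
have ie'p := bnd _ _ _ me' e'b iXp.
have ie'n := bnd _ _ _ me' e'b iXn.
have iMX : P.-integrable setT (fun w => (M * X w)%:E).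
  by apply: (bnd (cst M) X `|M|).
rewrite integralB//; last exact: integrableB.
rewrite integralB// ep en subee; last first.
  by rewrite -ep; exact: integrable_fin_num.
under [X in (_ - X)%E]eq_integral do rewrite EFinM.
by rewrite integralZl// X0 mule0 sube0.
Qed.

End brownian.

Section ito_mean.
Context {R : realType} {d : measure_display} {Omega : measurableType d}.
Variables (P : probability Omega R) (W : R -> {RV P >-> R}).
Hypotheses (P_complete : measure_is_complete P) (W_bm : is_brownian_motion W).

Lemma sp_time_ge a b (S : simple_process W a b) i :
  (i <= sp_size S)%N -> a <= sp_time S i.
Proof.
elim: i => [|i ih] iS; first by rewrite sp_first.
by rewrite (le_trans (ih (ltnW iS)))// sp_mono.
Qed.

(** Every term of the elementary integral is a bounded coefficient known at the
    left end of its interval, times the increment over it; multiplying by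
    [\1_A] preserves this since [A] belongs to the past of [a]. *)
Lemma sp_integral_mean a b (S : simple_process W a b) (A : set Omega) :
  0 <= a -> bm_filtration W a A ->
  P.-integrable setT (EFin \o sp_integral S) /\
  (\int[P]_w (\1_A w * sp_integral S w)%:E = 0)%E.
Proof.
move=> a0 FA; have [M SM] := sp_bounded S.
have term (B : set Omega) (i : 'I_(sp_size S)) : bm_filtration W a B ->
    P.-integrable setT (fun w => (\1_B w * sp_coef S i w *
       increment W (sp_time S i) (sp_time S i.+1) w)%:E) /\
    (\int[P]_w (\1_B w * sp_coef S i w *
       increment W (sp_time S i) (sp_time S i.+1) w)%:E = 0)%E.
  move=> FB; have aS : a <= sp_time S i by apply: sp_time_ge; exact: ltnW.
  apply: (increment_martingale P_complete W_bm (M := M)).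
  - exact: le_trans aS.
  - exact: sp_mono.
  - apply: measurable_funM; last exact: sp_adapted.
    apply: measurable_indic; apply: sub_sigma_algebra.
    exact: bm_filtrationS FB.
  - move=> w; have := SM i w (ltn_ord i); apply: le_trans.
    rewrite normrM ler_piMl// indicE; case: (_ \in _) => /=; rewrite ?normr1 ?normr0//.
have sumE (B : set Omega) : (fun w => (\1_B w * sp_integral S w)%:E) =
    fun w => (\sum_(i < sp_size S) (\1_B w * sp_coef S i w *
       increment W (sp_time S i) (sp_time S i.+1) w)%:E)%E.
  apply/funext => w; rewrite sumEFin /sp_integral mulr_sumr; congr EFin.
  by apply: eq_bigr => i _; rewrite mulrA.
split; last first.
  rewrite sumE integral_sum//; last by move=> i; exact: (term A i FA).1.
  by rewrite big1// => i _; exact: (term A i FA).2.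
have FT : bm_filtration W a setT.
  by rewrite -setC0; apply: sigma_algebraC; exact: sigma_algebra0.
rewrite (_ : _ \o _ = fun w => (\1_setT w * sp_integral S w)%:E); last first.
  by apply/funext => w; rewrite /= indicT mul1r.
by rewrite sumE; apply: integrable_sum => // i _; have [h _] := term setT i FT; exact: h.
Qed.

(** The property passes from elementary integrals to their L^2 limit because
    convergence in L^2 implies convergence in L^1. *)
Lemma ito_integral_mean a b (H : R -> Omega -> R) (I : Omega -> R) (A : set Omega) :
  0 <= a -> is_ito_integral W a b H I -> bm_filtration W a A ->
  P.-integrable setT (EFin \o I) /\ (\int[P]_w (\1_A w * I w)%:E = 0)%E.
Proof.
move=> a0 [mI [S [_ SI]]] FA.
have mA : measurable A := bm_filtration_measurable P_complete FA.
have approx e : 0 < e -> exists2 S0 : simple_process W a b, 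
    P.-integrable setT (fun w => (I w - sp_integral S0 w)%:E) &
    (\int[P]_w `|(I w - sp_integral S0 w)%:E| <= (2 * e)%:E)%E.
  move=> e0.
  have [k Ik] : exists k, (\int[P]_w ((I w - sp_integral (S k) w) ^+ 2)%:E <= (e ^+ 2)%:E)%E.
    move: SI => /fine_cvgP[fI /cvgr0Pnorm_le/(_ _ (exprn_gt0 2 e0))].
    move=> /(filterI fI)[k _ /(_ k (leqnn k))[fk hk]]; exists k.
    by rewrite -(fineK fk) lee_fin (le_trans (ler_norm _)).
  have [iS _] := sp_integral_mean (S k) a0 FA.
  have mS : measurable_fun setT (sp_integral (S k)).
    by apply/measurable_EFinP; exact: measurable_int iS.
  have mIS : measurable_fun setT (fun w => I w - sp_integral (S k) w).
    exact: measurable_funB.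
  have le2 : (\int[P]_w `|(I w - sp_integral (S k) w)%:E| <= (2 * e)%:E)%E.
    (* Pointwise, [|x| <= e + x ^+ 2 / e]. *)
    apply: (@le_trans _ _ (\int[P]_w (e%:E + e^-1%:E * ((I w - sp_integral (S k) w) ^+ 2)%:E))%E).
      apply: ge0_le_integral => //.
      - by apply: measurableT_comp => //; exact/measurable_EFinP.
      - apply: emeasurable_funD => //; apply: emeasurable_funM => //.
        by apply/measurable_EFinP; exact: measurable_funX.
      - move=> w _; rewrite -EFinM -EFinD lee_fin.
        set x := _ - _; rewrite -real_normK ?num_real//.
        set y := `|x|.
        rewrite -(ler_pM2l e0) mulrDr mulrA divff ?gt_eqF// mul1r.
        have := sqr_ge0 (y - e); have := sqr_ge0 y; have := sqr_ge0 e.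
        by rewrite sqrrB !expr2; lra.
    rewrite ge0_integralD//; last 3 first.
    - by move=> w _; rewrite lee_fin ltW.
    - by move=> w _; rewrite -EFinM lee_fin mulr_ge0 ?sqr_ge0// invr_ge0 ltW.
    - apply: emeasurable_funM => //.
      by apply/measurable_EFinP; exact: measurable_funX.
    rewrite [X in (X + _ <= _)%E](_ : _ = e%:E); last first.
      by rewrite integral_cst//= [X in (_ * X)%E]probability_setT mule1.
    rewrite ge0_integralZl//; last 3 first.
    - by apply/measurable_EFinP; exact: measurable_funX.
    - by move=> w _; rewrite lee_fin sqr_ge0.
    - by rewrite lee_fin invr_ge0 ltW.
    apply: (@le_trans _ _ (e%:E + e^-1%:E * (e ^+ 2)%:E)%E).
      by rewrite leeD2l// lee_wpmul2l// lee_fin invr_ge0 ltW.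
    by rewrite -EFinM -EFinD lee_fin expr2 mulrA mulVf ?gt_eqF// mul1r; lra.
  exists (S k) => //; apply/integrableP; split; first exact/measurable_EFinP.
  by rewrite (le_lt_trans le2)// ltry.
have iI : P.-integrable setT (EFin \o I).
  have [S0 iIS _] := approx 1 ltr01.
  have [iS _] := sp_integral_mean S0 a0 FA.
  rewrite (_ : EFin \o I = (fun w => (I w - sp_integral S0 w)%:E) \+ (EFin \o sp_integral S0))%E.
    exact: integrableD.
  by apply/funext => w; rewrite /= -EFinD subrK.
have iA (f : Omega -> R) : P.-integrable setT (EFin \o f) ->
    P.-integrable setT (fun w => (\1_A w * f w)%:E).
  move=> i_f; rewrite (_ : (fun w => _) = (EFin \o \1_A) \* (EFin \o f))%E//.
  apply: integrableMr => //; exists 1; split => // L L1 w _ /=.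
  by rewrite indicE; case: (_ \in _); rewrite /= ?normr1 ?normr0 ltW// (lt_trans _ L1).
split => //.
apply/eqP; rewrite -abse_eq0 eq_le abse_ge0 andbT; apply/lee_addgt0Pr => e e0.
rewrite add0e.
have [S0 iIS le2] := approx (e / 2) (divr_gt0 e0 (ltr0Sn R 1)).
have [iS S00] := sp_integral_mean S0 a0 FA.
have -> : (\int[P]_w (\1_A w * I w)%:E = \int[P]_w (\1_A w * (I w - sp_integral S0 w))%:E)%E.
  rewrite -[LHS]sube0 -S00 -integralB//; [|exact: iA|exact: iA].
  by apply: eq_integral => w _; rewrite -EFinB mulrBr.
rewrite (le_trans (le_abse_integral _ _ _))//.
  exact: measurable_int (iA _ iIS).
rewrite (le_trans _ (le_trans le2 _))//; last by rewrite lee_fin mulrC divfK.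
apply: ge0_le_integral => //.
- by apply: measurableT_comp => //; exact: measurable_int (iA _ iIS).
- by apply: measurableT_comp => //; exact: measurable_int iIS.
- move=> w _; rewrite lee_fin normrM ler_piMl// indicE.
  by case: (_ \in _); rewrite /= ?normr1 ?normr0.
Qed.

End ito_mean.

(** * Measurability with respect to the completed square *)

Section completed_square.
Context {R : realType} {d : measure_display} {Omega : measurableType d}.
Variables (P : probability Omega R).
Context {dx : measure_display} {X : measurableType dx}.
Local Notation PP := (P \x P)%E.
Local Notation Oc := (g_sigma_algebraType (completed_square P measurable)).

(** Only the coordinate in [Omega * Omega] is restricted: one null set of the
    square works for all [x] at once. *)
Definition equal_off_null (S : set (X * (Omega * Omega))) (M : set (Omega * Omega)) :=
  exists2 S' : set (X * (Omega * Omega)), measurable S' &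
    forall x q, ~ M q -> S (x, q) <-> S' (x, q).

Definition almost_product_measurable (S : set (X * (Omega * Omega))) :=
  exists2 M : set (Omega * Omega), measurable M /\ PP M = 0%E & equal_off_null S M.

Lemma sigma_algebra_almost_product_measurable :
  sigma_algebra setT almost_product_measurable.
Proof.
split.
- exists set0; first by split; [exact: measurable0|rewrite measure0].
  by exists set0.
- move=> S [M hM [S' mS' SS']]; exists M => //; exists (setT `\` S').
    exact: measurableD.
  by move=> x q nM; split=> -[_ h]; split=> // h'; apply: h; apply/SS'.
- move=> S hS; pose M k := s2val (cid2 (hS k)).
  have M0 k : measurable (M k) /\ PP (M k) = 0%E by rewrite /M; case: cid2.
  have MS k : equal_off_null (S k) (M k) by rewrite /M; case: cid2.
  exists (\bigcup_k M k).
    have mU : measurable (\bigcup_k M k).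
      by apply: bigcupT_measurable => k; case: (M0 k).
    split=> //; apply/negligibleP => //; apply: negligible_bigcup => k.
    by case: (M0 k) => mk k0; exact/negligibleP.
  pose S' k := s2val (cid2 (MS k)).
  have mS' k : measurable (S' k) by rewrite /S'; case: cid2.
  have SS' k : forall x q, ~ M k q -> S k (x, q) <-> S' k (x, q).
    by rewrite /S'; case: cid2.
  exists (\bigcup_k S' k); first exact: bigcupT_measurable.
  move=> x q nM; split=> -[k _ h]; exists k => //; apply/(SS' k) => //.
    by move=> Mk; apply: nM; exists k.
  by move=> Mk; apply: nM; exists k.
Qed.

Lemma completed_square_product_measurable (S : set (X * Oc)) :
  measurable S -> almost_product_measurable S.
Proof.
have sK := sigma_algebra_almost_product_measurable.
apply: smallest_sub => // _ [[A mA <-]|[C mC <-]]; rewrite setTI.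
  exists set0; first by split; [exact: measurable0|rewrite measure0].
  exists (fst @^-1` A) => //.
  by rewrite -[X in measurable X]setTI; exact: measurable_fst.
pose K' := [set C : set (Omega * Omega) |
  almost_product_measurable (snd @^-1` C)].
have sK' : sigma_algebra setT K'.
  have [K0 KC KU] := sK; split.
  - by rewrite /K' /= preimage_set0.
  - by move=> A; rewrite /K' /= => /KC; rewrite !setTD -preimage_setC.
  - by move=> A KA; rewrite /K' /= preimage_bigcup; exact: KU.
have base (B : set (Omega * Omega)) : measurable B -> K' B.
  move=> mB; exists set0; first by split; [exact: measurable0|rewrite measure0].
  exists (snd @^-1` B) => //.
  by rewrite -[X in measurable X]setTI; exact: measurable_snd.
suff : K' C by [].
move: C mC; apply: smallest_sub => // C mC; move: C mC.
apply: smallest_sub => // C [[A [B [mA mB ->]]]|[M [mM M0 CM]]].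
  by apply: base; exact: measurableX.
exists M => //; exists set0 => // x q nM; split=> // Cq.
by apply: nM; exact: CM.
Qed.

(** Completing the square only adds null sets, so a countable family of functions
    becomes measurable for the plain product sigma-algebra once it is set to 0
    on a single null set of the square.  Tonelli and [ae_swap] then apply. *)
Lemma completed_square_product_measurable_fun (I : countType)
    (f : I -> X * Oc -> R) :
  (forall i, measurable_fun setT (f i)) ->
  exists2 M : set (Omega * Omega), measurable M /\ PP M = 0%E &
    forall i, measurable_fun setT
      (fun z : X * (Omega * Omega) => if z.2 \in M then 0 else f i z).
Proof.
move=> mf.
have mS (t : I * rat) : measurable [set z | ratr t.2 < f t.1 z].
  rewrite -[X in measurable X]setTI.
  exact: (measurable_fun_ltr (measurable_cst _) (mf t.1)).
have hS t := completed_square_product_measurable (mS t).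
pose Mt t := s2val (cid2 (hS t)).
have M0 t : measurable (Mt t) /\ PP (Mt t) = 0%E by rewrite /Mt; case: cid2.
have MS t : equal_off_null [set z | ratr t.2 < f t.1 z] (Mt t) by rewrite /Mt; case: cid2.
pose M := \bigcup_t Mt t.
have mM : measurable M.
  by apply: countable_bigcupT_measurable => // t; case: (M0 t).
have MM0 : PP M = 0%E.
  apply/(ae_not_measure0 PP mM).
  have : {ae PP, forall q, forall t, ~ Mt t q}.
    apply: ae_forall_countable => t; have [mt t0] := M0 t.
    exact/(ae_not_measure0 PP mt).
  by apply: filterS => q nM [t _]; exact: nM.
exists M => // i.
move=> mT; apply: (measurability _ (RGenOInfty.measurableE R)) => // _ [_ [x ->] <-].
rewrite setTI.
pose S' t := s2val (cid2 (MS t)).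
have mS' t : measurable (S' t) by rewrite /S'; case: cid2.
have SS' t : forall x q, ~ Mt t q -> [set z | ratr t.2 < f t.1 z] (x, q) <-> S' t (x, q).
  by rewrite /S'; case: cid2.
have mM2 : measurable (snd @^-1` M : set (X * (Omega * Omega))).
  by rewrite -[X in measurable X]setTI; exact: measurable_snd.
rewrite (_ : _ @^-1` _ =
  (\bigcup_(q in [set q : rat | x < ratr q]) S' (i, q)) `\` snd @^-1` M `|`
  (if x < 0 then snd @^-1` M else set0)).
  apply: measurableU; last by case: ifP.
  apply: measurableD => //.
  rewrite bigcup_mkcond; apply: countable_bigcupT_measurable => // r.
  by case: ifP.
apply/seteqP; split=> -[y q] /=; rewrite in_itv/= andbT.
  case: ifPn => [/set_mem Mq x0|/negP nMq xf]; first by right; rewrite x0.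
  left; split; last by move=> Mq; apply: nMq; exact/mem_set.
  have [r] := rat_in_itvoo xf; rewrite in_itv/= => /andP[xr rf].
  exists r => //; apply/(SS' (i, r)) => //.
  by move=> Mq; apply: nMq; apply/mem_set; exists (i, r).
case=> [[[r xr Sq] nMq]|]; last first.
  by case: ifP => // x0 Mq; rewrite mem_set.
rewrite memNset//; apply: (lt_trans xr); apply/(SS' (i, r)) => //.
by move=> Mq; apply: nMq; exists (i, r).
Qed.

End completed_square.

(** * A backward Gronwall lemma *)

Section gronwall.
Context {R : realType}.
Local Notation mu := (@lebesgue_measure R).

Lemma measurable_Delta (T : R) : measurable (Delta T).
Proof.
have m1 : measurable_fun setT (fun p : R * R => p.1) by exact: measurable_fst.
have m2 : measurable_fun setT (fun p : R * R => p.2) by exact: measurable_snd.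
rewrite (_ : Delta T = [set p | 0 <= p.1] `&` [set p | p.1 <= p.2] `&` [set p | p.2 <= T]).
  by apply: measurableI; [apply: measurableI|]; rewrite -[X in measurable X]setTI;
    apply: measurable_fun_ler.
by apply/seteqP; split=> p /=; rewrite /Delta/=; [move=> [? []]|move=> [[]]].
Qed.

Lemma integral_expR_le (k s : R) : 0 < k -> 0 <= s ->
  (\int[mu]_(t in `[0%R, s]) (expR (k * t))%:E <= (k^-1 * expR (k * s))%:E)%E.
Proof.
move=> k0; rewrite le_eqVlt => /predU1P[<-|s0].
  rewrite set_itv1 integral_set1 lee_fin mulr_ge0 ?expR_ge0// invr_ge0 ltW//.
pose F (t : R) := k^-1 * expR (k * t).
have dF (t : R) : is_derive t 1 F (expR (k * t)).
  have dk : is_derive t 1 (fun u : R => k * u) k.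
    have := @is_deriveZ R R R id k t 1 1 (is_derive_id _ _).
    by rewrite [k *: 1]mulr1.
  have dE := is_derive1_comp (is_derive_expR (k * t)) dk.
  have := @is_deriveZ R R R (expR \o (fun u => k * u)) k^-1 t 1 _ dE.
  by rewrite [_ *: _]mulrC mulfK ?gt_eqF.
have cF : continuous F.
  by move=> t; apply/differentiable_continuous/derivable1_diffP; case: (dF t).
rewrite (@continuous_FTC2 _ _ F)//.
- by rewrite -EFinB lee_fin lerBlDr lerDl /F mulr_ge0 ?expR_ge0// invr_ge0 ltW.
- apply: continuous_subspaceT => t.
  apply: (continuous_comp (f := fun t => k * t)); last exact: continuous_expR.
  exact: mulrl_continuous.
- split; first by move=> t _; case: (dF t).
  + by apply: cvg_at_right_filter; exact: cF.
  + by apply: cvg_at_left_filter; exact: cF.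
- by move=> t _; rewrite derive1E; case: (dF t).
Qed.

(** Multiply by the weight [expR (2 * K * t)] and integrate over [[0, T]].
    Exchanging the integrals, the weighted integral [X] of [e] satisfies
    [X <= X / 2], and [X] is finite. *)
Lemma gronwall_backward (T K : R) (e : R -> \bar R) : 0 < K ->
  measurable_fun setT e -> (forall t, 0 <= e t)%E ->
  (\int[mu]_(t in `[0%R, T]) e t < +oo)%E ->
  {ae mu, forall t, 0 <= t <= T ->
     (e t <= K%:E * \int[mu]_(s in `[t, T]) e s)%E} ->
  {ae mu, forall t, 0 <= t <= T -> e t = 0%E}.
Proof.
move=> K0 me e0 efin he.
pose w (t : R) := expR (2 * K * t).
have w0 t : 0 <= w t by exact: expR_ge0.
have mw : measurable_fun setT w.
  by apply: measurableT_comp => //; exact: measurable_funM.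
have mwe : measurable_fun setT (fun t => (w t)%:E * e t)%E.
  by apply: emeasurable_funM => //; exact/measurable_EFinP.
have we0 t : (0 <= (w t)%:E * e t)%E by rewrite mule_ge0// lee_fin.
pose we : R -> \bar R := fun t => ((w t)%:E * e t)%E.
pose X := (\int[mu]_(t in `[0%R, T]) ((w t)%:E * e t))%E.
have X0 : (0 <= X)%E by apply: integral_ge0.
have Xfin : X \is a fin_num.
  rewrite ge0_fin_numE//.
  apply: (@le_lt_trans _ _ (\int[mu]_(t in `[0%R, T]) ((w T)%:E * e t))%E).
    apply: ge0_le_integral => //.
    - exact: measurable_funTS.
    - by apply: measurable_funTS; apply: emeasurable_funM.
    - move=> t /=; rewrite in_itv/= => /andP[_ tT].
      by rewrite lee_wpmul2r// lee_fin ler_expR ler_pM2l// mulr_gt0.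
  rewrite ge0_integralZl//; last 2 first.
  - exact: measurable_funTS.
  - by rewrite lee_fin.
  by rewrite lte_mul_pinfty// lee_fin.
pose RR := (measurableTypeR R * measurableTypeR R)%type.
pose k (p : RR) : \bar R := ((w p.1 * \1_(Delta T) p)%:E * e p.2)%E.
have mk : measurable_fun setT k.
  apply: emeasurable_funM; last exact: measurableT_comp.
  apply/measurable_EFinP; apply: measurable_funM; first exact: measurableT_comp.
  exact: measurable_indic (measurable_Delta T).
have k0 p : (0 <= k p)%E.
  by rewrite mule_ge0// lee_fin mulr_ge0// indicE; case: (_ \in _).
have mF : measurable_fun setT (fun t : measurableTypeR R => \int[mu]_s k (t, s))%E.
  exact: (measurable_fun_fubini_tonelli_F k mk k0).
have mG : measurable_fun setT (fun s : measurableTypeR R => \int[mu]_t k (t, s))%E.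
  exact: (measurable_fun_fubini_tonelli_G k mk k0).
have kt t : t \in `[0, T]%classic ->
    (\int[mu]_s k (t, s) = (w t)%:E * \int[mu]_(s in `[t, T]) e s)%E.
  rewrite inE/= in_itv/= => /andP[t0 tT].
  rewrite -ge0_integralZl//; last 2 first.
  - exact: measurable_funTS.
  - by rewrite lee_fin.
  rewrite [RHS]integral_mkcond; apply: eq_integral => s _.
  rewrite /k patchE indicE/=; case: ifPn => /=.
    by rewrite inE/= in_itv/= => /andP[ts sT]; rewrite mem_set ?mulr1.
  by move/negP => h; rewrite memNset ?mulr0 ?mul0e// => -[_ [ts sT]];
    apply: h; rewrite inE/= in_itv/= ts.
have ks s : (\int[mu]_t k (t, s) <=
    ((2 * K)^-1)%:E * (we \_ `[0%R, T]) s)%E.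
  rewrite patchE; case: ifPn => /=; last first.
    move/negP => h; rewrite integral0_eq ?mule0// => t _.
    rewrite /k indicE memNset ?mulr0 ?mul0e// => -[/= t0 [ts sT]].
    by apply: h; rewrite inE/= in_itv/= (le_trans t0).
  rewrite inE/= in_itv/= => /andP[s0 sT].
  rewrite (_ : (fun t => k (t, s)) = fun t => (((EFin \o w) \_ `[0%R, s]) t * e s)%E); last first.
    apply/funext => t; rewrite /k/= patchE indicE; case: ifPn => /=.
      by rewrite inE/= in_itv/= => /andP[t0 ts]; rewrite mem_set ?mulr1.
    move/negP => h; rewrite memNset ?mulr0// => -[/= t0 [ts _]].
    by apply: h; rewrite inE/= in_itv/= t0.
  rewrite ge0_integralZr//; last 2 first.
  - apply/(measurable_restrictT _ _).1 => //.
    exact/measurable_EFinP/measurable_funTS.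
  - by move=> t _; apply: erestrict_ge0 => ? _; rewrite lee_fin.
  rewrite -integral_mkcond muleA -EFinM lee_wpmul2r//.
  by apply: integral_expR_le => //; rewrite mulr_gt0.
have X2 : (X <= 2^-1%:E * X)%E.
  apply: (@le_trans _ _ (\int[mu]_(t in `[0%R, T]) (K%:E * \int[mu]_s k (t, s)))%E).
    apply: ae_ge0_le_integral => //.
    - exact: measurable_funTS.
    - by move=> t _; apply: mule_ge0; [rewrite lee_fin ltW|exact: integral_ge0].
    - apply: measurable_funTS; apply: emeasurable_funM => //.
    - apply: (filterS (Filter := ae_filter_ringOfSetsType mu)) he => t het; rewrite /= in_itv/= => tT.
      rewrite kt ?inE/= ?in_itv//= muleCA lee_wpmul2l ?lee_fin//.
      exact: het.
  rewrite ge0_integralZl//; last 3 first.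
  - by apply: measurable_funTS; exact mF.
  - by move=> t _; apply: integral_ge0.
  - by rewrite lee_fin ltW.
  apply: (@le_trans _ _ (K%:E * \int[mu]_s \int[mu]_t k (t, s))%E).
    apply: lee_wpmul2l; first by rewrite lee_fin ltW.
    rewrite -(fubini_tonelli k)//.
    apply: ge0_subset_integral => //.
    - by move=> t _; apply: integral_ge0.
  have mp : measurable_fun setT (we \_ `[0%R, T]).
    by apply/(measurable_restrictT _ _).1 => //; exact: measurable_funTS.
  apply: (@le_trans _ _ (K%:E * \int[mu]_s (((2 * K)^-1)%:E * (we \_ `[0%R, T]) s))%E).
    apply: lee_wpmul2l; first by rewrite lee_fin ltW.
    apply: ge0_le_integral => //.
    - by move=> s _; apply: integral_ge0.
    - by apply: emeasurable_funM.
  rewrite ge0_integralZl//; last 2 first.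
  - by move=> t _; apply: erestrict_ge0 => x _; exact: we0.
  - by rewrite lee_fin invr_ge0 mulr_ge0// ltW.
  rewrite -integral_mkcond muleA -EFinM -/X invfM mulrCA mulfV ?gt_eqF// mulr1.
  by [].
have XE : X = 0%E.
  move: X0 X2; rewrite -(fineK Xfin) -EFinM !lee_fin => a b.
  by congr EFin; lra.
have : (\int[mu]_(t in `[0%R, T]) `|(w t)%:E * e t| = 0)%E.
  by rewrite -XE; apply: eq_integral => t _; rewrite gee0_abs.
move/(ae_eq_integral_abs _ _ _).1 => h.
apply: filterS (h _ _) => [t het tT||]; [|by []|exact: measurable_funTS].
have := het; rewrite /= in_itv/= tT => /(_ isT)/eqP.
by rewrite mule_eq0 eqe gt_eqF ?expR_gt0//= => /eqP.
Qed.

End gronwall.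

(** * Processes on the time horizon *)

Section borel_coordinates.
Context {R : realType}.

Lemma measurable_coord n (j : 'I_n) :
  @measurable_fun _ _ (borel_rV R n) R setT (fun x => x 0 j).
Proof.
move=> mT; apply: (measurability _ (RGenOpens.measurableE R)) => // _ [B [x [y ->]] <-].
rewrite setTI; apply: sub_sigma_algebra.
apply: open_comp; last exact: interval_open.
by move=> z _; exact: coord_continuous.
Qed.

End borel_coordinates.

Section processes.
Context {R : realType} {d : measure_display} {Omega : measurableType d}.
Variables (P : probability Omega R) (W : R -> {RV P >-> R}).
Hypothesis P_complete : measure_is_complete P.
Variables (T : R) (n : nat).
Local Notation mu := (@lebesgue_measure R).
Local Notation RO := (measurableTypeR R * Omega)%type.

(** Outside [[0, T]] the process carries no information; it is set to 0 so that
    it is jointly measurable on the whole line. *)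
Definition on_horizon (Y : R -> Omega -> 'rV[R]_n) (s : R) (w : Omega) : 'rV[R]_n :=
  if 0 <= s <= T then Y s w else 0.

Variable Y : R -> Omega -> 'rV[R]_n.
Hypothesis Y_L2 : L2_process W T Y.

(** Joint measurability is given with respect to the augmented filtration at time
    [T], which consists of measurable sets because [P] is complete. *)
Lemma measurable_on_horizon (j : 'I_n) :
  measurable_fun setT (fun p : RO => on_horizon Y p.1 p.2 0 j).
Proof.
have [mY _] := Y_L2.
pose OT := g_sigma_algebraType (bm_filtration W T).
have mD : measurable ([set` `[0, T]] `*` setT : set (R * OT)%type).
  by apply: measurableX.
have mYj : measurable_fun ([set` `[0, T]] `*` setT : set (R * OT)%type) (fun p => Y p.1 p.2 0 j).
  exact: (measurableT_comp (measurable_coord j) mY).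
have {mYj}/(measurable_restrictT _ mD) mYj := mYj.
have mid : @measurable_fun _ _ RO (R * OT)%type setT id.
  apply/measurable_fun_pairP; split; first exact: measurable_fst.
  move=> _ B mB; rewrite setTI.
  rewrite (_ : _ @^-1` B = setT `*` B); last by apply/seteqP; split=> p //= [].
  apply: measurableX => //.
  apply: (bm_filtration_measurable P_complete (W := W) (t := T)).
  have <- : <<s bm_filtration W T>> = bm_filtration W T.
    exact: sigma_algebra_id (smallest_sigma_algebra _ _).
  exact: mB.
have := measurableT_comp mYj mid.
rewrite (_ : _ \o id = fun p : RO => on_horizon Y p.1 p.2 0 j)//.
apply/funext => -[s w]; rewrite /on_horizon /= patchE.
case: ifPn => [/set_mem[/= ]|].
  by rewrite in_itv/= => ->.
move/negP => h; case: ifPn => sT; last by rewrite mxE.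
by exfalso; apply: h; apply/mem_set; split => //=; rewrite in_itv.
Qed.

Lemma measurable_norm1_on_horizon :
  measurable_fun setT (fun p : RO => norm1 (on_horizon Y p.1 p.2)).
Proof.
apply: measurable_sum => j; apply: measurableT_comp => //.
exact: measurable_on_horizon.
Qed.

(** Square integrability implies integrability on a space of finite measure;
    [|x| <= x ^+ 2 + 1] is the elementary form of this. *)
Lemma integral_norm1_lty :
  (\int[P]_w \int[mu]_(s in `[0%R, T]) (norm1 (on_horizon Y s w))%:E < +oo)%E.
Proof.
have [_ fin] := Y_L2.
have nle (x : 'rV[R]_n) : norm1 x <= enorm x ^+ 2 + n%:R.
  rewrite /enorm sqr_sqrtr; last by apply: sumr_ge0 => i _; exact: sqr_ge0.
  rewrite -[n in n%:R]card_ord -sumr_const -big_split/=.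
  apply: ler_sum => j _; rewrite -(real_normK (num_real (x 0 j))).
  by have := sqr_ge0 (`|x 0 j| - 1); rewrite sqrrB1; have := sqr_ge0 (`|x 0 j|); lra.
have Tfin : (mu `[0%R, T] < +oo)%E.
  by rewrite lebesgue_measure_itv/=; case: ifP => _; rewrite ltry.
have inner w : (\int[mu]_(s in `[0%R, T]) (norm1 (on_horizon Y s w))%:E <=
    \int[mu]_(s in `[0%R, T]) (enorm (Y s w) ^+ 2)%:E +
    (n%:R * fine (mu `[0%R, T]))%:E)%E.
  have -> : ((n%:R * fine (mu `[0%R, T]))%:E = \int[mu]_(s in `[0%R, T]) n%:R%:E)%E.
    by rewrite integral_cst// EFinM fineK// ge0_fin_numE.
  apply: lower_integral_le_add => //.
  - by move=> s _; rewrite lee_fin norm1_ge0.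
  - by move=> s _; rewrite lee_fin sqr_ge0.
  - apply: aeW => s; rewrite /= in_itv/= => sT.
    by rewrite /on_horizon sT -EFinD lee_fin.
apply: (@le_lt_trans _ _ (\int[P]_w \int[mu]_(s in `[0%R, T]) (enorm (Y s w) ^+ 2)%:E +
    \int[P]_w (n%:R * fine (mu `[0%R, T]))%:E)%E).
  apply: lower_integral_le_add => //.
  - by move=> w _; apply: integral_ge0 => s _; rewrite lee_fin norm1_ge0.
  - by move=> w _; apply: integral_ge0 => s _; rewrite lee_fin sqr_ge0.
  - by move=> w _; rewrite lee_fin mulr_ge0// fine_ge0.
  - by apply: aeW => w _; exact: inner.
rewrite lte_add_pinfty//.
rewrite integral_cst//= [X in (_ * X)%E]probability_setT mule1 ltry//.
Qed.

End processes.

(** * Coefficients at almost every time *)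

Section lebesgue_square.
Context {R : realType}.
Local Notation mu := (@lebesgue_measure R).
Local Notation mR := (measurableTypeR R).

Lemma sigma_finite_lebesgue_square : sigma_finite setT (mu \x mu)%E.
Proof.
have /sigma_finiteP[F [TF ndF Foo]] := sigma_finiteT mu.
exists (fun k => F k `*` F k).
  rewrite -setXTT TF; apply/seteqP; split=> -[x y] /=; last first.
    by move=> [k _ []]; split; exists k.
  move=> [[k _ Fx] [l _ Fy]]; exists (maxn k l) => //; split.
    by move: x Fx; exact/subsetPset/ndF/leq_maxl.
  by move: y Fy; exact/subsetPset/ndF/leq_maxr.
move=> k; have [mF Fk] := Foo k; split; first exact: measurableX.
by rewrite product_measure1E// lte_mul_pinfty// ge0_fin_numE.
Qed.

Definition lebesgue_square : {sigma_finite_measure set (mR * mR)%type -> \bar R} :=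
  HB.pack (mu \x mu)%E
    (Measure_isSigmaFinite.Build _ _ _ (mu \x mu)%E sigma_finite_lebesgue_square).

End lebesgue_square.

Lemma measurable_Delta_preimage {R : realType} {d} {E : measurableType d} (T : R)
    (f : E -> R * R) :
  measurable_fun setT f -> measurable [set p | Delta T (f p)].
Proof.
move=> mf; rewrite -[X in measurable X]setTI.
exact: (mf measurableT _ (measurable_Delta T)).
Qed.

Section time_sections.
Context {R : realType} {d2 : measure_display} {X2 : measurableType d2}.
Variable (m2 : {sigma_finite_measure set X2 -> \bar R}).
Local Notation mu := (@lebesgue_measure R).
Local Notation mR := (measurableTypeR R).

Lemma Delta_finite_measure (T : R) : ((mu \x mu)%E (Delta T) < +oo)%E.
Proof.
apply: (@le_lt_trans _ _ ((mu \x mu)%E (`[0, T]%classic `*` `[0, T]%classic))).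
  apply: le_measure; rewrite ?inE//.
  - exact: (measurable_Delta T).
  - exact: measurableX.
  - move=> [t s] [/= t0 [ts sT]]; rewrite !in_itv/= t0 sT andbT.
    by rewrite (le_trans ts)//= (le_trans t0).
have Tfin : (mu `[0%R, T] < +oo)%E.
  by rewrite lebesgue_measure_itv/=; case: ifP => _; rewrite ltry.
by rewrite product_measure1E// lte_mul_pinfty// ge0_fin_numE.
Qed.

(** An exceptional set of triples [(t, s, omega)] is small for almost every [t],
    almost surely in [omega], for almost every [s]: the order of quantifiers in
    which the equation is read. *)
Lemma exceptional_time_sections (T : R) (S : set ((mR * mR) * X2)%type) :
  exceptional lebesgue_square m2 (Delta T) S ->
  {ae mu, forall t : R, {ae m2, forall y, {ae mu, forall s : R,
     Delta T (t, s) -> ~ S ((t, s), y)}}}.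
Proof.
move=> [mS aS].
(* Outside [Delta T] nothing is known about [S]. *)
pose S' := S `&` fst @^-1` (Delta T).
have mS' : measurable S'.
  apply: measurableI => //; rewrite -[X in measurable X]setTI.
  by apply: measurable_fst => //; exact: (measurable_Delta T).
have {}aS : {ae (mu \x mu)%E, forall p : mR * mR, {ae m2, forall y, ~ S' (p, y)}}.
  move: aS; apply: filterS => p h.
  have [Dp|nDp] := pselect (Delta T p); last by apply: aeW => y [].
  by move: (h Dp); apply: filterS => y nS [].
move/ae_product : aS.
apply: (filterS (Filter := ae_filter_ringOfSetsType mu)) => t aS.
pose St : set (mR * X2) := [set z | S' ((t, z.1), z.2)].
have mSt : measurable St.
  have mf : @measurable_fun _ _ (mR * X2)%type ((mR * mR) * X2)%type setT
      (fun z => ((t, z.1), z.2)).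
    apply: measurable_fun_pair => //; apply: measurable_fun_pair => //.
  by rewrite -[St]setTI; exact: mf.
have : {ae m2, forall y, {ae mu, forall s : mR, ~ St (s, y)}} by apply: ae_swap.
apply: filterS => y; apply: (filterS (Filter := ae_filter_ringOfSetsType mu)).
by move=> s nS Dts Sy; apply: nS.
Qed.

End time_sections.

Section coefficients.
Context {R : realType} {d : measure_display} {Omega : measurableType d}.
Variables (P : probability Omega R) (W : R -> {RV P >-> R}) (T : R) (n m : nat).
Variables (g0 g1 : generator (R := R) (Omega := Omega) n m).
Variables (theta0 theta1 : mf_coefficient (R := R) (Omega := Omega) n m).
Hypotheses (hyp0 : standing_hypotheses W T g0 theta0).
Hypotheses (hyp1 : standing_hypotheses W T g1 theta1).
Local Notation mu := (@lebesgue_measure R).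
Local Notation mR := (measurableTypeR R).

Lemma lipschitz_pair : exists L : R, 0 < L /\ forall t s, Delta T (t, s) ->
  (forall w y1 y2 c1 c2, enorm (g0 t s w y1 c1 - g0 t s w y2 c2)
     <= L * (enorm (y1 - y2) + enorm (c1 - c2))) /\
  (forall w y1 y2 c1 c2, enorm (g1 t s w y1 c1 - g1 t s w y2 c2)
     <= L * (enorm (y1 - y2) + enorm (c1 - c2))) /\
  (forall w y c, enorm (g0 t s w y c) <= L * (1 + enorm y + enorm c)) /\
  (forall w y c, enorm (g1 t s w y c) <= L * (1 + enorm y + enorm c)) /\
  (forall w w' y1 y2 y1' y2', enorm (theta0 t s w w' y1 y1' - theta0 t s w w' y2 y2')
     <= L * (enorm (y1 - y2) + enorm (y1' - y2'))) /\
  (forall w w' y1 y2 y1' y2', enorm (theta1 t s w w' y1 y1' - theta1 t s w w' y2 y2')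
     <= L * (enorm (y1 - y2) + enorm (y1' - y2'))) /\
  (forall w w' y y', enorm (theta0 t s w w' y y') <= L * (1 + enorm y + enorm y')) /\
  (forall w w' y y', enorm (theta1 t s w w' y y') <= L * (1 + enorm y + enorm y')).
Proof.
have [L0 [L00 h0]] := lipschitz_growth hyp0.
have [L1 [L10 h1]] := lipschitz_growth hyp1.
have e0 k (x : 'rV[R]_k) : 0 <= enorm x by exact: sqrtr_ge0.
have le0 x y : 0 <= y -> x <= L0 * y -> x <= (L0 + L1) * y.
  by move=> y0 xy; rewrite (le_trans xy)// ler_wpM2r// lerDl ltW.
have le1 x y : 0 <= y -> x <= L1 * y -> x <= (L0 + L1) * y.
  by move=> y0 xy; rewrite (le_trans xy)// ler_wpM2r// lerDr ltW.
exists (L0 + L1); split; first exact: addr_gt0.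
move=> t s Dts; have [a0 b0 c0 f0] := h0 t s Dts; have [a1 b1 c1 f1] := h1 t s Dts.
by do !split => *; [apply: le0|apply: le1|apply: le0|apply: le1|apply: le0|apply: le1
  |apply: le0|apply: le1]; rewrite ?addr_ge0.
Qed.

Lemma generator_measurable (g : generator (R := R) (Omega := Omega) n m)
    (theta : mf_coefficient (R := R) (Omega := Omega) n m) (y : 'rV[R]_n) (c : 'rV[R]_m) (i : 'I_n) :
  standing_hypotheses W T g theta ->
  measurable_fun setT (fun z : (mR * mR) * Omega =>
    (if z.1 \in Delta T then g z.1.1 z.1.2 z.2 y c else 0) 0 i).
Proof.
move=> hyp; have mg := g_measurable hyp.
have mgi := measurableT_comp (measurable_coord i) mg.
pose E := (R * R * Omega * borel_rV R n * borel_rV R m)%type.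
have mD : measurable ([set p | Delta T p.1.1.1] : set E).
  apply: (@measurable_Delta_preimage _ _ E T (fun p => p.1.1.1)).
  by apply: measurableT_comp => //; apply: measurableT_comp.
move/(measurable_restrictT _ mD) : mgi => mgi.
have mi : @measurable_fun _ _ ((mR * mR) * Omega)%type E setT
    (fun z => (((z.1, z.2), y : borel_rV R n), c : borel_rV R m)).
  apply: measurable_fun_pair; last exact: measurable_cst.
  apply: measurable_fun_pair; last exact: measurable_cst.
  by apply: measurable_fun_pair; [exact: measurable_fst|exact: measurable_snd].
have := measurableT_comp mgi mi.
apply: eq_measurable_fun => z _ /=; rewrite patchE /=.
rewrite (_ : (_ \in _) = (z.1 \in Delta T)); last by apply/idP/idP; rewrite !inE.
by case: ifP => // _; rewrite mxE.
Qed.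

(** The arguments [y], [y'] are treated as part of the parameter space, so the
    null set [M] depends neither on them nor on which of the two coefficients is
    considered. *)
Lemma mf_coefficient_measurable
    (theta theta' : mf_coefficient (R := R) (Omega := Omega) n m)
    (g g' : generator (R := R) (Omega := Omega) n m) :
  standing_hypotheses W T g theta -> standing_hypotheses W T g' theta' ->
  exists2 M : set (Omega * Omega), measurable M /\ (P \x P)%E M = 0%E &
  forall y y' (i : 'I_m),
    measurable_fun setT (fun z : (mR * mR) * (Omega * Omega) =>
      (if (z.1 \in Delta T) && (z.2 \notin M)
       then theta z.1.1 z.1.2 z.2.1 z.2.2 y y' else 0) 0 i) /\
    measurable_fun setT (fun z : (mR * mR) * (Omega * Omega) =>
      (if (z.1 \in Delta T) && (z.2 \notin M)
       then theta' z.1.1 z.1.2 z.2.1 z.2.2 y y' else 0) 0 i).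
Proof.
move=> hyp hyp'.
pose Oc := g_sigma_algebraType (completed_square P measurable).
pose X := ((mR * mR) * (borel_rV R n * borel_rV R n))%type.
pose E := (R * R * Oc * borel_rV R n * borel_rV R n)%type.
pose th (b : bool) := if b then theta else theta'.
have mth (b : bool) : @measurable_fun _ _ E (borel_rV R m) [set p | Delta T p.1.1.1]
    (fun p => th b p.1.1.1.1 p.1.1.1.2 p.1.1.2.1 p.1.1.2.2 p.1.2 p.2).
  by case: b; [exact: (theta_measurable hyp)|exact: (theta_measurable hyp')].
have mD : measurable ([set p | Delta T p.1.1.1] : set E).
  apply: (@measurable_Delta_preimage _ _ E T (fun p => p.1.1.1)).
  by apply: measurableT_comp => //; apply: measurableT_comp.
(* All coordinates of both coefficients form one countable family. *)
pose f (t : bool * 'I_m) (z : X * Oc) : R :=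
  (if z.1.1 \in Delta T
   then th t.1 z.1.1.1 z.1.1.2 z.2.1 z.2.2 z.1.2.1 z.1.2.2 else 0) 0 t.2.
have mf t : measurable_fun setT (f t).
  have mgi := measurableT_comp (measurable_coord t.2) (mth t.1).
  move/(measurable_restrictT _ mD) : mgi => mgi.
  have mi : @measurable_fun _ _ (X * Oc)%type E setT
      (fun z => (((z.1.1, z.2), z.1.2.1), z.1.2.2)).
    have m1 : measurable_fun setT (fun z : X * Oc => z.1) by exact: measurable_fst.
    have m12 : measurable_fun setT (fun z : X * Oc => z.1.2).
      exact: (measurableT_comp measurable_snd m1).
    apply: measurable_fun_pair; last exact: (measurableT_comp measurable_snd m12).
    apply: measurable_fun_pair; last exact: (measurableT_comp measurable_fst m12).
    apply: measurable_fun_pair; last exact: measurable_snd.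
    exact: (measurableT_comp measurable_fst m1).
  have := measurableT_comp mgi mi.
  apply: eq_measurable_fun => z _ /=; rewrite /f patchE /=.
  rewrite (_ : (_ \in _) = (z.1.1 \in Delta T)); last by apply/idP/idP; rewrite !inE.
  by case: ifP => // _; rewrite mxE.
have [M hM mfM] := completed_square_product_measurable_fun mf.
exists M => // y y' i.
have mi : @measurable_fun _ _ ((mR * mR) * (Omega * Omega))%type (X * (Omega * Omega))%type setT
    (fun z => ((z.1, (y : borel_rV R n, y' : borel_rV R n)), z.2)).
  apply: measurable_fun_pair; last exact: measurable_snd.
  by apply: measurable_fun_pair; [exact: measurable_fst|exact: measurable_cst].
have key b : measurable_fun setT (fun z : (mR * mR) * (Omega * Omega) =>
      (if (z.1 \in Delta T) && (z.2 \notin M)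
       then th b z.1.1 z.1.2 z.2.1 z.2.2 y y' else 0) 0 i).
  have := measurableT_comp (mfM (b, i)) mi.
  apply: eq_measurable_fun => z _ /=; rewrite /f/=.
  by case: (z.2 \in M) => /=; rewrite ?andbF ?andbT ?mxE.
by split; [exact: (key true)|exact: (key false)].
Qed.

End coefficients.

Section coefficient_comparison.
Context {R : realType} {d : measure_display} {Omega : measurableType d}.
Variables (P : probability Omega R) (W : R -> {RV P >-> R}) (T : R) (n m : nat).
Variables (g0 g1 : generator (R := R) (Omega := Omega) n m).
Variables (theta0 theta1 : mf_coefficient (R := R) (Omega := Omega) n m).
Hypotheses (hyp0 : standing_hypotheses W T g0 theta0).
Hypotheses (hyp1 : standing_hypotheses W T g1 theta1).
Local Notation mu := (@lebesgue_measure R).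
Local Notation mR := (measurableTypeR R).

Hypothesis jacobians : forall (y y' : 'rV[R]_n) (gamma : 'rV[R]_m),
  {ae (lebesgue_measure \x lebesgue_measure)%E, forall p : R * R, Delta T p ->
    {ae P, forall w,
      [/\ has_jacobian (fun c => g0 p.1 p.2 w y c) gamma,
          nonneg_mx (jacobian_mx (fun c => g0 p.1 p.2 w y c) gamma),
          has_jacobian (fun x => g0 p.1 p.2 w x gamma) y &
          nonneg_mx (jacobian_mx (fun x => g0 p.1 p.2 w x gamma) y)]} /\
    {ae (P \x P)%E, forall q : Omega * Omega,
      [/\ has_jacobian (fun x' => theta0 p.1 p.2 q.1 q.2 y x') y',
          nonneg_mx (jacobian_mx (fun x' => theta0 p.1 p.2 q.1 q.2 y x') y'),
          has_jacobian (fun x => theta0 p.1 p.2 q.1 q.2 x y') y &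
          nonneg_mx (jacobian_mx (fun x => theta0 p.1 p.2 q.1 q.2 x y') y)]}}.
Hypothesis coefficients_le : forall (y y' : 'rV[R]_n) (gamma : 'rV[R]_m),
  {ae (lebesgue_measure \x lebesgue_measure)%E, forall p : R * R, Delta T p ->
    {ae P, forall w, le_vec (g0 p.1 p.2 w y gamma) (g1 p.1 p.2 w y gamma)} /\
    {ae (P \x P)%E, forall q : Omega * Omega,
      le_vec (theta0 p.1 p.2 q.1 q.2 y y') (theta1 p.1 p.2 q.1 q.2 y y')}}.

Lemma enorm0 k : enorm (0 : 'rV[R]_k) = 0.
Proof. by rewrite /enorm big1 ?sqrtr0// => j _; rewrite mxE expr0n. Qed.

Lemma enorm_ge0 k (x : 'rV[R]_k) : 0 <= enorm x.
Proof. exact: sqrtr_ge0. Qed.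

(** The form in which the derivative and comparison hypotheses are used: full
    monotonicity of [f0] and domination by [f1], for all arguments at once. *)
Definition monotone_below k l o (f0 f1 : 'rV[R]_k -> 'rV[R]_l -> 'rV[R]_o) : Prop :=
  (forall u u' v v', le_vec u u' -> le_vec v v' -> le_vec (f0 u v) (f0 u' v')) /\
  (forall u v, le_vec (f0 u v) (f1 u v)).

Lemma generator_comparison :
  {ae mu, forall t : R, {ae P, forall w, {ae mu, forall s : R, Delta T (t, s) ->
     monotone_below (g0 t s w) (g1 t s w)}}}.
Proof.
have [L [L0 hL]] := lipschitz_pair hyp0 hyp1.
pose F (g : generator (R := R) (Omega := Omega) n m) (z : (mR * mR) * Omega) u v :=
  if z.1 \in Delta T then g z.1.1 z.1.2 z.2 u v else 0.
have FE g p w : Delta T p -> F g (p, w) = g p.1 p.2 w.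
  by move=> Dp; apply/funext => u; apply/funext => v; rewrite /F mem_set.
have lip0 z u v u' v' : enorm (F g0 z u v - F g0 z u' v')
    <= L * (enorm (u - u') + enorm (v - v')).
  rewrite /F; case: ifPn => [/set_mem Dz|_].
    by have [h _] := hL z.1.1 z.1.2 ltac:(by case: (z.1) Dz); exact: h.
  rewrite subrr enorm0; apply: mulr_ge0; first exact: ltW.
  by apply: addr_ge0; exact: enorm_ge0.
have lip1 z u v u' v' : enorm (F g1 z u v - F g1 z u' v')
    <= L * (enorm (u - u') + enorm (v - v')).
  rewrite /F; case: ifPn => [/set_mem Dz|_].
    by have [_ [h _]] := hL z.1.1 z.1.2 ltac:(by case: (z.1) Dz); exact: h.
  rewrite subrr enorm0; apply: mulr_ge0; first exact: ltW.
  by apply: addr_ge0; exact: enorm_ge0.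
have Pfin : (P setT < +oo)%E by rewrite probability_setT ltry.
have [u v i|u v i|||S eS hS] := @monotone_comparison_exceptional R _ _ _ _
    lebesgue_square P (Delta T) (measurable_Delta T) (Delta_finite_measure T) Pfin
    n m n (F g0) (F g1) L _ _ (ltW L0) lip0 lip1.
- exact: (generator_measurable _ _ _ hyp0).
- exact: (generator_measurable _ _ _ hyp1).
- move=> u v; have := jacobians u 0 v.
  apply: (filterS (Filter := ae_filter_ringOfSetsType lebesgue_square)) => p h Dp.
  by have [hg _] := h Dp; move: hg; apply: filterS => w; rewrite FE.
- move=> u v; have := coefficients_le u 0 v.
  apply: (filterS (Filter := ae_filter_ringOfSetsType lebesgue_square)) => p h Dp.
  by have [hg _] := h Dp; move: hg; apply: filterS => w; rewrite !FE.
have := exceptional_time_sections eS.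
apply: (filterS (Filter := ae_filter_ringOfSetsType mu)) => t.
apply: filterS => w.
apply: (filterS (Filter := ae_filter_ringOfSetsType mu)) => s nS Dts.
by have := hS _ (nS Dts); rewrite !FE.
Qed.

Definition probability_square : probability (Omega * Omega)%type R := (P \x P)%E.

(** As for the generators, but with [omega'] quantified last: after fixing [t]
    and [omega], one more exchange moves the null set in [omega'] inside the one
    in [s]. *)
Lemma mf_coefficient_comparison :
  {ae mu, forall t : R, {ae P, forall w, {ae mu, forall s : R, {ae P, forall w',
     Delta T (t, s) -> monotone_below (theta0 t s w w') (theta1 t s w w')}}}}.
Proof.
have [L [L0 hL]] := lipschitz_pair hyp0 hyp1.
have [M [mM M0] mF] := mf_coefficient_measurable hyp0 hyp1.
pose F (theta : mf_coefficient (R := R) (Omega := Omega) n m)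
  (z : (mR * mR) * (Omega * Omega)) u v :=
  if (z.1 \in Delta T) && (z.2 \notin M)
  then theta z.1.1 z.1.2 z.2.1 z.2.2 u v else 0.
have FE theta p q : Delta T p -> ~ M q -> F theta (p, q) = theta p.1 p.2 q.1 q.2.
  move=> Dp Mq; apply/funext => u; apply/funext => v.
  by rewrite /F /= (mem_set Dp) (memNset Mq).
have lip0 z u v u' v' : enorm (F theta0 z u v - F theta0 z u' v')
    <= L * (enorm (u - u') + enorm (v - v')).
  rewrite /F; case: ifPn => [/andP[/set_mem Dz _]|_].
    have [_ [_ [_ [_ [h _]]]]] := hL z.1.1 z.1.2 ltac:(by case: (z.1) Dz).
    exact: h.
  rewrite subrr enorm0; apply: mulr_ge0; first exact: ltW.
  by apply: addr_ge0; exact: enorm_ge0.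
have lip1 z u v u' v' : enorm (F theta1 z u v - F theta1 z u' v')
    <= L * (enorm (u - u') + enorm (v - v')).
  rewrite /F; case: ifPn => [/andP[/set_mem Dz _]|_].
    have [_ [_ [_ [_ [_ [h _]]]]]] := hL z.1.1 z.1.2 ltac:(by case: (z.1) Dz).
    exact: h.
  rewrite subrr enorm0; apply: mulr_ge0; first exact: ltW.
  by apply: addr_ge0; exact: enorm_ge0.
have nM : {ae probability_square, forall q, ~ M q} by apply/ae_not_measure0.
have Pfin : (probability_square setT < +oo)%E by rewrite probability_setT ltry.
have [u v i|u v i|||S eS hS] := @monotone_comparison_exceptional R _ _ _ _
    lebesgue_square probability_square (Delta T) (measurable_Delta T) (Delta_finite_measure T) Pfin
    n n m (F theta0) (F theta1) L _ _ (ltW L0) lip0 lip1.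
- by have [] := mF u v i.
- by have [] := mF u v i.
- move=> u v; have := jacobians u v 0.
  apply: (filterS (Filter := ae_filter_ringOfSetsType lebesgue_square)) => p h Dp.
  have [_ hg] := h Dp; move: hg nM.
  by apply: (@filterS2 _ _ (ae_filter_ringOfSetsType probability_square)) => q hq Mq; rewrite FE.
- move=> u v; have := coefficients_le u v 0.
  apply: (filterS (Filter := ae_filter_ringOfSetsType lebesgue_square)) => p h Dp.
  have [_ hg] := h Dp; move: hg nM.
  by apply: (@filterS2 _ _ (ae_filter_ringOfSetsType probability_square)) => q hq Mq; rewrite !FE.
have eS2 : exceptional lebesgue_square probability_square (Delta T) 
    (S `|` (snd @^-1` M)).
  apply: exceptionalU => //; split.
    by rewrite -[X in measurable X]setTI; exact: measurable_snd.
  by apply: aeW => p Dp.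
have mS2 : measurable (S `|` snd @^-1` M) by case: eS2.
have := exceptional_time_sections eS2.
apply: (filterS (Filter := ae_filter_ringOfSetsType mu)) => t.
move/ae_product; apply: filterS => w h.
(* The section of the bad set at [t] and [w], as a set of pairs [(w', s)]. *)
pose St : set (Omega * mR)%type :=
  [set z | Delta T (t, z.2) /\ (S `|` snd @^-1` M) ((t, z.2), (w, z.1))].
have mSt : measurable St.
  apply: measurableI.
    apply: (@measurable_Delta_preimage _ _ (Omega * mR)%type T (fun z => (t, z.2))).
    exact: (measurable_fun_pair (measurable_cst _) measurable_snd).
  have mf : @measurable_fun _ _ (Omega * mR)%type ((mR * mR) * (Omega * Omega))%type setT
      (fun z => ((t, z.2), (w, z.1))).
    apply: measurable_fun_pair.
      exact: (measurable_fun_pair (measurable_cst _) measurable_snd).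
    exact: (measurable_fun_pair (measurable_cst _) measurable_fst).
  by rewrite -[X in measurable X]setTI; exact: mf.
have : {ae mu, forall s : mR, {ae P, forall w', ~ St (w', s)}}.
  apply: ae_swap => //; move: h; apply: filterS => w'.
  by apply: (filterS (Filter := ae_filter_ringOfSetsType mu)) => s hs [] /hs.
apply: (filterS (Filter := ae_filter_ringOfSetsType mu)) => s.
apply: filterS => w' nS Dts.
have nS' : ~ S ((t, s), (w, w')) by move=> Sz; apply: nS; split => //; left.
have nM' : ~ M (w, w') by move=> Mz; apply: nS; split => //; right.
by have := hS _ nS'; rewrite !FE.
Qed.

End coefficient_comparison.

(** * The gap between two solutions and the drift terms *)

Section positive_gap.
Context {R : realType}.

Definition positive_gap {n : nat} (x y : 'rV[R]_n) : R :=
  \sum_j Num.max (x 0 j - y 0 j) 0.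

Lemma positive_gap_ge0 n (x y : 'rV[R]_n) : 0 <= positive_gap x y.
Proof. by apply: sumr_ge0 => j _; rewrite le_max lexx orbT. Qed.

Lemma positive_gap_le n (x y : 'rV[R]_n) : positive_gap x y <= norm1 x + norm1 y.
Proof.
rewrite /positive_gap /norm1 -big_split/=; apply: ler_sum => j _.
rewrite ge_max addr_ge0// andbT (le_trans (ler_norm _))//.
exact: ler_normB.
Qed.

Lemma positive_gap0 n (x y : 'rV[R]_n) : positive_gap x y = 0 -> le_vec x y.
Proof.
move=> /eqP; rewrite psumr_eq0 => [/allP h j|j _]; last by rewrite le_max lexx orbT.
have /h : j \in index_enum 'I_n by rewrite mem_index_enum.
by move=> /eqP h0; rewrite -subr_le0 -h0 le_max lexx.
Qed.

(** Pass through the componentwise maxima of [u, u'] and of [v, v']: [f0]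
    increases when going up to them, the Lipschitz bound brings it back to
    [(u', v')] at the cost of the positive gaps, and there [f0 <= f1]. *)
Lemma monotone_below_gap k l o (f0 f1 : 'rV[R]_k -> 'rV[R]_l -> 'rV[R]_o) (L : R) :
  0 <= L ->
  (forall u v u' v',
     enorm (f0 u v - f0 u' v') <= L * (enorm (u - u') + enorm (v - v'))) ->
  monotone_below f0 f1 -> forall u v u' v' i,
  f0 u v 0 i <= f1 u' v' 0 i + L * (positive_gap u u' + positive_gap v v').
Proof.
move=> L0 lip [mono le01] u v u' v' i.
pose up p (x y : 'rV[R]_p) : 'rV[R]_p := \row_j Num.max (x 0 j) (y 0 j).
have le_up p (x y : 'rV[R]_p) : le_vec x (up p x y).
  by move=> j; rewrite mxE le_max lexx.
have gap_up p (x y : 'rV[R]_p) : norm1 (up p x y - y) = positive_gap x y.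
  apply: eq_bigr => j _; rewrite !mxE.
  have [h|/ltW h] := leP (x 0 j) (y 0 j).
    by rewrite !max_r ?subr_le0// subrr normr0.
  by rewrite !max_l ?subr_ge0// ger0_norm ?subr_ge0.
apply: (le_trans (mono _ _ _ _ (le_up _ u u') (le_up _ v v') i)).
have := lipschitz_coord L0 lip i (up _ u u') (up _ v v') u' v'.
rewrite !gap_up => h; have := ler_norm (f0 (up k u u') (up l v v') 0 i - f0 u' v' 0 i).
by have := le01 u' v' i; move: h; lra.
Qed.

End positive_gap.

Section mean_field_term.
Context {R : realType} {d : measure_display} {Omega : measurableType d}.
Variables (P : probability Omega R) (n m : nat) (L : R).
Hypothesis L0 : 0 <= L.

(** In the constant, 2 comes from [Rintegral_comparison] and [m] from the number
    of coordinates. *)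
Lemma mf_integral_bound (th : Omega -> 'rV[R]_n -> 'rV[R]_n -> 'rV[R]_m)
    (x : 'rV[R]_n) (y : Omega -> 'rV[R]_n) :
  (forall w u v, enorm (th w u v) <= L * (1 + enorm u + enorm v)) ->
  measurable_fun setT (fun w => norm1 (y w)) ->
  (\int[P]_w (norm1 (y w))%:E < +oo)%E ->
  ((norm1 (vec_integral P setT (fun w => th w x (y w))))%:E <=
   (2 * m%:R * L)%:E * ((1 + norm1 x)%:E + \int[P]_w (norm1 (y w))%:E))%E.
Proof.
move=> bth my iy.
pose k w := (L * (1 + norm1 x + norm1 (y w)))%:E.
have k0 w : (0 <= k w)%E by rewrite lee_fin mulr_ge0// !addr_ge0// norm1_ge0.
have mk : measurable_fun setT k.
  apply/measurable_EFinP; apply: measurable_funM => //.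
  exact: measurable_funD.
have ik : (\int[P]_w k w = L%:E * ((1 + norm1 x)%:E + \int[P]_w (norm1 (y w))%:E))%E.
  rewrite /k; under eq_integral do rewrite EFinM EFinD.
  rewrite ge0_integralZl//; last 2 first.
  - by apply: emeasurable_funD => //; exact/measurable_EFinP.
  - by move=> w _; rewrite -EFinD lee_fin !addr_ge0// norm1_ge0.
  rewrite ge0_integralD//; last 3 first.
  - by move=> w _; rewrite lee_fin addr_ge0// norm1_ge0.
  - by move=> w _; rewrite lee_fin norm1_ge0.
  - exact/measurable_EFinP.
  by rewrite integral_cst//= [X in (_ * X + _)%E]probability_setT mule1.
have kfin : (\int[P]_w k w < +oo)%E.
  rewrite ik lte_mul_pinfty ?lee_fin//.
  by rewrite lte_add_pinfty// ltry.
have kf : (\int[P]_w k w)%E \is a fin_num.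
  by rewrite ge0_fin_numE//; exact: integral_ge0.
have bound (i : 'I_m) : (`|(\int[P]_w (th w x (y w) 0 i))%R|%:E <= 2%:E * \int[P]_w k w)%E.
  have fk w : `|th w x (y w) 0 i| <= L * (1 + norm1 x + norm1 (y w)).
    rewrite (le_trans (coord_le_enorm _ _))// (le_trans (bth _ _ _))//.
    by rewrite ler_wpM2l// lerD ?enorm_le_norm1// lerD2l enorm_le_norm1.
  have fk' : {ae P, forall w, setT w -> (`|(th w x (y w) 0 i)%:E| <= k w)%E}.
    by apply: aeW => w _; rewrite lee_fin.
  have zk : {ae P, forall w, setT w -> (`|(0 : R)%:E| <= k w)%E}.
    by apply: aeW => w _; rewrite abse0.
  have z0 : (\int[P]_w (0 : R))%R = 0 by rewrite Rintegral_cst// mul0r.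
  have k0' w : setT w -> (0 <= k w)%E by [].
  have up := Rintegral_comparison measurableT k0' mk k0' mk kfin fk' zk.
  have lo := Rintegral_comparison measurableT k0' mk k0' mk kfin zk fk'.
  move: up lo; rewrite z0 add0e -(fineK kf) -EFinM -EFinD !lee_fin => up lo.
  rewrite ler_norml; apply/andP; split; last first.
    apply: up; apply: aeW => w _; rewrite add0e lee_fin.
    by rewrite (le_trans (ler_norm _)).
  rewrite lerNl -subr_ge0 opprK addrC; apply: lo.
  apply: aeW => w _; rewrite -EFinD lee_fin.
  by have := fk w; rewrite ler_norml => /andP[]; lra.
apply: (@le_trans _ _ (\sum_(i < m) 2 * fine (\int[P]_w k w)%E)%:E).
  rewrite lee_fin; apply: ler_sum => i _; rewrite mxE.
  by rewrite -lee_fin EFinM fineK.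
rewrite sumr_const card_ord -(mulr_natl (2 * _)) mulrA EFinM fineK// ik muleA -EFinM.
by rewrite (_ : m%:R * 2 * L = 2 * m%:R * L)//; ring.
Qed.

(** Integrating [monotone_below_gap] over [omega'] turns the gap of the second
    argument into its mean; this is how the law of the solution enters. *)
Lemma mf_integral_gap (th0 th1 : Omega -> 'rV[R]_n -> 'rV[R]_n -> 'rV[R]_m)
    (x0 x1 : 'rV[R]_n) (y0 y1 : Omega -> 'rV[R]_n) :
  (forall w u v u' v',
     enorm (th0 w u v - th0 w u' v') <= L * (enorm (u - u') + enorm (v - v'))) ->
  (forall w u v, enorm (th0 w u v) <= L * (1 + enorm u + enorm v)) ->
  (forall w u v, enorm (th1 w u v) <= L * (1 + enorm u + enorm v)) ->
  {ae P, forall w, monotone_below (th0 w) (th1 w)} ->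
  measurable_fun setT (fun w => norm1 (y0 w)) ->
  measurable_fun setT (fun w => norm1 (y1 w)) ->
  measurable_fun setT (fun w => positive_gap (y0 w) (y1 w)) ->
  (\int[P]_w (norm1 (y0 w))%:E < +oo)%E ->
  (\int[P]_w (norm1 (y1 w))%:E < +oo)%E ->
  ((positive_gap (vec_integral P setT (fun w => th0 w x0 (y0 w)))
     (vec_integral P setT (fun w => th1 w x1 (y1 w))))%:E <=
   (2 * m%:R * L)%:E * ((positive_gap x0 x1)%:E +
      \int[P]_w (positive_gap (y0 w) (y1 w))%:E))%E.
Proof.
move=> lip0 b0 b1 mono my0 my1 mgap iy0 iy1.
pose c := 1 + norm1 x0 + norm1 x1.
have c0 : 0 <= c by rewrite !addr_ge0// norm1_ge0.
pose k w := (L * (c + norm1 (y0 w) + norm1 (y1 w)))%:E.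
have k0 w : setT w -> (0 <= k w)%E.
  by move=> _; rewrite lee_fin mulr_ge0// !addr_ge0// norm1_ge0.
have mk : measurable_fun setT k.
  apply/measurable_EFinP; apply: measurable_funM => //.
  by apply: measurable_funD => //; exact: measurable_funD.
have mE0 : measurable_fun setT (fun w => (norm1 (y0 w))%:E) by exact/measurable_EFinP.
have mE1 : measurable_fun setT (fun w => (norm1 (y1 w))%:E) by exact/measurable_EFinP.
have kfin : (\int[P]_w k w < +oo)%E.
  rewrite /k; under eq_integral do rewrite EFinM 2!EFinD.
  rewrite ge0_integralZl//; last 2 first.
  - by apply: emeasurable_funD => //; exact: emeasurable_funD.
  - by move=> w _; rewrite -!EFinD lee_fin !addr_ge0// norm1_ge0.
  rewrite lte_mul_pinfty ?lee_fin//.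
  rewrite ge0_integralD//; last 3 first.
  - by move=> w _; rewrite -EFinD lee_fin addr_ge0// norm1_ge0.
  - exact: emeasurable_funD.
  - by move=> w _; rewrite lee_fin norm1_ge0.
  rewrite lte_add_pinfty// ge0_integralD//; last first.
    by move=> w _; rewrite lee_fin norm1_ge0.
  rewrite lte_add_pinfty// integral_cst//= [X in (_ * X)%E]probability_setT mule1 ltry//.
pose h w := (L * (positive_gap x0 x1 + positive_gap (y0 w) (y1 w)))%:E.
have h0 w : setT w -> (0 <= h w)%E.
  by move=> _; rewrite lee_fin mulr_ge0// addr_ge0// positive_gap_ge0.
have mh : measurable_fun setT h.
  apply/measurable_EFinP; apply: measurable_funM => //; exact: measurable_funD.
have ih : (\int[P]_w h w = L%:E * ((positive_gap x0 x1)%:E +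
      \int[P]_w (positive_gap (y0 w) (y1 w))%:E))%E.
  rewrite /h; under eq_integral do rewrite EFinM EFinD.
  rewrite ge0_integralZl//; last 2 first.
  - by apply: emeasurable_funD => //; exact/measurable_EFinP.
  - by move=> w _; rewrite -EFinD lee_fin addr_ge0// positive_gap_ge0.
  rewrite ge0_integralD//; last 3 first.
  - by move=> w _; rewrite lee_fin positive_gap_ge0.
  - by move=> w _; rewrite lee_fin positive_gap_ge0.
  - exact/measurable_EFinP.
  by rewrite integral_cst//= [X in (_ * X + _)%E]probability_setT mule1.
have hfin : (\int[P]_w h w)%E \is a fin_num.
  rewrite ge0_fin_numE; last by apply: integral_ge0 => w _; exact: h0.
  apply: le_lt_trans kfin; apply: ge0_le_integral => // w _.
  rewrite lee_fin ler_wpM2l//.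
  have := positive_gap_le x0 x1; have := positive_gap_le (y0 w) (y1 w).
  by rewrite /c; lra.
have bound (i : 'I_m) : (\int[P]_w (th0 w x0 (y0 w) 0 i))%R <=
    (\int[P]_w (th1 w x1 (y1 w) 0 i))%R + 2 * fine (\int[P]_w h w)%E.
  rewrite -lee_fin EFinD EFinM (fineK hfin).
  apply: (Rintegral_comparison measurableT h0 mh k0 mk kfin).
  - apply: aeW => w _; rewrite lee_fin (le_trans (coord_le_enorm _ _))//.
    rewrite (le_trans (b0 _ _ _))// ler_wpM2l// /c.
    have := enorm_le_norm1 x0; have := enorm_le_norm1 (y0 w).
    by have := norm1_ge0 x1; have := norm1_ge0 (y1 w); lra.
  - apply: aeW => w _; rewrite lee_fin (le_trans (coord_le_enorm _ _))//.
    rewrite (le_trans (b1 _ _ _))// ler_wpM2l// /c.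
    have := enorm_le_norm1 x1; have := enorm_le_norm1 (y1 w).
    by have := norm1_ge0 x0; have := norm1_ge0 (y0 w); lra.
  - move: mono; apply: filterS => w mw _; rewrite -EFinD lee_fin.
    exact: (monotone_below_gap L0 (lip0 w) mw).
have I0 : 0 <= fine (\int[P]_w h w)%E.
  by rewrite fine_ge0//; apply: integral_ge0 => w _; exact: h0.
apply: (@le_trans _ _ (\sum_(i < m) 2 * fine (\int[P]_w h w)%E)%:E).
  rewrite lee_fin; apply: ler_sum => i _; rewrite !mxE ge_max.
  apply/andP; split; first by rewrite lerBlDl; exact: bound.
  by rewrite mulr_ge0.
rewrite sumr_const card_ord -(mulr_natl (2 * _)) mulrA EFinM fineK// ih muleA -EFinM.
by rewrite (_ : m%:R * 2 * L = 2 * m%:R * L)//; ring.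
Qed.

End mean_field_term.

Section generator_integrals.
Context {R : realType} {d : measure_display} {Omega : measurableType d}.
Variables (P : probability Omega R) (W : R -> {RV P >-> R}) (T : R) (n m : nat).
Hypothesis P_complete : measure_is_complete P.
Local Notation mu := (@lebesgue_measure R).
Local Notation mR := (measurableTypeR R).
Local Notation RO := (mR * Omega)%type.

Lemma measurable_section_time (f : RO -> R) s :
  measurable_fun setT f -> measurable_fun setT (fun w => f (s, w)).
Proof. by move=> mf; exact: measurableT_comp. Qed.

Lemma measurable_section_state (f : RO -> R) w :
  measurable_fun setT f -> measurable_fun setT (fun s : mR => f (s, w)).
Proof. by move=> mf; exact: measurableT_comp. Qed.

Variables (Y0 Y1 : R -> Omega -> 'rV[R]_n).
Hypotheses (Y0_L2 : L2_process W T Y0) (Y1_L2 : L2_process W T Y1).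

Definition gap (s : R) (w : Omega) : R :=
  positive_gap (on_horizon T Y0 s w) (on_horizon T Y1 s w).

Definition mean_gap (s : R) : \bar R := (\int[P]_w (gap s w)%:E)%E.

Lemma measurable_gap : measurable_fun setT (fun p : RO => gap p.1 p.2).
Proof.
apply: measurable_sum => j; apply: measurable_maxr => //.
exact: (measurable_funB (measurable_on_horizon P_complete Y0_L2 j)
  (measurable_on_horizon P_complete Y1_L2 j)).
Qed.

Lemma mean_gap_ge0 s : (0 <= mean_gap s)%E.
Proof. by apply: integral_ge0 => w _; rewrite lee_fin positive_gap_ge0. Qed.

Lemma measurable_mean_gap : measurable_fun setT (fun s : mR => mean_gap s).
Proof.
apply: (measurable_fun_fubini_tonelli_F (fun p : RO => (gap p.1 p.2)%:E)).
  by apply/measurable_EFinP; exact: measurable_gap.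
by move=> p; rewrite lee_fin positive_gap_ge0.
Qed.

Definition mean_norm (Y : R -> Omega -> 'rV[R]_n) (s : R) : \bar R :=
  (\int[P]_w (norm1 (on_horizon T Y s w))%:E)%E.

Lemma mean_norm_ge0 Y s : (0 <= mean_norm Y s)%E.
Proof. by apply: integral_ge0 => w _; rewrite lee_fin norm1_ge0. Qed.

Lemma measurable_mean_norm Y : L2_process W T Y ->
  measurable_fun setT (fun s : mR => mean_norm Y s).
Proof.
move=> YL2.
apply: (measurable_fun_fubini_tonelli_F
  (fun p : RO => (norm1 (on_horizon T Y p.1 p.2))%:E)).
  by apply/measurable_EFinP; exact: (measurable_norm1_on_horizon P_complete YL2).
by move=> p; rewrite lee_fin norm1_ge0.
Qed.

Lemma integral_norm1_on_horizon (Y : R -> Omega -> 'rV[R]_n) w :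
  (\int[mu]_s (norm1 (on_horizon T Y s w))%:E =
   \int[mu]_(s in `[0%R, T]) (norm1 (on_horizon T Y s w))%:E)%E.
Proof.
rewrite [RHS]integral_mkcond; apply: eq_integral => s _; rewrite patchE.
case: ifPn => //; rewrite notin_setE /= in_itv/= => /negP sT.
by rewrite /on_horizon /= (negbTE sT) /norm1 big1// => j _; rewrite mxE normr0.
Qed.

Lemma integral_mean_norm_lty Y : L2_process W T Y ->
  (\int[mu]_(s in `[0%R, T]) mean_norm Y s < +oo)%E.
Proof.
move=> YL2.
pose f (p : RO) := (norm1 (on_horizon T Y p.1 p.2))%:E.
have mf : measurable_fun setT f.
  by apply/measurable_EFinP; exact: (measurable_norm1_on_horizon P_complete YL2).
have f0 p : (0 <= f p)%E by rewrite lee_fin norm1_ge0.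
apply: (@le_lt_trans _ _ (\int[mu]_s mean_norm Y s)%E).
  apply: ge0_subset_integral => //.
  - exact: measurable_mean_norm.
  - by move=> s _; exact: mean_norm_ge0.
rewrite (fubini_tonelli f)//.
under eq_integral do rewrite /f integral_norm1_on_horizon.
exact: (integral_norm1_lty YL2).
Qed.

Variables (g0 g1 : generator (R := R) (Omega := Omega) n m).
Variables (theta0 theta1 : mf_coefficient (R := R) (Omega := Omega) n m).
Hypotheses (hyp0 : standing_hypotheses W T g0 theta0).
Hypotheses (hyp1 : standing_hypotheses W T g1 theta1).

(** The mean-field terms are compared by [mf_integral_gap], the generators by
    [monotone_below_gap].  The constant depends neither on [t] nor on [w]. *)
Lemma generator_integral_comparison : exists2 C : R, 0 < C &
  forall t w j, 0 <= t ->
  {ae mu, forall s : R, Delta T (t, s) -> monotone_below (g0 t s w) (g1 t s w)} ->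
  {ae mu, forall s : R, {ae P, forall w',
     Delta T (t, s) -> monotone_below (theta0 t s w w') (theta1 t s w w')}} ->
  {ae mu, forall s : R, (mean_norm Y0 s < +oo)%E} ->
  {ae mu, forall s : R, (mean_norm Y1 s < +oo)%E} ->
  (\int[mu]_(s in `[0%R, T]) (norm1 (on_horizon T Y0 s w))%:E < +oo)%E ->
  (\int[mu]_(s in `[0%R, T]) (norm1 (on_horizon T Y1 s w))%:E < +oo)%E ->
  ((\int[mu]_(s in `[t, T]) (g0 t s w (Y0 s w) (mf_term P theta0 Y0 t s w) 0 j))%R%:E <=
   (\int[mu]_(s in `[t, T]) (g1 t s w (Y1 s w) (mf_term P theta1 Y1 t s w) 0 j))%R%:E +
   2%:E * \int[mu]_(s in `[t, T]) (C%:E * ((gap s w)%:E + mean_gap s)))%E.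
Proof.
have [L [L0 hL]] := lipschitz_pair hyp0 hyp1.
(* The constant of [mf_integral_bound] and [mf_integral_gap]. *)
pose q := 2 * m%:R * L.
have q0 : 0 <= q by rewrite mulr_ge0 ?mulr_ge0// ltW.
exists (L * (1 + q)); first by rewrite mulr_gt0// ltr_pwDl.
set C := L * (1 + q).
have C0 : 0 <= C by rewrite mulr_ge0 ?ltW// ltr_pwDl.
move=> t w j t0 hg hth hA0 hA1 hi0 hi1.
pose a (Y : R -> Omega -> 'rV[R]_n) s := (norm1 (on_horizon T Y s w))%:E.
have sub : `[t, T] `<=` `[0%R, T].
  by move=> s /=; rewrite !in_itv/= => /andP[ts ->]; rewrite (le_trans t0).
have horizon (Y : R -> Omega -> 'rV[R]_n) s : s \in `[t, T]%classic -> on_horizon T Y s = Y s.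
  move=> /set_mem/sub; rewrite /= in_itv/= => sT.
  by apply/funext => w'; rewrite /on_horizon sT.
have inDelta s : s \in `[t, T]%classic -> Delta T (t, s).
  by move=> /set_mem/=; rewrite in_itv/= => /andP[ts sT]; split.
have ma (Y : R -> Omega -> 'rV[R]_n) : L2_process W T Y -> measurable_fun setT (fun s : mR => a Y s).
  move=> YL2; apply/measurable_EFinP.
  apply: (measurable_section_state (f := fun p => norm1 (on_horizon T Y p.1 p.2))).
  exact: (measurable_norm1_on_horizon P_complete YL2).
have a0 (Y : R -> Omega -> 'rV[R]_n) s : (0 <= a Y s)%E by rewrite lee_fin norm1_ge0.
(* A majorant of both integrands, from the growth conditions. *)
pose k s : \bar R := (C%:E * (1 + (a Y0 s + a Y1 s) + (mean_norm Y0 s + mean_norm Y1 s)))%E.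
have S0 s : (0 <= 1 + (a Y0 s + a Y1 s) + (mean_norm Y0 s + mean_norm Y1 s))%E.
  apply: adde_ge0; [apply: adde_ge0; [by []|by apply: adde_ge0]|by apply: adde_ge0; exact: mean_norm_ge0].
have k0 s : `[t, T]%classic s -> (0 <= k s)%E by move=> _; rewrite mule_ge0.
have mA0 := measurable_mean_norm Y0_L2.
have mA1 := measurable_mean_norm Y1_L2.
have mS : measurable_fun setT (fun s : mR =>
    1 + (a Y0 s + a Y1 s) + (mean_norm Y0 s + mean_norm Y1 s))%E.
  apply: emeasurable_funD; last exact: emeasurable_funD.
  by apply: emeasurable_funD => //; apply: emeasurable_funD; exact: ma.
have mk : measurable_fun (`[t, T]%classic : set mR) k.
  by apply: measurable_funTS; apply: emeasurable_funM.
have subfin (f : R -> \bar R) : measurable_fun setT f -> (forall s, 0 <= f s)%E ->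
    (\int[mu]_(s in `[0%R, T]) f s < +oo)%E -> (\int[mu]_(s in `[t, T]) f s < +oo)%E.
  move=> mf f0; apply: le_lt_trans; apply: ge0_subset_integral => //.
  exact: measurable_funTS.
have kfin : (\int[mu]_(s in `[t, T]) k s < +oo)%E.
  rewrite ge0_integralZl//; last exact: measurable_funTS.
  rewrite lte_mul_pinfty ?lee_fin//.
  have mT (f : mR -> \bar R) : measurable_fun setT f -> measurable_fun `[t, T]%classic f.
    exact: measurable_funTS.
  have mn0 (Y : R -> Omega -> 'rV[R]_n) s : (0 <= mean_norm Y s)%E by exact: mean_norm_ge0.
  have ma0 := ma Y0 Y0_L2; have ma1 := ma Y1 Y1_L2.
  rewrite ge0_integralD//; last 4 first.
  - by move=> s _; rewrite !adde_ge0.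
  - by apply: mT; apply: emeasurable_funD => //; exact: emeasurable_funD.
  - by move=> s _; rewrite adde_ge0.
  - by apply: mT; exact: emeasurable_funD.
  rewrite lte_add_pinfty//.
    rewrite ge0_integralD//; last 2 first.
    - by move=> s _; rewrite adde_ge0.
    - by apply: mT; exact: emeasurable_funD.
    rewrite lte_add_pinfty//.
      rewrite integral_cst//= mul1e lebesgue_measure_itv/=.
      by case: ifP => _; rewrite ltry.
    rewrite ge0_integralD//; last 2 first.
    - exact: mT.
    - exact: mT.
    by rewrite lte_add_pinfty//; apply: subfin.
  rewrite ge0_integralD//; last 2 first.
  - exact: mT.
  - exact: mT.
  by rewrite lte_add_pinfty//; apply: subfin => //; exact: integral_mean_norm_lty.
pose h s : \bar R := (C%:E * ((gap s w)%:E + mean_gap s))%E.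
have h0 s : `[t, T]%classic s -> (0 <= h s)%E.
  by move=> _; rewrite mule_ge0// adde_ge0 ?mean_gap_ge0// lee_fin positive_gap_ge0.
have mh : measurable_fun (`[t, T]%classic : set mR) h.
  apply: measurable_funTS; apply: emeasurable_funM => //.
  apply: emeasurable_funD; last exact: measurable_mean_gap.
  apply/measurable_EFinP.
  apply: (measurable_section_state (f := fun p => gap p.1 p.2)).
  exact: measurable_gap.
have mnorm (Y : R -> Omega -> 'rV[R]_n) s : L2_process W T Y -> measurable_fun setT (fun w' => norm1 (on_horizon T Y s w')).
  move=> YL2.
  apply: (measurable_section_time (f := fun p => norm1 (on_horizon T Y p.1 p.2))).
  exact: (measurable_norm1_on_horizon P_complete YL2).
have term_bound (Y : R -> Omega -> 'rV[R]_n)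
    (theta : mf_coefficient (R := R) (Omega := Omega) n m) s :
    L2_process W T Y -> s \in `[t, T]%classic ->
    (forall w1 w2 y y', enorm (theta t s w1 w2 y y') <= L * (1 + enorm y + enorm y')) ->
    (mean_norm Y s < +oo)%E ->
    ((norm1 (mf_term P theta Y t s w))%:E <= q%:E * (1 + a Y s + mean_norm Y s))%E.
  move=> YL2 sI bth fY; rewrite /a /mean_norm (@horizon Y s sI) -EFinD.
  apply: (mf_integral_bound (ltW L0)); first by move=> *; exact: bth.
    by have := @mnorm Y s YL2; rewrite (@horizon Y s sI).
  by move: fY; rewrite /mean_norm (@horizon Y s sI).
have g_bound (Y : R -> Omega -> 'rV[R]_n)
    (g : generator (R := R) (Omega := Omega) n m)
    (theta : mf_coefficient (R := R) (Omega := Omega) n m) s :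
    L2_process W T Y -> s \in `[t, T]%classic ->
    (forall w1 y c, enorm (g t s w1 y c) <= L * (1 + enorm y + enorm c)) ->
    (forall w1 w2 y y', enorm (theta t s w1 w2 y y') <= L * (1 + enorm y + enorm y')) ->
    (mean_norm Y s < +oo)%E ->
    (`|(g t s w (Y s w) (mf_term P theta Y t s w) 0 j)%:E| <=
       C%:E * (1 + a Y s + mean_norm Y s))%E.
  move=> YL2 sI bg bth fY.
  have := @term_bound Y theta s YL2 sI bth fY.
  have fA : mean_norm Y s \is a fin_num by rewrite ge0_fin_numE// mean_norm_ge0.
  rewrite -(fineK fA) /a -!EFinD -!EFinM !lee_fin (@horizon Y s sI) => h1.
  rewrite (le_trans (coord_le_enorm _ _))// (le_trans (bg _ _ _))//.
  rewrite /C -mulrA ler_wpM2l ?(ltW L0)//.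
  have := enorm_le_norm1 (Y s w); have := enorm_le_norm1 (mf_term P theta Y t s w).
  have : 0 <= fine (mean_norm Y s) by rewrite fine_ge0// mean_norm_ge0.
  by rewrite (mulrDl 1 q) mul1r; move: h1; lra.
have mtT : measurable (`[t, T]%classic : set mR) by [].
apply: (Rintegral_comparison mtT h0 mh k0 mk kfin).
- move: hA0; apply: (filterS (Filter := ae_filter_ringOfSetsType mu)) => s fY sI.
  have sI' : s \in `[t, T]%classic by exact/mem_set.
  have [_ [_ [bg [_ [_ [_ [bth _]]]]]]] := hL t s (inDelta s sI').
  apply: (le_trans (@g_bound Y0 g0 theta0 s Y0_L2 sI' bg bth fY)).
  apply: lee_wpmul2l; rewrite ?lee_fin//; apply: leeD; first apply: leeD => //.
  + by apply: leeDl; exact: a0.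
  + by apply: leeDl; exact: mean_norm_ge0.
- move: hA1; apply: (filterS (Filter := ae_filter_ringOfSetsType mu)) => s fY sI.
  have sI' : s \in `[t, T]%classic by exact/mem_set.
  have [_ [_ [_ [bg [_ [_ [_ bth]]]]]]] := hL t s (inDelta s sI').
  apply: (le_trans (@g_bound Y1 g1 theta1 s Y1_L2 sI' bg bth fY)).
  apply: lee_wpmul2l; rewrite ?lee_fin//; apply: leeD; first apply: leeD => //.
  + by apply: leeDr; exact: a0.
  + by apply: leeDr; exact: mean_norm_ge0.
have hmono := @filterI _ _ (ae_filter_ringOfSetsType mu) _ _ hg hth.
have hfin := @filterI _ _ (ae_filter_ringOfSetsType mu) _ _ hA0 hA1.
have := @filterI _ _ (ae_filter_ringOfSetsType mu) _ _ hmono hfin.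
apply: (filterS (Filter := ae_filter_ringOfSetsType mu)) => s [[gs ths] [f0 f1]] sI.
have sI' : s \in `[t, T]%classic by exact/mem_set.
have Ds := inDelta s sI'.
have [lipg [_ [_ [_ [lipth [_ [bth0 bth1]]]]]]] := hL t s Ds.
have gapE : mean_gap s = (\int[P]_w' (positive_gap (Y0 s w') (Y1 s w'))%:E)%E.
  by rewrite /mean_gap /gap !(@horizon _ s sI').
have gfin : mean_gap s \is a fin_num.
  rewrite ge0_fin_numE ?mean_gap_ge0//.
  apply: (@le_lt_trans _ _ (mean_norm Y0 s + mean_norm Y1 s)%E); last exact: lte_add_pinfty.
  rewrite /mean_norm -ge0_integralD//; last 4 first.
  - by move=> w' _; rewrite lee_fin norm1_ge0.
  - by apply/measurable_EFinP; exact: mnorm.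
  - by move=> w' _; rewrite lee_fin norm1_ge0.
  - by apply/measurable_EFinP; exact: mnorm.
  apply: ge0_le_integral => //.
  - by move=> w' _; rewrite lee_fin positive_gap_ge0.
  - apply/measurable_EFinP.
    apply: (measurable_section_time (f := fun p => gap p.1 p.2)).
    exact: measurable_gap.
  - by apply/measurable_EFinP; apply: measurable_funD; exact: mnorm.
  - by move=> w' _; rewrite -EFinD lee_fin positive_gap_le.
have := @mf_integral_gap R d Omega P n m L (ltW L0) (theta0 t s w) (theta1 t s w)
  (Y0 s w) (Y1 s w) (Y0 s) (Y1 s)
  (fun w' u v u' v' => lipth w w' u u' v v') (fun w' => bth0 w w') (fun w' => bth1 w w').
have -> : Y0 s = on_horizon T Y0 s by rewrite (@horizon _ s sI').
have -> : Y1 s = on_horizon T Y1 s by rewrite (@horizon _ s sI').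
move=> /(_ _ (@mnorm Y0 s Y0_L2) (mnorm Y1 s Y1_L2) _ f0 f1).
rewrite !(@horizon _ s sI').
move=> gapb.
have {gapb} : ((positive_gap (mf_term P theta0 Y0 t s w) (mf_term P theta1 Y1 t s w))%:E <=
    q%:E * ((gap s w)%:E + mean_gap s))%E.
  rewrite gapE /gap !(@horizon _ s sI').
  apply: gapb; first by move: ths; apply: filterS => w'; apply.
  have := @measurable_section_time (fun p => gap p.1 p.2) s measurable_gap.
  by rewrite /gap /= !(@horizon _ s sI').
rewrite /h -(fineK gfin) -!EFinD -!EFinM !lee_fin => gapb.
apply: (le_trans (monotone_below_gap (ltW L0)
  (fun u v u' v' => lipg w u u' v v') (gs Ds) _ _ (Y1 s w) (mf_term P theta1 Y1 t s w) j)).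
rewrite lerD2l /C -mulrA ler_wpM2l ?(ltW L0)// (mulrDl 1 q) mul1r.
have e0 : 0 <= fine (mean_gap s) by rewrite fine_ge0// mean_gap_ge0.
have -> : positive_gap (Y0 s w) (Y1 s w) = gap s w by rewrite /gap !(@horizon _ s sI').
by move: gapb; lra.
Qed.

End generator_integrals.

(** * The integral inequality for the mean gap *)

Section mean_zero_perturbation.
Context {R : realType} {d : measure_display} {X : measurableType d}.
Variable mu : {measure set X -> \bar R}.
Local Open Scope ereal_scope.

(** Moving the negative part of [q] to the right, [u + q^+ <= v + q^-], where
    [q^+] and [q^-] have the same finite integral. *)
Lemma le_integral_mean_zero (u v : X -> \bar R) (q : X -> R) :
  (forall x, 0 <= u x) -> measurable_fun setT u ->
  (forall x, 0 <= v x) -> measurable_fun setT v ->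
  mu.-integrable setT (EFin \o q) -> \int[mu]_x (q x)%:E = 0 ->
  {ae mu, forall x, u x + (q x)%:E <= v x} ->
  \int[mu]_x u x <= \int[mu]_x v x.
Proof.
move=> u0 mu_ v0 mv qi q0 uv.
have mq := measurable_int _ qi.
have pfin := integrable_pos_fin_num measurableT qi.
have nfin := integrable_neg_fin_num measurableT qi.
have pn : \int[mu]_x (EFin \o q)^\+ x = \int[mu]_x (EFin \o q)^\- x.
  move: q0; rewrite (integralE mu setT (EFin \o q)) => /eqP.
  by rewrite sube_eq ?add0e ?fin_num_adde_defr// => /eqP.
rewrite -(leeD2rE _ _ pfin) [in leRHS]pn.
rewrite -!ge0_integralD//; [|exact: measurable_funeneg|exact: measurable_funepos].
apply: ae_ge0_le_integral => //.
- by move=> x _; rewrite adde_ge0.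
- by apply: emeasurable_funD => //; exact: measurable_funepos.
- by move=> x _; rewrite adde_ge0.
- by apply: emeasurable_funD => //; exact: measurable_funeneg.
move: uv; apply: filterS => x uvx _.
rewrite funeposE funenegE/=.
have [q_ge0|/ltW q_le0] := leP 0%R (q x).
  by rewrite max_l// max_r ?adde0// lee_fin oppr_le0.
rewrite (_ : maxe (q x)%:E 0 = 0); last by apply/max_r; rewrite lee_fin.
rewrite max_l ?adde0; last by rewrite lee_fin oppr_ge0.
by rewrite EFinN leeBrDr//.
Qed.

End mean_zero_perturbation.

Section gap_inequality.
Context {R : realType} {d : measure_display} {Omega : measurableType d}.
Variables (P : probability Omega R) (W : R -> {RV P >-> R}) (T : R) (n m : nat).
Hypothesis P_complete : measure_is_complete P.
Hypothesis W_bm : is_brownian_motion W.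
Variables (Y0 Y1 : R -> Omega -> 'rV[R]_n).
Hypotheses (Y0_L2 : L2_process W T Y0) (Y1_L2 : L2_process W T Y1).
Local Notation mu := (@lebesgue_measure R).
Local Notation mR := (measurableTypeR R).
Local Notation RO := (mR * Omega)%type.
Local Notation gap := (gap T Y0 Y1).
Local Notation mean_gap := (mean_gap P T Y0 Y1).

(** The part of the pathwise estimate that remains after the stochastic integrals
    have been averaged out. *)
Definition gap_source (C t : R) (w : Omega) : \bar R :=
  (\int[mu]_(s in `[t, T]) (C%:E * ((gap s w)%:E + mean_gap s)))%E.

Lemma gap_source_ge0 C t w : 0 <= C -> (0 <= gap_source C t w)%E.
Proof.
move=> C0; apply: integral_ge0 => s _; rewrite mule_ge0// adde_ge0 ?mean_gap_ge0//.
by rewrite lee_fin positive_gap_ge0.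
Qed.

(** Tonelli: the mean of [gap s] and the constant [mean_gap s] contribute equally,
    which gives the factor 2. *)
Lemma integral_gap_source C t : 0 <= C ->
  measurable_fun setT (gap_source C t) /\
  (\int[P]_w gap_source C t w = (2 * C)%:E * \int[mu]_(s in `[t, T]) mean_gap s)%E.
Proof.
move=> C0.
pose f (p : RO) : \bar R := (C%:E * ((gap p.1 p.2)%:E + mean_gap p.1))%E.
have f0 p : (0 <= f p)%E.
  by rewrite mule_ge0// adde_ge0 ?mean_gap_ge0// lee_fin positive_gap_ge0.
have mgap := measurable_gap P_complete Y0_L2 Y1_L2.
have mmean := measurable_mean_gap P_complete Y0_L2 Y1_L2.
have mf : measurable_fun setT f.
  apply: emeasurable_funM => //; apply: emeasurable_funD; first exact/measurable_EFinP.
  exact: (measurableT_comp mmean).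
have mD : measurable ((`[t, T] : set mR) `*` setT : set RO).
  exact: measurableX.
pose J := f \_ ((`[t, T] : set mR) `*` setT : set RO).
have J0 p : (0 <= J p)%E by rewrite /J patchE; case: ifP.
have mJ : measurable_fun setT J.
  by apply/(measurable_restrictT _ mD); exact: measurable_funTS.
have JE s w : J (s, w) = ((fun s => f (s, w)) \_ `[t, T]) s.
  rewrite /J !patchE (_ : ((s, w) \in _) = (s \in `[t, T]%classic))//.
  by apply/idP/idP => [/set_mem[h _]|/set_mem h]; apply/mem_set.
have srcE : gap_source C t = fun w => (\int[mu]_s J (s, w))%E.
  apply/funext => w; rewrite /gap_source [LHS]integral_mkcond.
  by apply: eq_integral => s _; rewrite JE.
split; first by rewrite srcE; exact: measurable_fun_fubini_tonelli_G.
rewrite srcE -(fubini_tonelli J)//.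
transitivity (\int[mu]_(s in `[t, T]) ((2 * C)%:E * mean_gap s))%E; last first.
  rewrite ge0_integralZl//.
  - exact: measurable_funTS.
  - by move=> s _; exact: mean_gap_ge0.
  - by rewrite lee_fin mulr_ge0.
rewrite [RHS]integral_mkcond; apply: eq_integral => s _.
rewrite patchE; case: ifPn => st; last first.
  by apply: integral0_eq => w _; rewrite JE patchE (negbTE st).
under eq_integral do rewrite JE patchE st /f /=.
have mg : measurable_fun setT (fun w => (gap s w)%:E).
  by apply/measurable_EFinP; exact: (measurable_section_time (f := fun p => gap p.1 p.2)).
have g0 w : (0 <= (gap s w)%:E)%E by rewrite lee_fin positive_gap_ge0.
have e0 : (0 <= mean_gap s)%E by exact: mean_gap_ge0.
rewrite ge0_integralZl//; last 2 first.
- exact: emeasurable_funD.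
- by move=> w _; rewrite adde_ge0.
have e1 : (\int[P]_(_ in setT) mean_gap s = mean_gap s)%E.
  by rewrite integral_cst//= [X in (_ * X)%E]probability_setT mule1.
rewrite ge0_integralD// e1 -/(mean_gap s).
have -> : 2 * C = C + C by ring.
by rewrite EFinD ge0_muleDr// ge0_muleDl ?lee_fin.
Qed.

End gap_inequality.

Lemma ge0_integral_ae_lty {R : realType} {d : measure_display} {X : measurableType d}
    (mu : {measure set X -> \bar R}) (D : set X) (f : X -> \bar R) :
  measurable D -> measurable_fun D f -> (forall x, D x -> 0 <= f x)%E ->
  (\int[mu]_(x in D) f x < +oo)%E -> {ae mu, forall x, D x -> (f x < +oo)%E}.
Proof.
move=> mD mf f0 ffin.
have fi : mu.-integrable D f.
  apply/integrableP; split => //.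
  by under eq_integral => x /set_mem Dx do rewrite gee0_abs ?f0//.
have := integrable_ae mD fi; apply: filterS => x xfin Dx.
by rewrite -ge0_fin_numE ?f0//; exact: xfin.
Qed.

Section comparison.
Context {R : realType} {d : measure_display} {Omega : measurableType d}.
Variables (P : probability Omega R) (W : R -> {RV P >-> R}) (T : R) (n m : nat).
Hypothesis P_complete : measure_is_complete P.
Hypothesis W_bm : is_brownian_motion W.
Local Notation mu := (@lebesgue_measure R).
Local Notation mR := (measurableTypeR R).
Local Notation RO := (mR * Omega)%type.

Lemma integral_norm1_ae_lty (Y : R -> Omega -> 'rV[R]_n) : L2_process W T Y ->
  {ae P, forall w, (\int[mu]_(s in `[0%R, T]) (norm1 (on_horizon T Y s w))%:E < +oo)%E}.
Proof.
move=> YL2.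
have h : measurable_fun setT (fun w =>
    \int[mu]_(s in `[0%R, T]) (norm1 (on_horizon T Y s w))%:E)%E.
  under eq_fun do rewrite -integral_norm1_on_horizon.
  apply: (measurable_fun_fubini_tonelli_G
    (fun p : RO => (norm1 (on_horizon T Y p.1 p.2))%:E)).
    by apply/measurable_EFinP; exact: (measurable_norm1_on_horizon P_complete YL2).
  by move=> p; rewrite lee_fin norm1_ge0.
have := ge0_integral_ae_lty measurableT h _ (integral_norm1_lty YL2).
have h0 w : (0 <= \int[mu]_(s in `[0%R, T]) (norm1 (on_horizon T Y s w))%:E)%E.
  by apply: integral_ge0 => s _; rewrite lee_fin norm1_ge0.
by move=> /(_ (fun w _ => h0 w)); apply: filterS => w; exact.
Qed.

Lemma mean_norm_ae_lty (Y : R -> Omega -> 'rV[R]_n) : L2_process W T Y ->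
  {ae mu, forall s : R, (mean_norm P T Y s < +oo)%E}.
Proof.
move=> YL2.
have mtT : measurable (`[0%R, T]%classic : set mR) by [].
have mm := measurable_funTS (D := `[0%R, T]%classic) (measurable_mean_norm P_complete YL2).
have := ge0_integral_ae_lty mtT mm (fun s _ => mean_norm_ge0 P T Y s)
  (integral_mean_norm_lty P_complete YL2).
apply: (filterS (Filter := ae_filter_ringOfSetsType mu)) => s.
rewrite /= in_itv/=; case: (boolP (0 <= s <= T)) => [_|sT _]; first exact.
rewrite /mean_norm integral0_eq// => w _.
by rewrite /on_horizon (negbTE sT) /norm1 big1// => j _; rewrite mxE normr0.
Qed.

Variables (Y0 Y1 : R -> Omega -> 'rV[R]_n).
Hypotheses (Y0_L2 : L2_process W T Y0) (Y1_L2 : L2_process W T Y1).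

Lemma integral_mean_gap_lty :
  (\int[mu]_(s in `[0%R, T]) mean_gap P T Y0 Y1 s < +oo)%E.
Proof.
have mA0 := measurable_mean_norm P_complete Y0_L2.
have mA1 := measurable_mean_norm P_complete Y1_L2.
have mn (Y : R -> Omega -> 'rV[R]_n) s : L2_process W T Y ->
    measurable_fun setT (fun w => (norm1 (on_horizon T Y s w))%:E).
  move=> YL2; apply/measurable_EFinP.
  apply: (measurable_section_time (f := fun p => norm1 (on_horizon T Y p.1 p.2))).
  exact: (measurable_norm1_on_horizon P_complete YL2).
have mtT : measurable (`[0%R, T]%classic : set mR) by [].
apply: (@le_lt_trans _ _ (\int[mu]_(s in `[0%R, T])
   (mean_norm P T Y0 s + mean_norm P T Y1 s))%E); last first.
  rewrite ge0_integralD//.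
  - apply: lte_add_pinfty.
      exact: (integral_mean_norm_lty P_complete Y0_L2).
    exact: (integral_mean_norm_lty P_complete Y1_L2).
  - by move=> s _; exact: mean_norm_ge0.
  - exact: measurable_funTS.
  - by move=> s _; exact: mean_norm_ge0.
  - exact: measurable_funTS.
apply: ge0_le_integral => //.
- by move=> s _; exact: mean_gap_ge0.
- by apply: measurable_funTS; exact: (measurable_mean_gap P_complete Y0_L2 Y1_L2).
- by apply: measurable_funTS; exact: emeasurable_funD.
move=> s _; rewrite /mean_norm -ge0_integralD//; last 4 first.
- by move=> w _; rewrite lee_fin norm1_ge0.
- exact: mn.
- by move=> w _; rewrite lee_fin norm1_ge0.
- exact: mn.
apply: ge0_le_integral => //.
- by move=> w _; rewrite lee_fin positive_gap_ge0.
- apply/measurable_EFinP.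
  apply: (measurable_section_time (f := fun p => gap T Y0 Y1 p.1 p.2)).
  exact: (measurable_gap P_complete Y0_L2 Y1_L2).
- by apply: emeasurable_funD; exact: mn.
- by move=> w _; rewrite -EFinD lee_fin positive_gap_le.
Qed.

Variables (g0 g1 : generator (R := R) (Omega := Omega) n m).
Variables (theta0 theta1 : mf_coefficient (R := R) (Omega := Omega) n m).
Hypotheses (hyp0 : standing_hypotheses W T g0 theta0).
Hypotheses (hyp1 : standing_hypotheses W T g1 theta1).
Variables (psi0 psi1 : R -> Omega -> 'rV[R]_n).
Variables (Z0 Z1 : R -> R -> Omega -> 'rV[R]_n).
Hypothesis psi_le : forall t, 0 <= t <= T ->
  {ae P, forall w, le_vec (psi0 t w) (psi1 t w)}.
Hypotheses (sol0 : adapted_M_solution W T psi0 g0 theta0 Y0 Z0).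
Hypotheses (sol1 : adapted_M_solution W T psi1 g1 theta1 Y1 Z1).
Hypothesis generator_le :
  {ae mu, forall t : R, {ae P, forall w, {ae mu, forall s : R, Delta T (t, s) ->
     monotone_below (g0 t s w) (g1 t s w)}}}.
Hypothesis mf_coefficient_le :
  {ae mu, forall t : R, {ae P, forall w, {ae mu, forall s : R, {ae P, forall w',
     Delta T (t, s) -> monotone_below (theta0 t s w w') (theta1 t s w w')}}}}.

(** On the event [A] where the [j]-th coordinate of [Y0 t] exceeds that of [Y1 t],
    subtract the two equations: the free terms help, the drifts are compared by
    [generator_integral_comparison], and the difference of the Ito integrals
    over [[t, T]] has mean zero on [A], since [A] is known at time [t]. *)
Lemma mean_gap_inequality : exists2 K : R, 0 < K &
  {ae mu, forall t : R, 0 <= t <= T ->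
    (mean_gap P T Y0 Y1 t <=
     K%:E * \int[mu]_(s in `[t, T]) mean_gap P T Y0 Y1 s)%E}.
Proof.
have [C C0 cmp] := generator_integral_comparison P_complete Y0_L2 Y1_L2 hyp0 hyp1.
(* The sum over the coordinates gives [n * 4 C]; adding 1 keeps the constant
   positive when [n] is 0. *)
exists (n%:R * (4 * C) + 1); first by rewrite ltr_wpDl// mulr_ge0// mulr_ge0// ltW.
have nf0 := integral_norm1_ae_lty Y0_L2.
have nf1 := integral_norm1_ae_lty Y1_L2.
have mf0 := mean_norm_ae_lty Y0_L2.
have mf1 := mean_norm_ae_lty Y1_L2.
have hmono := @filterI _ _ (ae_filter_ringOfSetsType mu) _ _ generator_le mf_coefficient_le.
have heq := @filterI _ _ (ae_filter_ringOfSetsType mu) _ _ (bsvie sol0) (bsvie sol1).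
have := @filterI _ _ (ae_filter_ringOfSetsType mu) _ _ hmono heq.
apply: (filterS (Filter := ae_filter_ringOfSetsType mu)).
move=> t [[gle thle] [eq0 eq1]] tT.
have [I0 [ito0 {}eq0]] := eq0 tT; have [I1 [ito1 {}eq1]] := eq1 tT.
have /andP[t0 _] := tT.
have gapE w : gap T Y0 Y1 t w = positive_gap (Y0 t w) (Y1 t w).
  by rewrite /gap /on_horizon tT.
set E := (\int[mu]_(s in `[t, T]) mean_gap P T Y0 Y1 s)%E.
have E0 : (0 <= E)%E by apply: integral_ge0 => s _; exact: mean_gap_ge0.
have [msrc isrc] := integral_gap_source P_complete Y0_L2 Y1_L2 t (ltW C0).
have src0 w := @gap_source_ge0 _ _ _ P T n Y0 Y1 C t w (ltW C0).
pose part (j : 'I_n) w : R := Num.max (Y0 t w 0 j - Y1 t w 0 j) 0.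
have madapted (Y : R -> Omega -> 'rV[R]_n) j :
    @measurable_fun _ _ (g_sigma_algebraType (bm_filtration W t)) (borel_rV R n) setT (Y t) ->
    @measurable_fun _ _ (g_sigma_algebraType (bm_filtration W t)) R setT (fun w => Y t w 0 j).
  by move=> mY; exact: (measurableT_comp (measurable_coord j) mY).
have mdiff j : @measurable_fun _ _ (g_sigma_algebraType (bm_filtration W t)) R setT
    (fun w => Y0 t w 0 j - Y1 t w 0 j).
  apply: measurable_funB; apply: madapted.
    exact: (Y_adapted sol0 tT).
  exact: (Y_adapted sol1 tT).
have mpart j : measurable_fun setT (fun w => (part j w)%:E).
  apply/measurable_EFinP; apply: measurable_maxr => //.
  exact: (adapted_measurable_fun P_complete (mdiff j)).
have part0 j w : (0 <= (part j w)%:E)%E by rewrite lee_fin le_max lexx orbT.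
have bound j : (\int[P]_w (part j w)%:E <= (4 * C)%:E * E)%E.
  have -> : ((4 * C)%:E * E = \int[P]_w (2%:E * gap_source P T Y0 Y1 C t w))%E.
    rewrite ge0_integralZl// isrc muleA -EFinM; congr (_%:E * _)%E; ring.
  (* [A] is determined by the values at time [t], hence lies in the past of [t]. *)
  pose A : set Omega := (fun w => Y0 t w 0 j - Y1 t w 0 j) @^-1` `]0, +oo[.
  have FA : bm_filtration W t A by apply: (adapted_preimage (Y := R) (mdiff j)).
  have mA := bm_filtration_measurable P_complete FA.
  have [Ii0 z0] := ito_integral_mean P_complete W_bm t0 (ito0 j) FA.
  have [Ii1 z1] := ito_integral_mean P_complete W_bm t0 (ito1 j) FA.
  pose q w := \1_A w * I0 w 0 j - \1_A w * I1 w 0 j.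
  have iA (I : Omega -> R) : P.-integrable setT (EFin \o I) ->
      P.-integrable setT (EFin \o (fun w => \1_A w * I w)).
    move=> Ii; rewrite (_ : EFin \o _ = (EFin \o I) \_ A); last first.
      apply/funext => w; rewrite /= patchE indicE.
      by case: ifP => _; rewrite ?mul1r ?mul0r.
    rewrite -(integrable_mkcond _ mA). apply: (integrableS measurableT) => //.
  apply: (le_integral_mean_zero (q := q)) => //.
  - by move=> w; rewrite mule_ge0.
  - exact: emeasurable_funM.
  - exact: (integrableB measurableT (iA _ Ii0) (iA _ Ii1)).
  - rewrite /q; under eq_integral do rewrite EFinB.
    by rewrite integralB//; [rewrite z0 z1 sube0|exact: iA|exact: iA].
  have pj := psi_le tT.
  near=> w.
  have hY0 : Y0 t w = psi0 t w + vec_integral mu `[t, T]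
      (fun s => g0 t s w (Y0 s w) (mf_term P theta0 Y0 t s w)) - I0 w by near: w.
  have hY1 : Y1 t w = psi1 t w + vec_integral mu `[t, T]
      (fun s => g1 t s w (Y1 s w) (mf_term P theta1 Y1 t s w)) - I1 w by near: w.
  have hpsi : le_vec (psi0 t w) (psi1 t w) by near: w.
  have hg : {ae mu, forall s : R, Delta T (t, s) -> monotone_below (g0 t s w) (g1 t s w)}.
    by near: w.
  have hth : {ae mu, forall s : R, {ae P, forall w', Delta T (t, s) ->
      monotone_below (theta0 t s w w') (theta1 t s w w')}} by near: w.
  have hn0 : (\int[mu]_(s in `[0%R, T]) (norm1 (on_horizon T Y0 s w))%:E < +oo)%E by near: w.
  have hn1 : (\int[mu]_(s in `[0%R, T]) (norm1 (on_horizon T Y1 s w))%:E < +oo)%E by near: w.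
  have := cmp t w j t0 hg hth mf0 mf1 hn0 hn1.
  rewrite -/(gap_source P T Y0 Y1 C t w).
  have [wA|wA] := boolP (w \in A); last first.
    rewrite /q indicE (negbTE wA) !mul0r subrr adde0 => _.
    rewrite /part max_r; first by rewrite mule_ge0.
    by move: wA; rewrite notin_setE /A /= in_itv/= andbT => /negP; rewrite -leNgt.
  rewrite /q indicE wA !mul1r /part max_l; last first.
    by move: wA => /set_mem; rewrite /A /= in_itv/= andbT => /ltW.
  have dY := congr1 (fun x : 'rV[R]_n => x 0 j) hY0.
  have dY' := congr1 (fun x : 'rV[R]_n => x 0 j) hY1.
  move: dY dY' (hpsi j); rewrite /vec_integral !mxE.
  set J0 := (\int[_]_(_ in _) _)%R; set J1 := (\int[_]_(_ in _) _)%R.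
  move=> -> -> psij.
  case: (gap_source P T Y0 Y1 C t w) (src0 w) => [r| |]//= _.
    rewrite -EFinM -!EFinD !lee_fin; lra.
  by move=> _; rewrite gt0_muley// leey.
rewrite {1}/mean_gap.
under eq_integral do rewrite gapE /positive_gap -sumEFin.
rewrite ge0_integral_sum//; last by move=> j w _; exact: part0.
apply: (@le_trans _ _ (\sum_(j < n) (4 * C)%:E * E)%E).
  by apply: lee_sum => j _; exact: bound.
case: E E0 {bound} => [r| |]//= r0; last first.
  have C40 : 0 <= n%:R * (4 * C) by rewrite !mulr_ge0// ltW.
  by rewrite [leRHS]gt0_muley ?leey// lte_fin ltr_wpDl.
rewrite -EFinM sumEFin sumr_const card_ord -mulr_natl lee_fin.
by move: r0; rewrite lee_fin; lra.
Unshelve. all: by end_near.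
Qed.

End comparison.

Theorem theorem5p9 (R : realType) (d : measure_display)
  (Omega : measurableType d) (P : probability Omega R)
  (W : R -> {RV P >-> R}) (T : R) (n m : nat)
  (g0 g1 : generator (R := R) (Omega := Omega) n m)
  (theta0 theta1 : mf_coefficient (R := R) (Omega := Omega) n m)
  (psi0 psi1 Y0 Y1 : R -> Omega -> 'rV[R]_n)
  (Z0 Z1 : R -> R -> Omega -> 'rV[R]_n)
  (T_gt0 : 0 < T)
  (P_complete : measure_is_complete P)
  (W_bm : is_brownian_motion W)
  (hyp0 : standing_hypotheses W T g0 theta0)
  (hyp1 : standing_hypotheses W T g1 theta1)
  (g0_theta0_jacobians :
    forall (y y' : 'rV[R]_n) (gamma : 'rV[R]_m),
    {ae (lebesgue_measure \x lebesgue_measure)%E, forall p : R * R, Delta T p ->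
      {ae P, forall w,
        [/\ has_jacobian (fun c => g0 p.1 p.2 w y c) gamma,
            nonneg_mx (jacobian_mx (fun c => g0 p.1 p.2 w y c) gamma),
            has_jacobian (fun x => g0 p.1 p.2 w x gamma) y &
            nonneg_mx (jacobian_mx (fun x => g0 p.1 p.2 w x gamma) y)]} /\
      {ae (P \x P)%E, forall q : Omega * Omega,
        [/\ has_jacobian (fun x' => theta0 p.1 p.2 q.1 q.2 y x') y',
            nonneg_mx (jacobian_mx (fun x' => theta0 p.1 p.2 q.1 q.2 y x') y'),
            has_jacobian (fun x => theta0 p.1 p.2 q.1 q.2 x y') y &
            nonneg_mx (jacobian_mx (fun x => theta0 p.1 p.2 q.1 q.2 x y') y)]}})
  (g_theta_le :
    forall (y y' : 'rV[R]_n) (gamma : 'rV[R]_m),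
    {ae (lebesgue_measure \x lebesgue_measure)%E, forall p : R * R, Delta T p ->
      {ae P, forall w,
        le_vec (g0 p.1 p.2 w y gamma) (g1 p.1 p.2 w y gamma)} /\
      {ae (P \x P)%E, forall q : Omega * Omega,
        le_vec (theta0 p.1 p.2 q.1 q.2 y y') (theta1 p.1 p.2 q.1 q.2 y y')}})
  (psi0_L2 : L2_process W T psi0)
  (psi1_L2 : L2_process W T psi1)
  (psi_le : forall t, 0 <= t <= T ->
    {ae P, forall w, le_vec (psi0 t w) (psi1 t w)})
  (sol0 : adapted_M_solution W T psi0 g0 theta0 Y0 Z0)
  (sol1 : adapted_M_solution W T psi1 g1 theta1 Y1 Z1) :
  {ae lebesgue_measure, forall t : R, 0 <= t <= T ->
    {ae P, forall w, le_vec (Y0 t w) (Y1 t w)}}.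
Proof.
have Y0_L2 := Y_L2 sol0; have Y1_L2 := Y_L2 sol1.
have gle := generator_comparison hyp0 hyp1 g0_theta0_jacobians g_theta_le.
have thle := mf_coefficient_comparison hyp0 hyp1 g0_theta0_jacobians g_theta_le.
have [K K0 ineq] := mean_gap_inequality P_complete W_bm Y0_L2 Y1_L2 hyp0 hyp1
  psi_le sol0 sol1 gle thle.
have := gronwall_backward K0 (measurable_mean_gap P_complete Y0_L2 Y1_L2)
  (fun t => mean_gap_ge0 P T Y0 Y1 t)
  (integral_mean_gap_lty P_complete Y0_L2 Y1_L2) ineq.
apply: (filterS (Filter := ae_filter_ringOfSetsType _)) => t mean0 tT.
have mgap : measurable_fun setT (fun w => (gap T Y0 Y1 t w)%:E).
  apply/measurable_EFinP.
  apply: (measurable_section_time (f := fun p => gap T Y0 Y1 p.1 p.2)).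
  exact: (measurable_gap P_complete Y0_L2 Y1_L2).
have [gap0 _] := ae_eq_integral_abs P measurableT mgap.

have : (\int[P]_w `|(gap T Y0 Y1 t w)%:E| = 0)%E.
  rewrite -[RHS](mean0 tT); apply: eq_integral => w _.
  by rewrite gee0_abs// lee_fin positive_gap_ge0.
move=> /gap0; apply: filterS => w /(_ I) [].
rewrite /gap /on_horizon tT => /positive_gap0.
exact.
Qed.
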